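(* Let $\Sigma$ be a minimal surface in $\mathbb{R}^3$ with Gauss curvature $\mathcal{K}<0$ everywhere and unit normal vector field $\mathbf{n}$. Suppose there exist two orthogonal constant unit vector fields $\mathbf{V}_1$ and $\mathbf{V}_2$ in $\mathbb{R}^3$ such that, with $\mathbf{n}_{\mathbf{V}_1}=\langle \mathbf{n},\mathbf{V}_1\rangle_{\mathbb{R}^3}$ and $\mathbf{n}_{\mathbf{V}_2}=\langle \mathbf{n},\mathbf{V}_2\rangle_{\mathbb{R}^3}$, the function $$\ln \frac{\left(1-\mathbf{n}_{\mathbf{V}_1}^{2}\right)\left(1-\mathbf{n}_{\mathbf{V}_2}^{2}\right)}{-\mathcal{K}}$$ is constant. Then, up to homotheties, $\Sigma$ is congruent to (a part of) a member of the associate family connecting a doubly periodic Scherk graph and a singly periodic Scherk tower.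
   Context: A minimal surface means a connected, oriented, immersed surface in $\mathbb{R}^3$ with zero mean curvature. Congruent means equal up to an isometry of $\mathbb{R}^3$. The logarithmic function in the claim is considered at the points where its argument is positive. Weierstrass data: a non-planar minimal surface is (locally, or on its universal cover) given by a pair $(\mathbf{G},d\mathbf{h})$, where the meromorphic function $\mathbf{G}$ is the stereographic projection (from the north pole) of the Gauss map and $d\mathbf{h}$ is the holomorphic one-form with $\mathrm{Re}\, d\mathbf{h}=d\mathbf{x}_3$, via $$d\mathbf{x}_1=\mathrm{Re}\Big(\tfrac12\big(\tfrac1{\mathbf{G}}-\mathbf{G}\big)d\mathbf{h}\Big),\quad d\mathbf{x}_2=\mathrm{Re}\Big(\tfrac i2\big(\tfrac1{\mathbf{G}}+\mathbf{G}\big)d\mathbf{h}\Big),\quad d\mathbf{x}_3=\mathrm{Re}(d\mathbf{h}).$$ The associate family $\{\Sigma_\theta\}_{\theta\in[0,\pi/2]}$ of $\Sigma_0$ with data $(\mathbf{G},d\mathbf{h})$ consists of the minimal surfaces $\Sigma_\theta$ with data $(\mathbf{G},e^{i\theta}d\mathbf{h})$; $\Sigma_{\pi/2}$ is the conjugate surface of $\Sigma_0$. Up to congruence and homothety, the doubly periodic Scherk graph is the complete minimal surface having as fundamental piece the graph $z=\ln\left(\frac{\cos y}{\cos x}\right)$, $-\frac{\pi}{2}<x,y<\frac{\pi}{2}$; its Weierstrass data is $\frac{1}{\mathbf{G}}d\mathbf{h}=\frac{1}{\mathbf{G}^4-1}d\mathbf{G}$. The singly periodic Scherk tower is its conjugate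 surface. The associate family connecting them consists of the minimal surfaces with data $\frac1{\mathbf{G}}d\mathbf{h}=\frac{e^{i\theta}}{\mathbf{G}^4-1}d\mathbf{G}$, $\theta\in[0,\frac{\pi}{2}]$, defined on the universal cover of $(\mathbb{C}\cup\{\infty\})\setminus\{\pm1,\pm i\}$, with $\mathbf{G}$ the covering map. *)

(* Defs.v *)
From HB Require Import structures.
From mathcomp Require Import all_boot all_order all_algebra.
From mathcomp Require Import all_classical all_reals all_analysis.
From mathcomp Require Import complex.

Set Implicit Arguments.
Unset Strict Implicit.
Unset Printing Implicit Defensive.

Import Order.TTheory GRing.Theory Num.Theory.
Import numFieldNormedType.Exports.

Local Open Scope classical_set_scope.
Local Open Scope ring_scope.
Local Open Scope complex_scope.

(** * Euclidean 3-space *)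

Definition vec3 (R : realType) (a b c : R) : 'rV[R]_3 :=
  \row_(i < 3) [:: a; b; c]`_i.

Definition dot (R : realType) (x y : 'rV[R]_3) : R :=
  \sum_(i < 3) x 0 i * y 0 i.

(* The library norm of a matrix is the sup norm, hence a Euclidean one. *)
Definition enorm (R : realType) (x : 'rV[R]_3) : R := Num.sqrt (dot x x).

Definition cross (R : realType) (x y : 'rV[R]_3) : 'rV[R]_3 :=
  let x0 := x 0 (inord 0) in let x1 := x 0 (inord 1) in
  let x2 := x 0 (inord 2) in let y0 := y 0 (inord 0) in
  let y1 := y 0 (inord 1) in let y2 := y 0 (inord 2) in
  vec3 (x1 * y2 - x2 * y1) (x2 * y0 - x0 * y2) (x0 * y1 - x1 * y0).

Definition euclidean_isometry (R : realType) (f : 'rV[R]_3 -> 'rV[R]_3) : Prop :=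
  forall x y, enorm (f x - f y) = enorm (x - y).

(** * Smooth functions of two real variables *)

Fixpoint Ck (R : realType) (V : normedModType R) (k : nat)
    (U : set 'rV[R]_2) (f : 'rV[R]_2 -> V) : Prop :=
  match k with
  | 0 => {in U, continuous f}
  | k'.+1 => (forall x, U x -> differentiable f x) /\
             (forall v, Ck k' U ('D_v f))
  end.

Definition smooth (R : realType) (V : normedModType R)
    (U : set 'rV[R]_2) (f : 'rV[R]_2 -> V) : Prop :=
  forall k, Ck k U f.

(** * Local geometry of a parametrized surface *)

Section LocalGeometry.
Context {R : realType}.
Implicit Types (f : 'rV[R]_2 -> 'rV[R]_3) (x : 'rV[R]_2).

Definition pd (i : 'I_2) f : 'rV[R]_2 -> 'rV[R]_3 := 'D_(delta_mx 0 i) f.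

Definition unit_normal f x : 'rV[R]_3 :=
  let w := cross (pd 0 f x) (pd 1 f x) in (enorm w)^-1 *: w.

Definition fst_form (i j : 'I_2) f x : R := dot (pd i f x) (pd j f x).

Definition snd_form (i j : 'I_2) f x : R := dot (pd i (pd j f) x) (unit_normal f x).

Definition gauss_curv f x : R :=
  (snd_form 0 0 f x * snd_form 1 1 f x - snd_form 0 1 f x ^+ 2) /
  (fst_form 0 0 f x * fst_form 1 1 f x - fst_form 0 1 f x ^+ 2).

Definition mean_curv f x : R :=
  (fst_form 0 0 f x * snd_form 1 1 f x - 2 * fst_form 0 1 f x * snd_form 0 1 f x
     + fst_form 1 1 f x * snd_form 0 0 f x) /
  (2 * (fst_form 0 0 f x * fst_form 1 1 f x - fst_form 0 1 f x ^+ 2)).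

End LocalGeometry.

(** * Connected oriented smooth surfaces *)

(* A chart is given by its local parametrization [par], defined on [dom], and
   by the inverse [coord], defined on the image of [dom]; outside these sets
   the values of [par] and [coord] are irrelevant. *)
Record chart (R : realType) (M : topologicalType) := Chart {
  dom : set 'rV[R]_2;
  par : 'rV[R]_2 -> M;
  coord : M -> 'rV[R]_2
}.

Definition chart_image (R : realType) (M : topologicalType) (c : chart R M) : set M :=
  par c @` dom c.

Definition chart_axiom (R : realType) (M : topologicalType) (c : chart R M) : Prop :=
  [/\ open (dom c), open (chart_image c),
      {within dom c, continuous (par c)},
      {within chart_image c, continuous (coord c)} &
      forall x, dom c x -> coord c (par c x) = x].

Definition oriented_compatible (R : realType) (M : topologicalType)
    (c1 c2 : chart R M) : Prop :=
  let W := dom c1 `&` par c1 @^-1` chart_image c2 in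
  let transition := coord c2 \o par c1 in
  smooth W transition /\ (forall x, W x -> 0 < \det ('J transition x)).

Record surface (R : realType) := Surface {
  surface_space :> topologicalType;
  atlas : set (chart R surface_space);
  surface_hausdorff : hausdorff_space surface_space;
  surface_second_countable : @second_countable surface_space;
  surface_connected : connected [set: surface_space];
  atlas_chart : forall c, atlas c -> chart_axiom c;
  atlas_cover : forall p, exists2 c, atlas c & chart_image c p;
  atlas_oriented : forall c1 c2, atlas c1 -> atlas c2 -> oriented_compatible c1 c2
}.

Section Immersions.
Context {R : realType} {M : surface R}.
Implicit Type X : M -> 'rV[R]_3.

Definition immersion X : Prop :=
  forall c, atlas c -> smooth (dom c) (X \o par c) /\
    (forall x, dom c x -> cross (pd 0 (X \o par c) x) (pd 1 (X \o par c) x) <> 0).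

Definition gauss_map X (n : M -> 'rV[R]_3) : Prop :=
  forall c, atlas c -> forall x, dom c x ->
    n (par c x) = unit_normal (X \o par c) x.

Definition gauss_curvature X (K : M -> R) : Prop :=
  forall c, atlas c -> forall x, dom c x ->
    K (par c x) = gauss_curv (X \o par c) x.

Definition minimal_immersion X : Prop :=
  immersion X /\
  (forall c, atlas c -> forall x, dom c x -> mean_curv (X \o par c) x = 0).

End Immersions.

(** * Coverings and simple connectedness *)

(* [s] is the inverse of the homeomorphism from the sheet [S] onto the evenly
   covered relatively open set [V `&` B]. *)
Definition covering_map (P T : topologicalType) (B : set T) (f : P -> T) : Prop :=
  [/\ continuous f, f @` [set: P] = B &
    forall b, B b -> exists V : set T, [/\ open V, V b &
      exists sheets : set (set P),
      [/\ trivIset sheets id,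
          \bigcup_(S in sheets) S = f @^-1` V &
          forall S, sheets S -> open S /\ exists s : T -> P,
            [/\ {within V `&` B, continuous s},
                forall y, (V `&` B) y -> S (s y) /\ f (s y) = y &
                forall q, S q -> s (f q) = q]]]].

Definition local_homeomorphism (P Q : topologicalType) (F : P -> Q) : Prop :=
  [/\ continuous F, forall U, open U -> open (F @` U) &
      forall q, exists2 U, open_nbhs q U & {in U &, injective F}].

Definition simply_connected (R : realType) (T : topologicalType) : Prop :=
  (forall x y : T, exists g : R -> T,
     [/\ {within `[0, 1]%classic, continuous g}, g 0 = x & g 1 = y]) /\
  (forall g : R -> T, {within `[0, 1]%classic, continuous g} -> g 0 = g 1 ->
     exists h : R * R -> T,
       {within `[0, 1]%classic `*` `[0, 1]%classic, continuous h} /\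
       (forall t : R, 0 <= t <= 1 ->
          [/\ h (0, t) = g t, h (1, t) = g 0, h (t, 0) = g 0 & h (t, 1) = g 0])).

(* The immersed surface [X] is (a part of) the immersed surface [Y].  Neither
   is assumed embedded or simply connected, so a map [M -> N] through which [X]
   factors exists in general only on a covering of [M] (for instance, when [N]
   is simply connected and [M] is not); [F] is then automatically a local
   diffeomorphism because [X] and [Y] are immersions. *)
Definition part_of (R : realType) (M N : surface R)
    (X : M -> 'rV[R]_3) (Y : N -> 'rV[R]_3) : Prop :=
  exists (P : topologicalType) (pi : P -> M) (F : P -> N),
    [/\ covering_map [set: M] pi, local_homeomorphism F &
        forall q, X (pi q) = Y (F q)].

(** * Weierstrass data *)

(* The Riemann sphere is the unit sphere, [stereo] being the stereographic
   projection from the north pole, which represents the point at infinity; the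
   value of [stereo] at the north pole is meaningless. *)
Definition north (R : realType) : 'rV[R]_3 := vec3 0 0 1.

Definition stereo (R : realType) (n : 'rV[R]_3) : R[i] :=
  let d := 1 - n 0 (inord 2) in (n 0 (inord 0) / d) +i* (n 0 (inord 1) / d).

Definition expi (R : realType) (theta : R) : R[i] := cos theta +i* sin theta.

(* A complex-valued one-form, read in each chart: [w c x v] is its value at
   [par c x] on the tangent vector with coordinates [v] in [c]. *)
Definition one_form (R : realType) (M : topologicalType) :=
  chart R M -> 'rV[R]_2 -> 'rV[R]_2 -> R[i].

Definition differential (R : realType) (M : topologicalType) (G : M -> R[i]) :
    one_form R M :=
  fun c x v => 'D_v (fun y => complex.Re (G (par c y))) x
            +i* 'D_v (fun y => complex.Im (G (par c y))) x.

Section Weierstrass.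
Context {R : realType} {M : surface R}.
Implicit Types (X nu : M -> 'rV[R]_3) (dh : one_form R M).

(* [nu] is the Gauss map of [X] as a map to the Riemann sphere and
   [G := stereo \o nu]; the formulas are required where [G] is neither 0 nor
   infinity and extend to these isolated points by continuity. *)
Definition weierstrass_data X nu dh : Prop :=
  gauss_map X nu /\
  (forall c, atlas c -> forall x, dom c x ->
     let G := stereo (nu (par c x)) in
     nu (par c x) <> north R -> G <> 0 ->
     forall v, 'D_v (X \o par c) x =
       vec3 (complex.Re (1 / 2 * (1 / G - G) * dh c x v))
            (complex.Re ('i / 2 * (1 / G + G) * dh c x v))
            (complex.Re (dh c x v))).

(* (1/G) dh = dG / (G^4 - 1) *)
Definition scherk_form nu dh : Prop :=
  forall c, atlas c -> forall x, dom c x ->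
    let G := stereo (nu (par c x)) in
    nu (par c x) <> north R -> G <> 0 ->
    forall v, 1 / G * dh c x v =
      1 / (G ^+ 4 - 1) * differential (fun p => stereo (nu p)) c x v.

End Weierstrass.

(* The Riemann sphere minus 1, -1, i, -i. *)
Definition punctured_sphere (R : realType) : set 'rV[R]_3 :=
  [set n | enorm n = 1 /\
           (n = north R \/ stereo n \notin [:: 1; -1; 'i; - 'i])].

(* The associate family from the doubly periodic Scherk graph (theta = 0) to the
   singly periodic Scherk tower (theta = pi / 2), on the universal cover [D] of
   the punctured sphere. *)
Definition scherk_associate_family (R : realType) (D : surface R)
    (S : R -> D -> 'rV[R]_3) : Prop :=
  simply_connected R D /\
  exists (nu : D -> 'rV[R]_3) (dh : one_form R D),
    [/\ covering_map (@punctured_sphere R) nu, scherk_form nu dh &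
      forall theta, 0 <= theta <= pi / 2 ->
        minimal_immersion (S theta) /\
        weierstrass_data (S theta) nu (fun c x v => expi theta * dh c x v)].

(* Main.v *)
Require Import Defs.
From mathcomp Require Import all_boot all_order all_algebra.
From mathcomp Require Import all_classical all_reals all_analysis.
From mathcomp Require Import complex ring lra.

(** Take an orthonormal frame whose first two vectors [e0], [e1] are [V1], [V2].
    Up to a homothety, the differential of a Scherk graph, as a function of its
    unit normal [n], is [dn |-> L n dn], where [L n] is a traceless symmetric
    operator of the plane orthogonal to [n] with
    [|L n v|^2 = |v|^2 / ((1 - n0^2) (1 - n1^2))]; its associate surfaces have
    differential [cos t L n dn + sin t (n x L n dn)].
    On a minimal surface [X] with [K < 0] the Gauss map is conformal and
    orientation-reversing, so [dX = a L n dn + b (n x L n dn)] for some functions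
    [a], [b], and the assumption says exactly that [a^2 + b^2] is constant.
    Differentiating, the closedness of [dX], [L n dn] and [n x L n dn] forces [a]
    and [b] to be constant.  Reflections bring [(a, b)] to the quadrant
    [0 <= t <= pi / 2], so that [X] and a member of the family have the same
    differential as functions of the normal.  Their difference is then locally
    constant on the fibre product of the two Gauss maps, and a level set of it
    is the covering through which [X] factors. *)

Set Implicit Arguments.
Unset Strict Implicit.
Unset Printing Implicit Defensive.

Import Order.TTheory GRing.Theory Num.Theory.
Import numFieldNormedType.Exports.

Local Open Scope classical_set_scope.
Local Open Scope ring_scope.

(** * Functions of class C^k on the plane *)

(** The operators [L n] fit because both they and the differential of the normal of a minimal
    surface are conformal and reverse orientation. Hence [L n dn] is conformal and preserves
    orientation, as [dX] does when read in the tangent plane, and the two can only differ by a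
    rotation and a dilation; [a] and [b] are its coefficients.

    Two kinds of points obstruct the comparison. At the normals [+- e0], [+- e1] the operator [L n]
    has no meaning, and the argument of the logarithm vanishes, so the assumption is silent exactly
    where it is wanted. At [+- e2] the Weierstrass formulas are silent. In both cases a locally
    injective Gauss map makes the bad points isolated and an identity passes to the limit; in the
    first case the limit contradicts [K < 0], so these normals never occur.

    The last obstacle is regularity: a covering supplies local sections that are only known to be
    continuous, while the two surfaces have to be compared through their differentials. Two-sided
    Lipschitz control of an immersion near a point bridges this gap. *)

Section Calculus.
Context {R : realType}.
Implicit Types (U : set 'rV[R]_2) (f g : 'rV[R]_2 -> R).

Lemma is_diff_of_bound (V W : normedModType R) (f : V -> W)
    (df : {linear V -> W}) x :
  continuous df ->
  (forall e, 0 < e -> \forall y \near x,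
     `|f y - f x - df (y - x)| <= e * `|y - x|) ->
  is_diff x f df.
Proof.
move=> cdf H.
have E : f \o shift x = cst (f x) + df +o_ 0 id.
  apply/eqaddoP => e e0.
  have := H e e0; rewrite (near_shift 0 x); apply: filterS => h /=.
  by rewrite subr0 addrK !fctE opprD addrA.
have D := diff_unique cdf E.
apply: DiffDef => //.
by apply/diff_locallyP; rewrite D.
Qed.

Lemma diff_bound (V W : normedModType R) (f : V -> W) x (e : R) :
  differentiable f x -> 0 < e ->
  \forall y \near x, `|f y - f x - 'd f x (y - x)| <= e * `|y - x|.
Proof.
move=> /diff_locally /eqaddoP /(_ e) H e0.
rewrite (near_shift 0 x); have := H e0; apply: filterS => h /=.
by rewrite !fctE /= subr0 addrK opprD addrA.
Qed.

Lemma near_eq_differentiable (V W : normedModType R) (f g : V -> W) x :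
  (\near x, f x = g x) -> differentiable f x -> differentiable g x.
Proof.
move=> fg df.
suff : is_diff x g ('d f x) by [].
apply: is_diff_of_bound; first exact: diff_continuous.
move=> e e0; near=> y.
rewrite -(nbhs_singleton fg).
have <- : f y = g y by near: y.
by near: y; exact: diff_bound.
Unshelve. all: by end_near. Qed.

Lemma near_open (T : topologicalType) (U : set T) x (P : T -> Prop) :
  open U -> U x -> (forall y, U y -> P y) -> \forall y \near x, P y.
Proof. by move=> oU Ux UP; exact: filterS UP (open_nbhs_nbhs (conj oU Ux)). Qed.

Lemma near_eq_continuous (T T' : topologicalType) (f g : T -> T') x :
  (\near x, f x = g x) -> {for x, continuous f} -> {for x, continuous g}.
Proof.
move=> fg; rewrite /prop_for /continuous_at -(nbhs_singleton fg).
by apply: cvg_trans; apply: near_eq_cvg; apply: filterS fg => y ->.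
Qed.

Lemma Ck_ext (V : normedModType R) k U (f g : 'rV[R]_2 -> V) : open U ->
  (forall x, U x -> f x = g x) -> Ck k U f -> Ck k U g.
Proof.
move=> oU; elim: k f g => [|k IH] f g fg /=.
  move=> cf x Ux; apply: near_eq_continuous (cf x Ux).
  by move: Ux; rewrite inE => Ux; exact: near_open fg.
move=> [df Df]; split=> [x Ux|v].
  apply: near_eq_differentiable (df x Ux).
  exact: near_open fg.
apply: IH (Df v) => x Ux.
apply: near_eq_derive.
exact: near_open fg.
Qed.

Lemma CkW (V : normedModType R) k U (f : 'rV[R]_2 -> V) :
  Ck k.+1 U f -> Ck k U f.
Proof.
elim: k f => [|k IH] f [df Df].
  by move=> x /[!inE] Ux; apply/differentiable_continuous/df.
by split=> // v; apply: IH.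
Qed.

Lemma Ck_cst k U (a : R) : Ck k U (fun=> a).
Proof.
elim: k a => [|k IH] a; first by move=> x _; exact: cst_continuous.
split=> [x _|v]; first exact: differentiable_cst.
have -> : 'D_v (fun=> a) = (fun=> 0 : R).
  by apply/funext => y; exact: derive_cst.
exact: IH.
Qed.

Lemma CkD k U f g : open U -> Ck k U f -> Ck k U g ->
  Ck k U (fun x => f x + g x).
Proof.
move=> oU; elim: k f g => [|k IH] f g.
  by move=> cf cg x Ux; exact: continuousD (cf x Ux) (cg x Ux).
move=> [df Df] [dg Dg]; split=> [x Ux|v].
  by apply: differentiableD; [exact: df|exact: dg].
apply: (@Ck_ext _ _ _ (fun x => 'D_v f x + 'D_v g x)) => // [x Ux|].
  by rewrite -deriveD//; apply: diff_derivable; [exact: df|exact: dg].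
by apply: IH; [exact: Df|exact: Dg].
Qed.

Lemma CkM k U f g : open U -> Ck k U f -> Ck k U g ->
  Ck k U (fun x => f x * g x).
Proof.
move=> oU; elim: k f g => [|k IH] f g.
  by move=> cf cg x Ux; exact: continuousM (cf x Ux) (cg x Ux).
move=> Cf Cg; have := Cf; have := Cg; move=> [dg Dg] [df Df]; split=> [x Ux|v].
  by apply: differentiableM; [exact: df|exact: dg].
apply: (@Ck_ext _ _ _ (fun x => f x * 'D_v g x + g x * 'D_v f x)) => //.
  by move=> x Ux; apply: esym; apply: (@deriveM _ _ f g); apply: diff_derivable;
    [exact: df|exact: dg].
by apply: CkD => //; apply: IH; (try by exact: CkW); [exact: Dg|exact: Df].
Qed.

Lemma CkN k U f : open U -> Ck k U f -> Ck k U (fun x => - f x).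
Proof.
move=> oU Cf; apply: (@Ck_ext _ _ _ (fun x => (-1) * f x)) => //.
  by move=> x _; rewrite mulN1r.
by apply: CkM => //; exact: Ck_cst.
Qed.

Lemma CkB k U f g : open U -> Ck k U f -> Ck k U g ->
  Ck k U (fun x => f x - g x).
Proof. by move=> oU Cf Cg; apply: CkD => //; exact: CkN. Qed.

(** The derivative of [1 / f] is a polynomial in [1 / f] and ['D_v f], so one order of smoothness is
    gained at each step of the induction; the square root is treated in the same way. *)
Lemma CkV k U f : open U -> (forall x, U x -> f x != 0) -> Ck k U f ->
  Ck k U (fun x => (f x)^-1).
Proof.
move=> oU f0; elim: k => [|k IH].
  by move=> cf x Ux; apply: continuousV (cf x Ux); apply: f0; rewrite -inE.
move=> Cf; have := Cf => -[df Df]; split=> [x Ux|v].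
  by apply: differentiableV; auto.
apply: (@Ck_ext _ _ _ (fun x => - ((f x)^-1 * (f x)^-1) * 'D_v f x)) => //.
  move=> x Ux; rewrite [RHS](@deriveV _ _ f)//; last by apply: diff_derivable; exact: df.
    by rewrite -[(f x ^-2)]exprVn expr2.
  exact: f0.
by apply: CkM (Df v) => //; apply: CkN => //; apply: CkM => //; apply/IH/CkW.
Qed.

Lemma Ck_sqrt k U f : open U -> (forall x, U x -> 0 < f x) -> Ck k U f ->
  Ck k U (fun x => Num.sqrt (f x)).
Proof.
move=> oU f0; elim: k => [|k IH].
  move=> cf x Ux; apply: continuous_comp (cf x Ux) _.
  exact: sqrt_continuous.
move=> Cf; have := Cf => -[df Df].
have ds x : U x -> differentiable Num.sqrt (f x).
  move=> Ux; apply/derivable1_diffP.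
  by have [] := is_derive1_sqrt (f0 _ Ux).
split=> [x Ux|v].
  by apply: differentiable_comp; auto.
apply: (@Ck_ext _ _ _ (fun x => (2 * Num.sqrt (f x))^-1 * 'D_v f x)) => //.
  move=> x Ux; rewrite [RHS]deriveE; last by apply: differentiable_comp; auto.
  rewrite diff_comp/=; [|by auto..].
  have -> : 'd f x v = 'D_v f x *: (1 : R) by rewrite [_ *: _]mulr1 deriveE; auto.
  rewrite linearZ/= -deriveE; last by auto.
  by rewrite derive_sqrt ?f0// mulrC.
apply: CkM (Df v) => //; apply: CkV => //.
  by move=> x Ux; rewrite mulf_neq0 ?pnatr_eq0// gt_eqF// sqrtr_gt0 f0.
by apply: CkM => //; [exact: Ck_cst|apply/IH/CkW].
Qed.

Lemma Ck_coord n k U (f : 'rV[R]_2 -> 'rV[R]_n.+1) i : open U -> Ck k U f ->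
  Ck k U (fun x => f x 0 i).
Proof.
move=> oU; elim: k f => [|k IH] f.
  move=> cf x Ux; apply: (@continuous_comp _ _ _ f (fun v : 'rV[R]_n.+1 => v 0 i)).
    exact: (cf x Ux).
  exact: coord_continuous.
move=> [df Df]; split=> [x Ux|v].
  apply: (@differentiable_comp _ _ _ _ f (fun v : 'rV[R]_n.+1 => v 0 i)); auto.
  exact: differentiable_coord.
apply: (@Ck_ext _ _ _ (fun x => 'D_v f x 0 i)) => //; last exact/IH/Df.
by move=> x Ux; rewrite derive_mx ?mxE//; apply: diff_derivable; auto.
Qed.

End Calculus.

(** * Mean value theorems and symmetry of second derivatives *)

Section Calculus2.
Context {R : realType}.
Implicit Types (U : set 'rV[R]_2) (f g : 'rV[R]_2 -> R).

Lemma is_derive_line (V W : normedModType R) (f : V -> W) x v t :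
  differentiable f (x + t *: v) ->
  is_derive t (1 : R) (fun t => f (x + t *: v)) ('D_v f (x + t *: v)).
Proof.
move=> df.
have dl : is_diff t (fun t : R => x + t *: v) (fun s => s *: v).
  apply: is_diff_eq.
  by rewrite add0r.
have ? : differentiable (fun s : R => f (x + s *: v)) t.
  by apply: (@differentiable_comp _ _ _ _ (fun t : R => x + t *: v) f).
apply: DeriveDef; first exact: diff_derivable.
rewrite [LHS]deriveE// (@diff_comp _ _ _ _ (fun t : R => x + t *: v) f)//=.
by rewrite diff_val scale1r -deriveE.
Qed.

Lemma ord2P (i : 'I_2) : i = 0 \/ i = 1.
Proof. by case: i => -[|[|//]] ?; [left|right]; exact/val_inj. Qed.

Lemma derive_partials (W : normedModType R) (f : 'rV[R]_2 -> W) x v : differentiable f x ->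
  'D_v f x = v 0 0 *: 'D_(delta_mx 0 0) f x + v 0 1 *: 'D_(delta_mx 0 1) f x.
Proof.
move=> df; rewrite !deriveE// -!linearZ -linearD /=; congr ('d f x _).
apply/rowP => i; rewrite !mxE.
have [->|->] := ord2P i.
- by rewrite mulr1 mulr0 addr0.
- by rewrite mulr1 mulr0 add0r.
Qed.

Lemma convex_ball (V : normedModType R) (x0 x y : V) r t : 0 <= t <= 1 ->
  ball x0 r x -> ball x0 r y -> ball x0 r (x + t *: (y - x)).
Proof.
rewrite -ball_normE /= => /andP[t0 t1] xr yr.
have -> : x0 - (x + t *: (y - x)) = (1 - t) *: (x0 - x) + t *: (x0 - y).
  rewrite scalerBl scale1r -[RHS]addrA -scalerN -scalerDr opprB addrA subrK.
  by rewrite opprD addrA -scalerN opprB.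
rewrite (le_lt_trans (ler_normD _ _))// !normrZ ger0_norm ?subr_ge0// ger0_norm//.
have [->|t_neq0] := eqVneq t 0; first by rewrite subr0 mul1r mul0r addr0.
rewrite [ltRHS](_ : r = (1 - t) * r + t * r); last by rewrite -mulrDl subrK mul1r.
apply: ler_ltD; first by rewrite ler_wpM2l ?subr_ge0// ltW.
by rewrite ltr_pM2l// lt_def t_neq0.
Qed.

Lemma MVT_line (V : normedModType R) (f : V -> R) x v (s : R) : 0 < s ->
  (forall t, 0 <= t <= s -> differentiable f (x + t *: v)) ->
  exists2 t, 0 <= t <= s & f (x + s *: v) - f x = s * 'D_v f (x + t *: v).
Proof.
move=> s0 df.
have dl t : t \in `]0, s[ -> is_derive t 1 (fun t => f (x + t *: v)) ('D_v f (x + t *: v)).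
  by move=> /subset_itv_oo_cc ts; apply/is_derive_line/df.
have cl : {within `[0, s], continuous (fun t => f (x + t *: v))}.
  apply: continuous_in_subspaceT => t /[!inE] ts.
  apply/differentiable_continuous/derivable1_diffP.
  by have [] := is_derive_line (df t ts).
have [t ts] := MVT s0 dl cl.
rewrite scale0r addr0 subr0 mulrC => E; exists t => //.
by move: ts; rewrite in_itv/= => /andP[/ltW -> /ltW ->].
Qed.

Lemma MVT_ball (V : normedModType R) (f : V -> R) x0 r x y :
  (forall z, ball x0 r z -> differentiable f z) -> ball x0 r x -> ball x0 r y ->
  exists2 z, ball x0 r z & f y - f x = 'D_(y - x) f z.
Proof.
move=> df xr yr.
have [||t t01] := @MVT_line V f x (y - x) 1; first by [].
  by move=> t t01; apply: df; exact: convex_ball.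
rewrite scale1r (addrC x) subrK mul1r => E; exists (x + t *: (y - x)) => //.
exact: convex_ball.
Qed.

Lemma derive0_ball_cst n (f : 'rV[R]_2 -> 'rV[R]_n.+1) x0 r x y :
  (forall z, ball x0 r z -> differentiable f z) ->
  (forall z v, ball x0 r z -> 'D_v f z = 0) ->
  ball x0 r x -> ball x0 r y -> f x = f y.
Proof.
move=> df Df xr yr; apply/rowP => i; apply/eqP; rewrite -subr_eq0; apply/eqP.
have dfi z : ball x0 r z -> differentiable (fun z => f z 0 i) z.
  move=> zr; apply: (@differentiable_comp _ _ _ _ f (fun v : 'rV[R]_n.+1 => v 0 i)).
    exact: df.
  exact: differentiable_coord.
have [z zr ->] := MVT_ball dfi yr xr.
have := congr1 (fun w : 'rV_n.+1 => w 0 i) (Df z (x - y) zr).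
by rewrite derive_mx ?mxE//; apply/diff_derivable/df.
Qed.

(** The mean value theorem is applied twice: along [u] to the increment [f (y + s v) - f y], then
    along [v] to ['D_u f]. *)
Lemma second_difference U f x u v s : Ck 2 U f -> 0 < s ->
  (forall a b, 0 <= a <= s -> 0 <= b <= s -> U (x + a *: u + b *: v)) ->
  exists a b, [/\ 0 <= a <= s, 0 <= b <= s &
    f (x + s *: u + s *: v) - f (x + s *: u) - f (x + s *: v) + f x =
    s ^+ 2 * 'D_v ('D_u f) (x + a *: u + b *: v)].
Proof.
move=> [df D2f] s0 HU.
have s01 : (0 : R) <= s <= s by rewrite lexx (ltW s0).
have s00 : (0 : R) <= 0 <= s by rewrite lexx (ltW s0).
have HU0 a : 0 <= a <= s -> U (x + a *: u).
  by move=> /HU /(_ s00); rewrite scale0r addr0.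
pose g y := f (y + s *: v) - f y.
have dgv a : 0 <= a <= s -> differentiable (fun y => f (y + s *: v)) (x + a *: u).
  move=> as_; apply: (@differentiable_comp _ _ _ _ (fun y => y + s *: v) f).
    exact: differentiableD.
  exact/df/HU.
have dg a : 0 <= a <= s -> differentiable g (x + a *: u).
  move=> as_; apply: differentiableB; first exact: dgv.
  exact/df/HU0.
have [a as_ Ea] := MVT_line s0 dg.
have Dfu b : 0 <= b <= s -> differentiable ('D_u f) (x + a *: u + b *: v).
  by move=> bs; have [D _] := D2f u; apply: D; exact: HU.
have [b bs Eb] := MVT_line s0 Dfu.
exists a, b; split=> //.
transitivity (g (x + s *: u) - g x); first by rewrite /g opprB addrA addrAC.
have Es : 'D_u (fun y => f (y + s *: v)) (x + a *: u) = 'D_u f (x + a *: u + s *: v).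
  rewrite deriveE; last exact: dgv.
  rewrite (@diff_comp _ _ _ _ (fun y => y + s *: v) f)/=; last first.
  - exact/df/HU.
  - exact: differentiableD.
  rewrite -deriveE; last exact/df/HU.
  congr (derive f _ _).
  by rewrite -deriveE; [rewrite deriveD// derive_id derive_cst addr0|exact: differentiableD].
rewrite Ea deriveB; [|exact/diff_derivable/dgv|exact/diff_derivable/df/HU0].
by rewrite Es Eb mulrA -expr2.
Qed.

(** The second difference over a parallelogram is symmetric in [u] and [v], so it equals [s ^+ 2]
    times either mixed derivative, each taken at some point of the parallelogram. Both values are
    close to those at [x] by continuity. *)
Lemma derive_sym U f x u v : open U -> Ck 2 U f -> U x ->
  'D_v ('D_u f) x = 'D_u ('D_v f) x.
Proof.
move=> oU C2 Ux; apply/eqP; rewrite -subr_eq0 -normr_eq0 eq_le normr_ge0 andbT.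
apply/ler_addgt0Pl => e e0; rewrite addr0.
have [_ D2] := C2.
have cA : {for x, continuous ('D_v ('D_u f))}.
  by have [_ D] := D2 u; apply: D; rewrite inE.
have cB : {for x, continuous ('D_u ('D_v f))}.
  by have [_ D] := D2 v; apply: D; rewrite inE.
have e20 : 0 < e / 2 by rewrite divr_gt0.
have nU : nbhs x U by exact: open_nbhs_nbhs.
have nA : \forall y \near x, `|'D_v ('D_u f) x - 'D_v ('D_u f) y| < e / 2.
  by have /cvgrPdist_lt := cA; apply.
have nB : \forall y \near x, `|'D_u ('D_v f) x - 'D_u ('D_v f) y| < e / 2.
  by have /cvgrPdist_lt := cB; apply.
have [r /= r0 Hr] := (nbhs_ballP _ _).1 (filterI nU (filterI nA nB)).
(* Makes [s * (|u| + |v| + 1)] equal to [r / 2], so that the whole parallelogram of sides [s *: u]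
   and [s *: v] stays in the ball of radius [r]; the [+ 1] covers [u = v = 0]. *)
pose s := r / (2 * (`|u| + `|v| + 1)).
have uv0 : 0 < `|u| + `|v| + 1 by rewrite ltr_wpDl// addr_ge0.
have s0 : 0 < s by rewrite divr_gt0// mulr_gt0.
have inball a b : 0 <= a <= s -> 0 <= b <= s -> ball x r (x + a *: u + b *: v).
  move=> /andP[a0 as_] /andP[b0 bs]; rewrite -ball_normE/= -addrA opprD addrA subrr sub0r normrN.
  rewrite (le_lt_trans (ler_normD _ _))// !normrZ !ger0_norm//.
  apply: (@le_lt_trans _ _ (s * (`|u| + `|v| + 1))).
    by rewrite !mulrDr mulr1 ler_wpDr ?(ltW s0)// lerD// ler_wpM2r.
  rewrite /s -mulrA invfM -mulrA mulVf ?gt_eqF// mulr1.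
  by rewrite ltr_pdivrMr// ltr_pMr// ltr1n.
have [|a [b [as_ bs E1]]] := @second_difference U f x u v s C2 s0.
  by move=> a b as_ bs; exact: (Hr _ (inball _ _ as_ bs)).1.
have [|b' [a' [bs' as' E2]]] := @second_difference U f x v u s C2 s0.
  by move=> b' a' bs' as'; rewrite addrAC; exact: (Hr _ (inball _ _ as' bs')).1.
have E : 'D_v ('D_u f) (x + a *: u + b *: v) = 'D_u ('D_v f) (x + b' *: v + a' *: u).
  have s20 : s ^+ 2 != 0 by rewrite expf_neq0 ?gt_eqF.
  apply: (mulfI s20); apply: (etrans (esym E1)); apply: etrans E2.
  rewrite (addrAC x (s *: v)).
  move: (f (x + s *: u + s *: v)) (f (x + s *: u)) (f (x + s *: v)) (f x) => A B C D.
  ring.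
have [_ [HA _]] := Hr _ (inball _ _ as_ bs).
have [_ [_ HB]] := Hr _ (inball _ _ as' bs').
rewrite addrAC in HB.
rewrite E in HA; move: HA HB.
move: ('D_v ('D_u f) x) ('D_u ('D_v f) x) ('D_u ('D_v f) _) => A B C HA HB.
apply: ltW; rewrite (splitr e); apply: le_lt_trans (ltrD HA HB).
by rewrite (distrC B) -[X in `|X|](subrKA C) ler_normD.
Qed.

End Calculus2.

(** * Vector algebra and the operators of the Scherk surfaces *)

Section Algebra.
Context {R : realType}.
Implicit Types (u v n : 'rV[R]_3).

Lemma vec3E0 (a b c : R) : vec3 a b c 0 (inord 0) = a.
Proof. by rewrite mxE inordK. Qed.
Lemma vec3E1 (a b c : R) : vec3 a b c 0 (inord 1) = b.
Proof. by rewrite mxE inordK. Qed.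
Lemma vec3E2 (a b c : R) : vec3 a b c 0 (inord 2) = c.
Proof. by rewrite mxE inordK. Qed.
Definition vec3E := (vec3E0, vec3E1, vec3E2).

Lemma ord3P (i : 'I_3) : [\/ i = inord 0, i = inord 1 | i = inord 2].
Proof.
by case: i => -[|[|[|//]]] i; [constructor 1|constructor 2|constructor 3];
  apply/val_inj; rewrite /= inordK.
Qed.

Lemma row3P u v : u 0 (inord 0) = v 0 (inord 0) ->
  u 0 (inord 1) = v 0 (inord 1) -> u 0 (inord 2) = v 0 (inord 2) -> u = v.
Proof. by move=> ? ? ?; apply/rowP => i; case: (ord3P i) => ->. Qed.

Lemma vec3_eta u : u = vec3 (u 0 (inord 0)) (u 0 (inord 1)) (u 0 (inord 2)).
Proof. by apply: row3P; rewrite vec3E. Qed.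

Lemma dotE u v : dot u v = u 0 (inord 0) * v 0 (inord 0) +
  u 0 (inord 1) * v 0 (inord 1) + u 0 (inord 2) * v 0 (inord 2).
Proof.
rewrite /dot !big_ord_recr big_ord0/= add0r; congr (_ * _ + _ * _ + _ * _);
  by congr (_ 0 _); apply/val_inj; rewrite /= inordK.
Qed.

(* The differential at [n] of the inverse Gauss map of a Scherk graph,
   [n |-> (- atan (n0 / n2), atan (n1 / n2), 1/2 ln ((n0^2 + n2^2) / (n1^2 + n2^2)))]. *)
Definition scherk_map n v : 'rV[R]_3 :=
  let n0 := n 0 (inord 0) in let n1 := n 0 (inord 1) in let n2 := n 0 (inord 2) in
  let v0 := v 0 (inord 0) in let v1 := v 0 (inord 1) in let v2 := v 0 (inord 2) in
  let d1 := n0 ^+ 2 + n2 ^+ 2 in let d2 := n1 ^+ 2 + n2 ^+ 2 in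
  vec3 (- ((n2 * v0 - n0 * v2) / d1)) ((n2 * v1 - n1 * v2) / d2)
       ((n0 * v0 + n2 * v2) / d1 - (n1 * v1 + n2 * v2) / d2).

(* On the unit sphere, the complement of the four poles [+- e0], [+- e1]. *)
Definition regular n := n 0 (inord 0) ^+ 2 + n 0 (inord 2) ^+ 2 != 0 /\
  n 0 (inord 1) ^+ 2 + n 0 (inord 2) ^+ 2 != 0.

Lemma crossE u v : cross u v =
  vec3 (u 0 (inord 1) * v 0 (inord 2) - u 0 (inord 2) * v 0 (inord 1))
       (u 0 (inord 2) * v 0 (inord 0) - u 0 (inord 0) * v 0 (inord 2))
       (u 0 (inord 0) * v 0 (inord 1) - u 0 (inord 1) * v 0 (inord 0)).
Proof. by []. Qed.

Lemma mx0E (i : 'I_3) : (0 : 'rV[R]_3) 0 i = 0. Proof. by rewrite mxE. Qed.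
Lemma mxDE u v (i : 'I_3) : (u + v) 0 i = u 0 i + v 0 i. Proof. by rewrite mxE. Qed.
Lemma mxNE u (i : 'I_3) : (- u) 0 i = - u 0 i. Proof. by rewrite mxE. Qed.
Lemma mxZE (a : R) u (i : 'I_3) : (a *: u) 0 i = a * u 0 i. Proof. by rewrite mxE. Qed.
Definition row3E := (vec3E, crossE, mx0E, mxDE, mxNE, mxZE).

(** Inverse stereographic projection from the north pole; [distereo] below is its differential at
    [(x, y)] on the vector [(p, q)]. The denominator never vanishes, which suits [field]. *)
Definition istereo (x y : R) := let s := x ^+ 2 + y ^+ 2 + 1 in
  vec3 (2 * x / s) (2 * y / s) ((x ^+ 2 + y ^+ 2 - 1) / s).

Definition distereo (x y p q : R) := let s := x ^+ 2 + y ^+ 2 + 1 in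
  let ds := 2 * (x * p + y * q) in
  vec3 (2 * (p * s - x * ds) / s ^+ 2) (2 * (q * s - y * ds) / s ^+ 2)
       (2 * ds / s ^+ 2).

Lemma istereo_surj n (x := n 0 (inord 0) / (1 - n 0 (inord 2)))
    (y := n 0 (inord 1) / (1 - n 0 (inord 2))) :
  dot n n = 1 -> n 0 (inord 2) != 1 -> n = istereo x y.
Proof.
move=> + n1; have d0 : 1 - n 0 (inord 2) != 0 by rewrite subr_eq0 eq_sym.
rewrite /x /y dotE; move: (n 0 (inord 0)) (n 0 (inord 1)) (n 0 (inord 2)) (vec3_eta n) d0.
move=> a b c -> d0 E.
have sE : (a / (1 - c)) ^+ 2 + (b / (1 - c)) ^+ 2 + 1 = 2 / (1 - c).
  transitivity ((a * a + b * b + c * c + 1 - 2 * c) / (1 - c) ^+ 2).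
    by field; rewrite d0.
  by rewrite E; field; rewrite d0.
rewrite /istereo sE; apply: row3P; rewrite !vec3E.
- by field; rewrite d0.
- by field; rewrite d0.
- have -> : (a / (1 - c)) ^+ 2 + (b / (1 - c)) ^+ 2 - 1 = 2 / (1 - c) - 2.
    by rewrite -sE; ring.
  by field; rewrite d0.
Qed.

(** [p] and [q] are the derivatives along [v] of the two stereographic coordinates [x] and [y] of
    [n]. *)
Lemma distereo_surj n v (x := n 0 (inord 0) / (1 - n 0 (inord 2)))
    (y := n 0 (inord 1) / (1 - n 0 (inord 2)))
    (p := v 0 (inord 0) / (1 - n 0 (inord 2)) +
      n 0 (inord 0) * v 0 (inord 2) / (1 - n 0 (inord 2)) ^+ 2)
    (q := v 0 (inord 1) / (1 - n 0 (inord 2)) +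
      n 0 (inord 1) * v 0 (inord 2) / (1 - n 0 (inord 2)) ^+ 2) :
  dot n n = 1 -> dot n v = 0 -> n 0 (inord 2) != 1 -> v = distereo x y p q.
Proof.
rewrite /p /q /x /y !dotE => + + n1.
have d0 : 1 - n 0 (inord 2) != 0 by rewrite subr_eq0 eq_sym.
move: (n 0 (inord 0)) (n 0 (inord 1)) (n 0 (inord 2)) d0.
move: (v 0 (inord 0)) (v 0 (inord 1)) (v 0 (inord 2)) (vec3_eta v).
move=> u w z -> a b c d0 E F.
have sE : (a / (1 - c)) ^+ 2 + (b / (1 - c)) ^+ 2 + 1 = 2 / (1 - c).
  transitivity ((a * a + b * b + c * c + 1 - 2 * c) / (1 - c) ^+ 2).
    by field; rewrite d0.
  by rewrite E; field; rewrite d0.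
have dsE : a / (1 - c) * (u / (1 - c) + a * z / (1 - c) ^+ 2) +
    b / (1 - c) * (w / (1 - c) + b * z / (1 - c) ^+ 2) = z / (1 - c) ^+ 2.
  have -> : a / (1 - c) * (u / (1 - c) + a * z / (1 - c) ^+ 2) +
    b / (1 - c) * (w / (1 - c) + b * z / (1 - c) ^+ 2) =
    (a * u + b * w + c * z) / (1 - c) ^+ 2 - c * z / (1 - c) ^+ 2 + z * (a * a + b * b +
      c * c - c * c) / (1 - c) ^+ 3.
    by field; rewrite d0.
  by rewrite E F; field; rewrite d0.
rewrite /distereo sE dsE; apply: row3P; rewrite !vec3E; field;
  rewrite ?d0 ?invr_eq0 ?mulf_neq0 ?d0 ?pnatr_eq0 ?invr_eq0 ?d0 ?pnatr_eq0 //.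
Qed.

(** Replaces a unit vector and its tangent vectors by free real parameters. An identity subject to
    [|n| = 1] and to orthogonality becomes a rational identity without side relations, which [field]
    settles; only the north pole is handled apart. *)
Lemma sphere_tangent_ind (P : 'rV[R]_3 -> 'rV[R]_3 -> 'rV[R]_3 -> Prop) :
  (forall a b c d, P (vec3 0 0 1) (vec3 a b 0) (vec3 c d 0)) ->
  (forall x y p q p' q', P (istereo x y) (distereo x y p q) (distereo x y p' q')) ->
  forall n u v, dot n n = 1 -> dot n u = 0 -> dot n v = 0 -> P n u v.
Proof.
move=> Pn Ps n u v nn nu nv.
have [n1|n1] := eqVneq (n 0 (inord 2)) 1; last first.
  by rewrite (istereo_surj nn n1) {1}(distereo_surj nn nu n1) (distereo_surj nn nv n1).
move: nn nu nv; rewrite !dotE n1 !mul1r => nn nu nv.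
have [n00 n10] : n 0 (inord 0) = 0 /\ n 0 (inord 1) = 0.
  have /eqP : n 0 (inord 0) ^+ 2 + n 0 (inord 1) ^+ 2 = 0.
    by rewrite !expr2; apply: (addIr 1); rewrite nn add0r.
  by rewrite paddr_eq0 ?sqr_ge0// !expf_eq0/= => /andP[/eqP-> /eqP->].
move: nu nv; rewrite n00 n10 !mul0r !add0r => u0 v0.
rewrite (vec3_eta n) n00 n10 n1 (vec3_eta u) u0 (vec3_eta v) v0.
exact: Pn.
Qed.

Lemma tangent_ind (P : 'rV[R]_3 -> 'rV[R]_3 -> Prop) :
  (forall a b, P (vec3 0 0 1) (vec3 a b 0)) ->
  (forall x y p q, P (istereo x y) (distereo x y p q)) ->
  forall n v, dot n n = 1 -> dot n v = 0 -> P n v.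
Proof.
move=> Pn Ps n v nn nv.
by apply: (@sphere_tangent_ind (fun n v _ => P n v) _ _ n v v nn nv nv) => *.
Qed.

End Algebra.

Section Algebra2.
Context {R : realType}.
Implicit Types (u v n : 'rV[R]_3).

Lemma istereo_den (x y : R) : x ^+ 2 + y ^+ 2 + 1 != 0.
Proof. by rewrite gt_eqF// ltr_wpDl// addr_ge0// sqr_ge0. Qed.

Lemma regular_istereo (x y : R) : regular (istereo x y) ->
  (2 * x) ^+ 2 + (x ^+ 2 + y ^+ 2 - 1) ^+ 2 != 0 /\
  (2 * y) ^+ 2 + (x ^+ 2 + y ^+ 2 - 1) ^+ 2 != 0.
Proof.
rewrite /regular !vec3E !expr_div_n -!mulrDl !mulf_eq0 !invr_eq0 !negb_or.
by move=> [/andP[-> _] /andP[-> _]].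
Qed.

Lemma double_cross n v : dot n n = 1 -> dot n v = 0 -> cross n (cross n v) = - v.
Proof.
apply: (@tangent_ind R (fun n v => cross n (cross n v) = - v)) => [a b|x y p q].
  by apply: row3P; rewrite !row3E; ring.
have s0 := istereo_den x y.
by apply: row3P; rewrite !row3E; field; rewrite s0.
Qed.

Lemma scherk_map_tangent n v : dot n n = 1 -> dot n v = 0 -> regular n ->
  dot n (scherk_map n v) = 0.
Proof.
apply: (@tangent_ind R (fun n v => regular n -> dot n (scherk_map n v) = 0)) => [a b _|x y p q].
  by rewrite dotE !row3E; field; rewrite ?oner_eq0//.
move=> /regular_istereo[h1 h2]; have s0 := istereo_den x y.
by rewrite dotE !row3E; field; rewrite s0 h1 h2.
Qed.

Lemma scherk_map_norm n v : dot n n = 1 -> dot n v = 0 -> regular n ->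
  dot (scherk_map n v) (scherk_map n v) * ((1 - n 0 (inord 0) ^+ 2) * (1 - n 0 (inord 1) ^+ 2))
    = dot v v.
Proof.
apply: (@tangent_ind R (fun n v => regular n -> dot (scherk_map n v) (scherk_map n v) *
  ((1 - n 0 (inord 0) ^+ 2) * (1 - n 0 (inord 1) ^+ 2)) = dot v v)) => [a b _|x y p q].
  by rewrite !dotE !row3E; field; rewrite ?oner_eq0//.
move=> /regular_istereo[h1 h2]; have s0 := istereo_den x y.
by rewrite !dotE !row3E; field; rewrite s0 h1 h2.
Qed.

(** A traceless symmetric operator of a plane anticommutes with the quarter turn, that is, it
    reverses orientation. *)
Lemma scherk_map_cross n v : dot n n = 1 -> dot n v = 0 -> regular n ->
  scherk_map n (cross n v) = - cross n (scherk_map n v).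
Proof.
apply: (@tangent_ind R (fun n v => regular n ->
  scherk_map n (cross n v) = - cross n (scherk_map n v))) => [a b _|x y p q].
  by apply: row3P; rewrite !row3E; field; rewrite ?oner_eq0//.
move=> /regular_istereo[h1 h2]; have s0 := istereo_den x y.
by apply: row3P; rewrite !row3E; field; rewrite s0 h1 h2.
Qed.

(** Both sides are normal vectors, and they agree because the operator is symmetric and anticommutes
    with the quarter turn. This is the extra term in the exterior derivative of [n x L n dn], whose
    closedness thus reduces to that of [L n dn]. *)
Lemma cross_scherk_map n u v : dot n n = 1 -> dot n u = 0 -> dot n v = 0 -> regular n ->
  cross u (scherk_map n v) = cross v (scherk_map n u).
Proof.
apply: (@sphere_tangent_ind R (fun n u v => regular n ->
  cross u (scherk_map n v) = cross v (scherk_map n u))) => [a b c d _|x y p q p' q'].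
  by apply: row3P; rewrite !row3E; field; rewrite ?oner_eq0//.
move=> /regular_istereo[h1 h2]; have s0 := istereo_den x y.
by apply: row3P; rewrite !row3E; field; rewrite s0 h1 h2.
Qed.

Lemma regularP n : dot n n = 1 ->
  regular n <-> (1 - n 0 (inord 1) ^+ 2) * (1 - n 0 (inord 0) ^+ 2) != 0.
Proof.
rewrite dotE => nn; rewrite mulf_eq0 negb_or /regular.
have -> : n 0 (inord 0) ^+ 2 + n 0 (inord 2) ^+ 2 = 1 - n 0 (inord 1) ^+ 2 by rewrite -nn; ring.
have -> : n 0 (inord 1) ^+ 2 + n 0 (inord 2) ^+ 2 = 1 - n 0 (inord 0) ^+ 2 by rewrite -nn; ring.
by split=> [[-> ->]|/andP[]].
Qed.

Lemma scherk_mapD n u v : scherk_map n (u + v) = scherk_map n u + scherk_map n v.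
Proof. by apply: row3P; rewrite !row3E; ring. Qed.

Lemma scherk_mapZ n (a : R) v : scherk_map n (a *: v) = a *: scherk_map n v.
Proof. by apply: row3P; rewrite !row3E; ring. Qed.

Lemma crossDr u v n : cross n (u + v) = cross n u + cross n v.
Proof. by apply: row3P; rewrite !row3E; ring. Qed.

Lemma crossZr (a : R) u n : cross n (a *: u) = a *: cross n u.
Proof. by apply: row3P; rewrite !row3E; ring. Qed.

Lemma dotDl u v n : dot (u + v) n = dot u n + dot v n.
Proof. by rewrite !dotE !row3E; ring. Qed.

Lemma dotZl (a : R) u n : dot (a *: u) n = a * dot u n.
Proof. by rewrite !dotE !row3E; ring. Qed.

Lemma dotC u v : dot u v = dot v u.
Proof. by rewrite !dotE; ring. Qed.

Lemma dotZr (a : R) u n : dot u (a *: n) = a * dot u n.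
Proof. by rewrite !dotE !row3E; ring. Qed.

Lemma dot_ge0 u : 0 <= dot u u.
Proof. by rewrite dotE -!expr2 !addr_ge0// sqr_ge0. Qed.

Lemma dot_eq0 u : (dot u u == 0) = (u == 0).
Proof.
apply/eqP/eqP => [|->]; last by rewrite !dotE !row3E; ring.
rewrite dotE -!expr2 => /eqP; rewrite !paddr_eq0 ?addr_ge0 ?sqr_ge0// !expf_eq0/=.
by move=> /andP[/andP[/eqP a /eqP b] /eqP c]; apply: row3P; rewrite mx0E.
Qed.

Lemma dot_cross_l u v : dot u (cross u v) = 0.
Proof. by rewrite dotE !row3E; ring. Qed.

Lemma dot_cross_r u v : dot v (cross u v) = 0.
Proof. by rewrite dotE !row3E; ring. Qed.

Lemma lagrange u v : dot (cross u v) (cross u v) = dot u u * dot v v - dot u v ^+ 2.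
Proof. by rewrite !dotE !row3E; ring. Qed.

Lemma tangent_expand n u v : dot n n = 1 -> dot n u = 0 -> dot n v = 0 ->
  dot v v *: u = dot u v *: v + dot u (cross n v) *: cross n v.
Proof.
apply: (@sphere_tangent_ind R (fun n u v =>
  dot v v *: u = dot u v *: v + dot u (cross n v) *: cross n v)) => [a b c d|x y p q p' q'].
  by apply: row3P; rewrite !row3E !dotE !row3E; ring.
have s0 := istereo_den x y.
by apply: row3P; rewrite !row3E !dotE !row3E; field; rewrite s0.
Qed.

End Algebra2.

(** * The differential of a minimal surface at one point, in terms of its normal *)

Section Algebra3.
Context {R : realType}.
Implicit Types (u v w n X : 'rV[R]_3).

Lemma dot_cross_tangent n X0 X1 w : dot n n = 1 -> dot n X0 = 0 -> dot n X1 = 0 ->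
  dot n w = 0 -> dot w (cross X0 X1) = 0.
Proof.
move=> nn n0 n1 nw.
have : dot n n * dot w (cross X0 X1) = dot n w * dot n (cross X0 X1) +
  (dot n X1 * dot (cross n w) X0 - dot n X0 * dot (cross n w) X1).
  by rewrite !dotE !row3E; ring.
by rewrite nn n0 n1 nw !mul0r mul1r subrr addr0.
Qed.

(** Cramer's rule in the basis [X0], [X1], [cross X0 X1], multiplied by the Gram determinant so that
    it is a polynomial identity. *)
Lemma cross_basis X0 X1 w :
  (dot X0 X0 * dot X1 X1 - dot X0 X1 ^+ 2) *: w =
  (dot X1 X1 * dot w X0 - dot X0 X1 * dot w X1) *: X0 +
  (dot X0 X0 * dot w X1 - dot X0 X1 * dot w X0) *: X1 +
  dot w (cross X0 X1) *: cross X0 X1.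
Proof. by apply: row3P; rewrite !row3E !dotE !row3E; ring. Qed.

Lemma basis_expand n X0 X1 w : dot n n = 1 -> dot n X0 = 0 -> dot n X1 = 0 ->
  dot n w = 0 ->
  (dot X0 X0 * dot X1 X1 - dot X0 X1 ^+ 2) *: w =
  (dot X1 X1 * dot w X0 - dot X0 X1 * dot w X1) *: X0 +
  (dot X0 X0 * dot w X1 - dot X0 X1 * dot w X0) *: X1.
Proof.
move=> nn n0 n1 nw.
by rewrite cross_basis (dot_cross_tangent nn) // scale0r addr0.
Qed.

(** [(a0, b0)] and [(a1, b1)] are the columns of the shape operator in the basis of partial
    derivatives. It is self-adjoint and traceless, so by Cayley-Hamilton its square is minus its
    determinant, namely [k]; the first two equations are this in the metric [E], [F], [G]. *)
Lemma minimal_shape (E F G e f g k : R) : E != 0 -> E * G - F ^+ 2 != 0 ->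
  E * g - 2 * F * f + G * e = 0 ->
  k = - ((e * g - f ^+ 2) / (E * G - F ^+ 2)) ->
  let D := E * G - F ^+ 2 in
  let a0 := (G * e - F * f) / D in let b0 := (E * f - F * e) / D in
  let a1 := (G * f - F * g) / D in let b1 := (E * g - F * f) / D in
  [/\ a0 * (a0 * E + b0 * F) + b0 * (a0 * F + b0 * G) = k * E,
      a0 * (a1 * E + b1 * F) + b0 * (a1 * F + b1 * G) = k * F &
      a0 * b1 - a1 * b0 = - k].
Proof.
move=> E0 D0 H kE D a0 b0 a1 b1.
have gE : g = (2 * F * f - G * e) / E.
  apply: (mulIf E0); rewrite divfK//.
  by apply/eqP; rewrite -subr_eq0 -H; apply/eqP; ring.
by split; rewrite ?kE /a0 /a1 /b0 /b1 gE /D; field; rewrite ?D0 ?E0.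
Qed.

(* The Weingarten equations: a minimal surface has a conformal and
   orientation-reversing Gauss map. *)
Lemma minimal_gauss_frame n X0 X1 n0 n1 (k : R) :
  dot n n = 1 -> dot n X0 = 0 -> dot n X1 = 0 -> dot n n0 = 0 -> dot n n1 = 0 ->
  cross X0 X1 != 0 -> dot X0 n1 = dot X1 n0 ->
  dot X0 X0 * dot X1 n1 - 2 * dot X0 X1 * dot X0 n1 + dot X1 X1 * dot X0 n0 = 0 ->
  k = - ((dot X0 n0 * dot X1 n1 - dot X0 n1 ^+ 2) / (dot X0 X0 * dot X1 X1 - dot X0 X1 ^+ 2)) ->
  [/\ dot X0 X0 != 0, dot n0 n0 = k * dot X0 X0, dot n1 n0 = k * dot X0 X1 &
      cross n0 n1 = - k *: cross X0 X1].
Proof.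
move=> nn nX0 nX1 nn0 nn1 c0 sym H kE.
set E := dot X0 X0 in H kE *; set F := dot X0 X1 in H kE *; set G := dot X1 X1 in H kE *.
have D0 : E * G - F ^+ 2 != 0 by rewrite -lagrange dot_eq0.
have E0 : E != 0.
  rewrite dot_eq0; apply: contraNneq c0 => ->.
  by apply/eqP/row3P; rewrite !row3E; ring.
pose D := E * G - F ^+ 2.
pose a0 := (G * dot X0 n0 - F * dot X0 n1) / D.
pose b0 := (E * dot X0 n1 - F * dot X0 n0) / D.
pose a1 := (G * dot X0 n1 - F * dot X1 n1) / D.
pose b1 := (E * dot X1 n1 - F * dot X0 n1) / D.
have [S1 S2 S3] : [/\ a0 * (a0 * E + b0 * F) + b0 * (a0 * F + b0 * G) = k * E,
      a0 * (a1 * E + b1 * F) + b0 * (a1 * F + b1 * G) = k * F &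
      a0 * b1 - a1 * b0 = - k] := minimal_shape E0 D0 H kE.
rewrite -/D in D0.
have n0E : n0 = a0 *: X0 + b0 *: X1.
  apply: (scalerI D0); rewrite (basis_expand nn nX0 nX1 nn0) scalerDr !scalerA.
  by rewrite /a0 /b0 -/E -/F -/G !(mulrC D) !divfK// !(dotC n0) sym.
have n1E : n1 = a1 *: X0 + b1 *: X1.
  apply: (scalerI D0); rewrite (basis_expand nn nX0 nX1 nn1) scalerDr !scalerA.
  by rewrite /a1 /b1 -/E -/F -/G !(mulrC D) !divfK// !(dotC n1).
have N00 : dot n0 n0 = k * E.
  by rewrite -S1 n0E !(dotDl, dotZl) !(dotC _ (_ + _)) !(dotDl,
    dotZl) (dotC X1 X0) -/E -/F -/G; ring.
have N01 : dot n1 n0 = k * F.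
  rewrite dotC -S2 n0E n1E !(dotDl, dotZl) !(dotC _ (_ + _)) !(dotDl, dotZl) (dotC X1 X0).
  by rewrite -/E -/F -/G; ring.
split=> //.
by rewrite -S3 n0E n1E; apply: row3P; rewrite !row3E; ring.
Qed.

(** The differential of the normal and [scherk_map n] both reverse orientation conformally, so [dX]
    is a rotation and dilation of their composition. Comparing lengths,
    [|dX|^2 = (a^2 + b^2) |L n dn|^2] and [|dn|^2 = k |dX|^2], gives the last equation. The explicit
    quotients for [a] and [b] are recorded because their smoothness is read off them later. *)
Lemma minimal_scherk_rotation n X0 X1 n0 n1 (k : R) :
  dot n n = 1 -> dot n X0 = 0 -> dot n X1 = 0 -> dot n n0 = 0 -> dot n n1 = 0 ->
  regular n -> cross X0 X1 != 0 -> dot X0 n1 = dot X1 n0 ->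
  dot X0 X0 * dot X1 n1 - 2 * dot X0 X1 * dot X0 n1 + dot X1 X1 * dot X0 n0 = 0 ->
  k = - ((dot X0 n0 * dot X1 n1 - dot X0 n1 ^+ 2) / (dot X0 X0 * dot X1 X1 - dot X0 X1 ^+ 2)) ->
  0 < k ->
  exists a b,
    [/\ X0 = a *: scherk_map n n0 + b *: cross n (scherk_map n n0),
        X1 = a *: scherk_map n n1 + b *: cross n (scherk_map n n1),
        dot n0 n0 = k * dot X0 X0,
        a = dot X0 (scherk_map n n0) / dot (scherk_map n n0) (scherk_map n n0) /\
        b = dot X0 (cross n (scherk_map n n0)) / dot (scherk_map n n0) (scherk_map n n0) &
        (a ^+ 2 + b ^+ 2) * k = (1 - n 0 (inord 0) ^+ 2) * (1 - n 0 (inord 1) ^+ 2)].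
Proof.
move=> nn nX0 nX1 nn0 nn1 rn c0 sym H kE k0.
have [E0 N00 N01 N01c] := minimal_gauss_frame nn nX0 nX1 nn0 nn1 c0 sym H kE.
set E := dot X0 X0 in E0 N00 *; set F := dot X0 X1 in N01.
pose w := dot n (cross X0 X1).
have N1J : dot n1 (cross n n0) = - k * w.
  by rewrite /w -dotZr -N01c !dotE !row3E; ring.
have X1J : dot X1 (cross n X0) = w by rewrite /w !dotE !row3E; ring.
have n00 : dot n0 n0 != 0 by rewrite N00 mulf_neq0// gt_eqF.
(* [F / E] and [w / E] are the coordinates of [X1] in the orthogonal frame [X0], [cross n X0]; the
   opposite sign here expresses the reversal of orientation. *)
have n1p : n1 = (F / E) *: n0 - (w / E) *: cross n n0.
  apply: (scalerI n00); rewrite (tangent_expand nn nn1 nn0) N01 N1J N00 scalerBr !scalerA.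
  rewrite -scaleNr; congr (_ *: _ + _ *: _); by field.
have X1p : X1 = (F / E) *: X0 + (w / E) *: cross n X0.
  apply: (scalerI E0); rewrite (tangent_expand nn nX1 nX0) X1J dotC -/F scalerDr !scalerA.
  by rewrite !(mulrC E) !divfK.
set L0 := scherk_map n n0.
have nL0 : dot n L0 = 0 by exact: scherk_map_tangent.
have L00 : dot L0 L0 != 0.
  apply: contraNneq n00 => L00.
  by rewrite -(scherk_map_norm nn nn0 rn) -/L0 L00 mul0r.
set a := dot X0 L0 / dot L0 L0; set b := dot X0 (cross n L0) / dot L0 L0.
have X0p : X0 = a *: L0 + b *: cross n L0.
  apply: (scalerI L00); rewrite (tangent_expand nn nX0 nL0) scalerDr !scalerA.
  by rewrite !(mulrC (dot L0 L0)) !divfK.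
have L1 : scherk_map n n1 = (F / E) *: L0 + (w / E) *: cross n L0.
  rewrite n1p -scaleNr scherk_mapD !scherk_mapZ (scherk_map_cross nn nn0 rn) scalerN scaleNr
    opprK.
  by [].
exists a, b; split=> //.
- rewrite L1 crossDr !crossZr (double_cross nn nL0) {1}X1p {1 2}X0p crossDr !crossZr
  (double_cross nn nL0).
  by apply: row3P; rewrite !(mxDE, mxZE, mxNE); ring.
- apply: (mulIf E0).
  have EE : E = (a ^+ 2 + b ^+ 2) * dot L0 L0.
    rewrite /E X0p; transitivity (a ^+ 2 * dot L0 L0 + b ^+ 2 * dot (cross n L0) (cross n L0)).
      by rewrite !dotE !row3E; ring.
    by rewrite lagrange nn nL0; ring.
  rewrite -mulrA -N00 -(scherk_map_norm nn nn0 rn) -/L0 mulrA -EE; ring.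
Qed.

End Algebra3.

(** * The Weierstrass representation *)

Section WeierstrassAlgebra.
Local Open Scope complex_scope.
Context {R : realType}.

Lemma stereo_istereo (x y : R) : stereo (istereo x y) = x +i* y.
Proof.
have s0 := istereo_den x y.
rewrite /stereo !vec3E.
have -> : 1 - (x ^+ 2 + y ^+ 2 - 1) / (x ^+ 2 + y ^+ 2 + 1) = 2 / (x ^+ 2 + y ^+ 2 + 1).
  by field; rewrite s0.
by congr (_ +i* _); field; rewrite s0.
Qed.

Lemma half_complex : (1 / 2 : R[i]) = (1 / 2) +i* 0.
Proof.
have -> : (1 / 2) +i* 0 = (1 / 2)%:C by [].
by rewrite rmorphM fmorphV rmorph1 rmorph_nat.
Qed.

Lemma complex_quartic (x y : R) : (x +i* y) ^+ 4 - 1 =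
  (x ^+ 4 - 6 * x ^+ 2 * y ^+ 2 + y ^+ 4 - 1) +i* (4 * x ^+ 3 * y - 4 * x * y ^+ 3).
Proof.
by rewrite !exprS expr0 mulr1; apply/eqP; rewrite eq_complex /=; apply/andP; split; apply/eqP;
  ring.
Qed.

Lemma expi_Re (t a b : R) :
  complex.Re (expi t * (a +i* - b)) = cos t * a + sin t * b.
Proof. by rewrite /expi /=; ring. Qed.

(** [p +i* q] is [dG] on [v]. The three Weierstrass forms have the components of [- (1 / 4) L n v]
    as real parts, and their imaginary parts are the opposites of the components of
    [- (1 / 4) (n x L n v)]. The factor compares two normalizations: at [G = 0] the first coordinate
    of the Weierstrass integrand for [t = 0] is [- p / 2], that of [scherk_map] is [2 p]. *)
Lemma weierstrass_scherk n v (t p q : R) (dh : R[i]) (G := stereo n) :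
  dot n n = 1 -> dot n v = 0 -> regular n -> n 0 (inord 2) != 1 -> G != 0 ->
  p = v 0 (inord 0) / (1 - n 0 (inord 2)) +
    n 0 (inord 0) * v 0 (inord 2) / (1 - n 0 (inord 2)) ^+ 2 ->
  q = v 0 (inord 1) / (1 - n 0 (inord 2)) +
    n 0 (inord 1) * v 0 (inord 2) / (1 - n 0 (inord 2)) ^+ 2 ->
  1 / G * dh = 1 / (G ^+ 4 - 1) * (p +i* q) ->
  vec3 (complex.Re (1 / 2 * (1 / G - G) * (expi t * dh)))
       (complex.Re ('i / 2 * (1 / G + G) * (expi t * dh)))
       (complex.Re (expi t * dh)) =
  - (1 / 4) *: (cos t *: scherk_map n v + sin t *: cross n (scherk_map n v)).
Proof.
move=> nn nv rn n1 G0 pE qE H.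
have nE := istereo_surj nn n1; have vE := distereo_surj nn nv n1.
rewrite -pE -qE in vE.
set x := n 0 (inord 0) / (1 - n 0 (inord 2)) in nE vE.
set y := n 0 (inord 1) / (1 - n 0 (inord 2)) in nE vE.
have GE : G = x +i* y by rewrite /G nE stereo_istereo.
rewrite nE in rn; have [h1 h2] := regular_istereo rn.
have s0 := istereo_den x y.
(* The two quantities that [regular] keeps away from zero are [|G^2 + 1|^2] and [|G^2 - 1|^2] in
   stereographic coordinates, so their product is [|G^4 - 1|^2]. *)
have Q0 : G ^+ 4 - 1 != 0.
  rewrite GE complex_quartic eq_complex /= negb_and -negb_and.
  apply/negP => /andP[/eqP A0 /eqP B0].
  have : ((2 * x) ^+ 2 + (x ^+ 2 + y ^+ 2 - 1) ^+ 2) * ((2 * y) ^+ 2 + (x ^+ 2 +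
    y ^+ 2 - 1) ^+ 2) =
    (x ^+ 4 - 6 * x ^+ 2 * y ^+ 2 + y ^+ 4 - 1) ^+ 2 +
      (4 * x ^+ 3 * y - 4 * x * y ^+ 3) ^+ 2 by ring.
  by rewrite A0 B0 expr0n /= addr0 => /eqP; rewrite mulf_eq0 (negPf h1) (negPf h2).
pose W := (p +i* q) / (G ^+ 4 - 1).
have dhE : dh = G * W.
  transitivity (G * (1 / G * dh)); first by field.
  by rewrite H /W [1 / _ * _]mulrC mul1r.
have E0 : 1 / 2 * (1 / G - G) * (expi t * dh) = expi t * (1 / 2 * (1 - G ^+ 2) * W).
  by rewrite dhE; field.
have E1 : 'i / 2 * (1 / G + G) * (expi t * dh) = expi t * ('i * (1 / 2 * (1 + G ^+ 2) * W)).
  by rewrite dhE; field.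
rewrite E0 E1 dhE.
(* Clears the complex denominator of [W], after which the real and imaginary parts can be compared
   by [field]. *)
have red (A : R[i]) (a b : R) : A * (p +i* q) = (a +i* b) * (G ^+ 4 - 1) -> A * W = a +i* b.
  by move=> AE; rewrite /W mulrA AE mulfK.
set L := scherk_map n v; set M := cross n L.
have F0 : 1 / 2 * (1 - G ^+ 2) * W =
    (- (1 / 4) * L 0 (inord 0)) +i* - (- (1 / 4) * M 0 (inord 0)).
  apply: red; rewrite half_complex GE complex_quartic /M /L nE vE !row3E expr2.
  apply/eqP; rewrite eq_complex /=; apply/andP; split; apply/eqP; field; by rewrite s0 ?h1 ?h2.
have F1 : 'i * (1 / 2 * (1 + G ^+ 2) * W) =
    (- (1 / 4) * L 0 (inord 1)) +i* - (- (1 / 4) * M 0 (inord 1)).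
  rewrite mulrA; apply: red; rewrite half_complex GE complex_quartic /M /L nE vE !row3E expr2.
  apply/eqP; rewrite eq_complex /=; apply/andP; split; apply/eqP; field; by rewrite s0 ?h1 ?h2.
have F2 : G * W =
    (- (1 / 4) * L 0 (inord 2)) +i* - (- (1 / 4) * M 0 (inord 2)).
  apply: red; rewrite GE complex_quartic /M /L nE vE !row3E.
  apply/eqP; rewrite eq_complex /=; apply/andP; split; apply/eqP; field; by rewrite s0 ?h1 ?h2.
by rewrite F0 F1 F2 !expi_Re; apply: row3P; rewrite vec3E !(mxDE, mxZE); ring.
Qed.
End WeierstrassAlgebra.

(** * Immersions of the plane and open maps to the sphere *)

Section Immersion.
Context {R : realType}.
Implicit Types (U : set 'rV[R]_2).

Lemma differentiable_row n (V : normedModType R) (f : V -> 'rV[R]_n) x :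
  (forall i, differentiable (fun y => f y 0 i) x) -> differentiable f x.
Proof.
move=> df.
have -> : f = \sum_i (fun y => f y 0 i *: (delta_mx 0 i : 'rV[R]_n)).
  by apply/funext => y; rewrite fct_sumE [LHS]row_sum_delta.
apply: differentiable_sum => i; exact: differentiableZl.
Qed.

Lemma derive_coord n (V : normedModType R) (f : V -> 'rV[R]_n) x v i : differentiable f x ->
  'D_v (fun y => f y 0 i) x = 'D_v f x 0 i.
Proof. by move=> df; rewrite derive_mx ?mxE//; exact: diff_derivable. Qed.

Lemma continuous_normP (T : topologicalType) (V : normedModType R) (f : T -> V) x :
  {for x, continuous f} <-> forall e, 0 < e -> \forall y \near x, `|f x - f y| <= e.
Proof. exact: cvgrPdist_le. Qed.

Lemma near_forall (T : topologicalType) (I : finType) (P : I -> T -> Prop) (x : T) :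
  (forall i, \forall y \near x, P i y) -> \forall y \near x, forall i, P i y.
Proof. exact: filter_forall. Qed.

Lemma Ck_row n k U (f : 'rV[R]_2 -> 'rV[R]_n.+1) : open U ->
  (forall i, Ck k U (fun x => f x 0 i)) -> Ck k U f.
Proof.
move=> oU; elim: k f => [|k IH] f cf.
  move=> x Ux; apply/continuous_normP => e e0.
  have H : \forall y \near x, forall i, `|f x 0 i - f y 0 i| <= e.
    apply: near_forall => i.
    by have /continuous_normP := cf i x Ux; apply.
  apply: filterS H => y Hy.
  rewrite [leLHS]/Num.Def.normr/= mx_normrE; apply: bigmax_le; first exact: ltW.
  by move=> [i j] _ /=; rewrite !mxE ord1.
have df x : U x -> differentiable f x.
  by move=> Ux; apply: differentiable_row => i; have [d _] := cf i; exact: d.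
split=> // v; apply: IH => i.
have [_ Dv] := cf i; apply: (Ck_ext oU _ (Dv v)) => x Ux.
by rewrite derive_coord//; exact: df.
Qed.

Lemma coord_le_norm n (u : 'rV[R]_n) i : `|u 0 i| <= `|u|.
Proof.
rewrite [leRHS]/Num.Def.normr/= mx_normrE.
by apply: le_trans (le_bigmax _ _ (0, i)).
Qed.

Lemma norm_le_coord n (u : 'rV[R]_n) e : 0 <= e -> (forall i, `|u 0 i| <= e) -> `|u| <= e.
Proof.
move=> e0 H; rewrite [leLHS]/Num.Def.normr/= mx_normrE; apply: bigmax_le => //.
by move=> [i j] _ /=; rewrite ord1.
Qed.

Lemma dot_le (u v : 'rV[R]_3) : `|dot u v| <= 3 * (`|u| * `|v|).
Proof.
rewrite /dot (le_trans (ler_norm_sum _ _ _))//.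
apply: (@le_trans _ _ (\sum_(i < 3) `|u| * `|v|)).
  by apply: ler_sum => i _; rewrite normrM ler_pM// coord_le_norm.
rewrite sumr_const card_ord -[leLHS]mulr_natl; exact: lexx.
Qed.

Lemma norm_le_dot (u : 'rV[R]_3) : `|u| ^+ 2 <= dot u u.
Proof.
rewrite -[leRHS]sqr_sqrtr ?dot_ge0// ler_sqr ?nnegrE ?sqrtr_ge0//.
apply: norm_le_coord => [|i]; first exact: sqrtr_ge0.
rewrite -sqrtr_sqr ler_sqrt ?dot_ge0// /dot (bigD1 i)//= expr2 lerDl.
by apply: sumr_ge0 => j _; rewrite -expr2 sqr_ge0.
Qed.

Lemma is_derive_dot (V : normedModType R) (f g : V -> 'rV[R]_3) x v :
  differentiable f x -> differentiable g x ->
  is_derive x v (fun y => dot (f y) (g y)) (dot ('D_v f x) (g x) + dot (f x) ('D_v g x)).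
Proof.
move=> df dg.
have dc (h : V -> 'rV[R]_3) i : differentiable h x ->
    is_derive x v (fun y => h y 0 i) ('D_v h x 0 i).
  move=> dh; rewrite -derive_coord//; apply: derivableP; apply: diff_derivable.
  exact: (@differentiable_comp _ _ _ _ h (fun w : 'rV[R]_3 => w 0 i)) dh (differentiable_coord
    _ _ _).
have -> : (fun y => dot (f y) (g y)) = \sum_(i < 3) (fun y => f y 0 i * g y 0 i).
  by apply/funext => y; rewrite fct_sumE.
apply: is_derive_eq.
  apply: (@is_derive_sum _ _ _ _ _ _ _ (fun i => f x 0 i *: 'D_v g x 0 i +
    g x 0 i *: 'D_v f x 0 i)) => i.
  by apply: (@is_deriveM _ _ (fun y => f y 0 i) (fun y => g y 0 i)); exact: dc.
rewrite big_split /= addrC /dot; congr (_ + _).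
by apply: eq_bigr => i _; rewrite mulrC.
Qed.

Lemma differentiable_dot (V : normedModType R) (f g : V -> 'rV[R]_3) x :
  differentiable f x -> differentiable g x ->
  differentiable (fun y => dot (f y) (g y)) x.
Proof.
move=> df dg.
have dc (h : V -> 'rV[R]_3) i : differentiable h x -> differentiable (fun y => h y 0 i) x.
  move=> dh.
  exact: (@differentiable_comp _ _ _ _ h (fun w : 'rV[R]_3 => w 0 i)) dh (differentiable_coord
    _ _ _).
have -> : (fun y => dot (f y) (g y)) = \sum_(i < 3) (fun y => f y 0 i * g y 0 i).
  by apply/funext => y; rewrite fct_sumE.
by apply: differentiable_sum => i; apply: differentiableM; exact: dc.
Qed.

Lemma derive_dotl (V : normedModType R) (f : V -> 'rV[R]_3) w x v : differentiable f x ->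
  'D_v (fun y => dot (f y) w) x = dot ('D_v f x) w.
Proof.
move=> df; have dw : differentiable (fun _ : V => w) x by exact: differentiable_cst.
rewrite (@derive_val _ _ _ _ _ _ _ (is_derive_dot v df dw)) derive_cst.
by rewrite [X in _ + X]dotE !mx0E !mulr0 !addr0.
Qed.

Lemma Ck_dot k U (f g : 'rV[R]_2 -> 'rV[R]_3) : open U -> Ck k U f -> Ck k U g ->
  Ck k U (fun x => dot (f x) (g x)).
Proof.
move=> oU Cf Cg; apply: (@Ck_ext _ _ _ _ (fun x => f x 0 (inord 0) * g x 0 (inord 0) +
  f x 0 (inord 1) * g x 0 (inord 1) + f x 0 (inord 2) * g x 0 (inord 2))) => //.
  by move=> x _; rewrite dotE.
by do 2?[apply: CkD => //]; apply: CkM => //; exact: Ck_coord.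
Qed.

Lemma Ck_vcst n k U (a : 'rV[R]_n.+1) : open U -> Ck k U (fun=> a).
Proof. by move=> oU; apply: Ck_row => // i; exact: Ck_cst. Qed.

Lemma dual_basis (u0 u1 : 'rV[R]_3) : cross u0 u1 != 0 ->
  exists w0 w1, [/\ dot u0 w0 = 1, dot u1 w0 = 0, dot u0 w1 = 0 & dot u1 w1 = 1].
Proof.
move=> c0; have cc : dot (cross u0 u1) (cross u0 u1) != 0 by rewrite dot_eq0.
exists ((dot (cross u0 u1) (cross u0 u1))^-1 *: cross u1 (cross u0 u1)).
exists ((dot (cross u0 u1) (cross u0 u1))^-1 *: cross (cross u0 u1) u0).
by split; rewrite dotC dotZl; [apply: (mulfI cc); rewrite mulVKf// mulr1
  |apply: (mulfI cc); rewrite mulVKf// mulr0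
  |apply: (mulfI cc); rewrite mulVKf// mulr0
  |apply: (mulfI cc); rewrite mulVKf// mulr1]; rewrite !dotE !row3E; ring.
Qed.

Lemma near_partial U (f : 'rV[R]_2 -> R) x0 v (a e : R) : Ck 1 U f -> U x0 ->
  'D_v f x0 = a -> 0 < e -> \forall x \near x0, `|'D_v f x - a| <= e.
Proof.
move=> [_ Df] Ux0 <- e0; have := Df v x0; rewrite inE => /(_ Ux0) /continuous_normP /(_ e e0).
by apply: filterS => y; rewrite distrC.
Qed.

Lemma absorb_half (x y : R) : x <= y + 1 / 2 * x -> x <= 2 * y.
Proof. by move=> ?; lra. Qed.

Lemma immersion_lipschitz U (m : 'rV[R]_2 -> 'rV[R]_3) x0 : open U -> Ck 1 U m -> U x0 ->
  cross (pd 0 m x0) (pd 1 m x0) != 0 ->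
  exists C r, [/\ 0 < C, 0 < r, ball x0 r `<=` U &
    forall x y, ball x0 r x -> ball x0 r y -> `|x - y| <= C * `|m x - m y|].
Proof.
move=> oU Cm Ux0 /dual_basis[w0 [w1 [E00 E10 E01 E11]]].
have [dm _] := Cm.
have Cf w : Ck 1 U (fun x => dot (m x) w) := @Ck_dot 1 U m (fun=> w) oU Cm (Ck_vcst 1 w oU).
have D w (i : 'I_2) a : dot (pd i m x0) w = a -> 'D_(delta_mx 0 i) (fun x => dot (m x) w) x0 = a.
  by move=> <-; rewrite derive_dotl//; exact: dm.
(* Two partial derivatives, each off by at most [1 / 4], leave an error of at most
   [1 / 2 * |x - y|]. *)
have e4 : (0 : R) < 1 / 4 by [].
have N00 := near_partial (Cf w0) Ux0 (D _ _ _ E00) e4.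
have N10 := near_partial (Cf w0) Ux0 (D _ _ _ E10) e4.
have N01 := near_partial (Cf w1) Ux0 (D _ _ _ E01) e4.
have N11 := near_partial (Cf w1) Ux0 (D _ _ _ E11) e4.
have nU : nbhs x0 U by exact: open_nbhs_nbhs.
have [r /= r0 Hr] := (nbhs_ballP _ _).1
  (filterI nU (filterI (filterI N00 N10) (filterI N01 N11))).
pose W := `|w0| + `|w1| + 1.
have W0 : 0 < W by rewrite ltr_wpDl// addr_ge0.
(* The [3] of [dot_le], where norms are sup norms, doubled by absorbing the half. *)
exists (6 * W), r; split=> //; first by rewrite mulr_gt0.
  by move=> x /Hr[].
move=> x y xr yr.
have key w (i : 'I_2) : `|w| <= W ->
    (forall z, ball x0 r z -> `|(x - y) 0 i - 'D_(x - y) (fun x => dot (m x) w) z| <= 1 / 2 *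
      `|x - y|) ->
    `|(x - y) 0 i| <= 3 * W * `|m x - m y| + 1 / 2 * `|x - y|.
  move=> wW H.
  have [z zr Ez] := @MVT_ball _ _ (fun x => dot (m x) w) x0 r y x
    (fun z zr => (Cf w).1 z (Hr z zr).1) yr xr.
  have -> : (x - y) 0 i = (dot (m x) w - dot (m y) w) +
    ((x - y) 0 i - 'D_(x - y) (fun x => dot (m x) w) z) by rewrite Ez; ring.
  rewrite (le_trans (ler_normD _ _))// lerD ?H//.
  have -> : dot (m x) w - dot (m y) w = dot (m x - m y) w.
    by rewrite !dotE !row3E; ring.
  rewrite (le_trans (dot_le _ _))// -mulrA ler_wpM2l// mulrC ler_wpM2r//.
have bound (a b c d : R) : `|a| <= 1 / 4 -> `|b| <= 1 / 4 ->
    `|c| <= `|x - y| -> `|d| <= `|x - y| -> `|c * a + d * b| <= 1 / 2 * `|x - y|.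
  move=> ha hb hc hd; rewrite (le_trans (ler_normD _ _))// !normrM.
  have -> : 1 / 2 * `|x - y| = `|x - y| * (1 / 4) + `|x - y| * (1 / 4) by field.
  by apply: lerD; apply: ler_pM.
have part w z : ball x0 r z -> 'D_(x - y) (fun x => dot (m x) w) z =
    (x - y) 0 0 * 'D_(delta_mx 0 0) (fun x => dot (m x) w) z +
    (x - y) 0 1 * 'D_(delta_mx 0 1) (fun x => dot (m x) w) z.
  by move=> zr; rewrite derive_partials//; exact: ((Cf w).1 z (Hr z zr).1).
have K0 : `|(x - y) 0 0| <= 3 * W * `|m x - m y| + 1 / 2 * `|x - y|.
  apply: (key w0); first by rewrite /W -addrA lerDl addr_ge0.
  move=> z zr; have [_ [[h0 h1] _]] := Hr z zr; rewrite (part _ _ zr) -[leLHS]normrN.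
  set d0 := derive _ _ _; set d1 := derive _ _ _.
  have -> : - ((x - y) 0 0 - ((x - y) 0 0 * d0 + (x - y) 0 1 * d1)) =
    (x - y) 0 0 * (d0 - 1) + (x - y) 0 1 * (d1 - 0) by ring.
  by apply: bound => //; exact: coord_le_norm.
have K1 : `|(x - y) 0 1| <= 3 * W * `|m x - m y| + 1 / 2 * `|x - y|.
  apply: (key w1); first by rewrite /W addrAC lerDr addr_ge0.
  move=> z zr; have [_ [_ [h0 h1]]] := Hr z zr; rewrite (part _ _ zr) -[leLHS]normrN.
  set d0 := derive _ _ _; set d1 := derive _ _ _.
  have -> : - ((x - y) 0 1 - ((x - y) 0 0 * d0 + (x - y) 0 1 * d1)) =
    (x - y) 0 0 * (d0 - 0) + (x - y) 0 1 * (d1 - 1) by ring.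
  by apply: bound => //; exact: coord_le_norm.
have : `|x - y| <= 3 * W * `|m x - m y| + 1 / 2 * `|x - y|.
  apply: norm_le_coord; first by rewrite addr_ge0// mulr_ge0// mulr_ge0// ltW.
  move=> i; have [->|->] := ord2P i.
  - exact: K0.
  - exact: K1.
move=> /absorb_half h; apply: le_trans h _.
by have -> : 2 * (3 * W * `|m x - m y|) = 6 * W * `|m x - m y| by ring.
Qed.
End Immersion.

Section OpenMap.
Context {R : realType}.
Implicit Types (U : set 'rV[R]_2).

Lemma derive_local_min (V : normedModType R) (f : V -> R) x r v : 0 < r ->
  (forall y, ball x r y -> differentiable f y) ->
  (forall y, ball x r y -> f x <= f y) -> 'D_v f x = 0.
Proof.
move=> r0 df fmin; pose d := r / (`|v| + 1).
have v0 : 0 < `|v| + 1 by rewrite ltr_wpDl.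
have d0 : 0 < d by rewrite divr_gt0.
have inb t : t \in `]-d, d[ -> ball x r (x + t *: v).
  rewrite in_itv/= -ltr_norml => td; rewrite -ball_normE/= opprD addrA subrr sub0r normrN normrZ.
  have : `|t| * (`|v| + 1) < r by rewrite -ltr_pdivlMr.
  by apply: le_lt_trans; rewrite ler_wpM2l// lerDl.
have x0E : x + 0 *: v = x by rewrite scale0r addr0.
have d00 : 0 \in `]-d, d[ by rewrite in_itv/= oppr_lt0 d0.
have dl t : t \in `]-d, d[ -> is_derive t 1 (fun t : R => f (x + t *: v)) ('D_v f (x + t *: v)).
  by move=> /inb ts; apply/is_derive_line/df.
have D0 : is_derive (0 : R) (1 : R) (fun t : R => f (x + t *: v)) (0 : R).
  apply: (@derive1_at_min _ _ (- d) d) => //.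
  - by rewrite ge0_cp // ltW.
  - by move=> t /dl[].
  - by move=> t /inb tb; rewrite x0E; exact: fmin.
rewrite -[x]x0E; have [_ <-] := dl 0 d00.
by have [_ E] := D0; exact: E.
Qed.

Lemma derive_dot_unit (V : normedModType R) (m : V -> 'rV[R]_3) x v :
  (\forall y \near x, dot (m y) (m y) = 1) -> differentiable m x ->
  dot (m x) ('D_v m x) = 0.
Proof.
move=> m1 dm; have : 'D_v (fun y => dot (m y) (m y)) x = 0.
  by rewrite (@near_eq_derive _ _ _ _ (fun=> 1 : R)) ?derive_cst.
rewrite (@derive_val _ _ _ _ _ _ _ (is_derive_dot v dm dm)) (dotC ('D_v m x)) -mulr2n => /eqP.
by rewrite mulrn_eq0/= => /eqP.
Qed.

Lemma orthogonal_tangent_frame (n u0 u1 y : 'rV[R]_3) : dot n n = 1 -> dot y y = 1 ->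
  dot n u0 = 0 -> dot n u1 = 0 -> cross u0 u1 != 0 -> dot y u0 = 0 -> dot y u1 = 0 ->
  y = n \/ y = - n.
Proof.
move=> nn yy nu0 nu1 c0 yu0 yu1.
pose z := y - dot n y *: n.
have nz : dot n z = 0.
  rewrite /z dotC dotDl -scaleNr dotZl nn (dotC y); ring.
have zu0 : dot z u0 = 0 by rewrite /z -scaleNr dotDl dotZl nu0 yu0 mulr0 addr0.
have zu1 : dot z u1 = 0 by rewrite /z -scaleNr dotDl dotZl nu1 yu1 mulr0 addr0.
have D0 : dot u0 u0 * dot u1 u1 - dot u0 u1 ^+ 2 != 0 by rewrite -lagrange dot_eq0.
have z0 : z = 0.
  apply: (scalerI D0); rewrite (basis_expand nn nu0 nu1 nz) zu0 zu1.
  by rewrite !mulr0 subrr !scale0r addr0 scaler0.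
have yE : y = dot n y *: n by apply/eqP; rewrite -subr_eq0 -/z z0.
have /eqP : dot n y ^+ 2 = 1.
  by move: yy; rewrite {1}yE dotZl -expr2.
rewrite -subr_eq0 subr_sqr_1 mulf_eq0 subr_eq0 addr_eq0 => /orP[/eqP e|/eqP e]; [left|right].
  by rewrite yE e scale1r.
by rewrite yE e scaleN1r.
Qed.

Lemma compact_norm_ball n (x : 'rV[R]_n) r : 0 < r -> compact [set y | `|x - y| <= r].
Proof.
move=> r0; apply: bounded_closed_compact.
  exists (`|x| + r); split; first exact: num_real.
  move=> M hM y /= xy; apply: le_trans (ltW hM).
  have -> : y = x - (x - y) by rewrite opprB addrC subrK.
  by rewrite (le_trans (ler_normB _ _))// lerD2l.
by have := @closed_ball_closed _ _ x r; rewrite closed_ballE.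
Qed.

(* The squared distance from a nearby point of the sphere to [m x] has an interior minimum on a
   small closed disc, and at a critical point the difference is normal to the sphere. *)
Lemma sphere_open_map U A (m : 'rV[R]_2 -> 'rV[R]_3) x0 : open U -> open A -> Ck 1 U m ->
  (forall x, U x -> dot (m x) (m x) = 1) ->
  (forall x, U x -> cross (pd 0 m x) (pd 1 m x) != 0) -> U x0 -> A x0 ->
  exists2 e, 0 < e & forall y, dot y y = 1 -> `|m x0 - y| < e ->
    exists x, [/\ U x, A x & m x = y].
Proof.
move=> oU oA Cm m1 mc Ux0 Ax0.
have [C [r [C0 r0 rU lip]]] := immersion_lipschitz oU Cm Ux0 (mc _ Ux0).
have nA : nbhs x0 A by exact: open_nbhs_nbhs.
have [r1 /= r10 r1A] := (nbhs_ballP _ _).1 nA.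
pose s := Num.min r r1 / 2.
have mr0 : 0 < Num.min r r1 by rewrite lt_min r0.
have s0 : 0 < s by rewrite divr_gt0.
have smr : s < Num.min r r1 by rewrite ltr_pdivrMr// ltr_pMr// ltr1n.
have sr : s < r by apply: lt_le_trans smr _; rewrite ge_min lexx.
have sr1 : s < r1 by apply: lt_le_trans smr _; rewrite ge_min lexx orbT.
(* The first bound keeps the minimum off the boundary of the disc: [|m x0 - m x| < 4 * e] forces
   [|x0 - x| < s]. The second makes the minimal squared distance smaller than [4], which excludes
   the antipodal critical point. *)
pose e := Num.min (s / (4 * C)) (1 / 2).
have e0 : 0 < e by rewrite lt_min !divr_gt0// mulr_gt0.
have le_bound (b : R) : b <= (1 / 2) ^+ 2 -> 3 * b < 4 by lra.
exists e => // y yy ye.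
have inb x : `|x0 - x| <= s -> ball x0 r x by move=> h; rewrite -ball_normE/=;
  exact: le_lt_trans sr.
have dm x : U x -> differentiable m x by have [d _] := Cm; exact: d.
have dmy x : U x -> differentiable (fun x => m x - y) x.
  by move=> Ux; apply: differentiableB => //; exact: dm.
pose phi x := dot (m x - y) (m x - y).
have dphi x : U x -> differentiable phi x.
  by move=> Ux; apply: differentiable_dot; exact: dmy.
pose B := [set x | `|x0 - x| <= s].
have B0 : B !=set0 by exists x0; rewrite /B/= subrr normr0 ltW.
have cphi : {within B, continuous phi}.
  apply: continuous_in_subspaceT => x /[!inE] Bx.
  exact/differentiable_continuous/dphi/rU/inb.
have [x /[!inE] Bx xmin] := EVT_min_rV B0 (@compact_norm_ball _ x0 s s0) cphi.
have Ux : U x by exact/rU/inb.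
have phi0 : phi x <= 3 * e ^+ 2.
  apply: (@le_trans _ _ (phi x0)); first by apply: xmin; rewrite inE /B/= subrr normr0 ltW.
  rewrite /phi; apply: le_trans (ler_norm _) _; apply: le_trans (dot_le _ _) _.
  by rewrite ler_wpM2l// -expr2 ler_sqr ?nnegrE// ltW.
have xe : `|m x - y| <= 2 * e.
  rewrite -ler_sqr ?nnegrE ?mulr_ge0 ?(ltW e0)//.
  apply: le_trans (norm_le_dot _) _; apply: le_trans phi0 _.
  by rewrite exprMn ler_wpM2r ?sqr_ge0//; lra.
have xs : `|x0 - x| < s.
  have x0r : ball x0 r x0 by exact: ballxx.
  apply: le_lt_trans (lip _ _ x0r (inb _ Bx)) _.
  have : `|m x0 - m x| < 4 * e.
    have -> : m x0 - m x = (m x0 - y) - (m x - y) by rewrite opprB addrA subrK.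
    apply: le_lt_trans (ler_normB _ _) _; move: ye xe.
    by move: `|m x0 - y| `|m x - y| => a b; lra.
  rewrite -(ltr_pM2l C0) => /lt_le_trans; apply.
  have : e <= s / (4 * C) by rewrite ge_min lexx.
  rewrite ler_pdivlMr ?mulr_gt0//.
  by have -> : e * (4 * C) = C * (4 * e) by ring.
have Ax : A x by apply: r1A; rewrite -ball_normE/=; exact: lt_trans sr1.
exists x; split=> //.
have crit v : dot ('D_v m x) y = 0.
  have r2 : 0 < s - `|x0 - x| by rewrite subr_gt0.
  have sub z : ball x (s - `|x0 - x|) z -> B z.
    rewrite -ball_normE/= /B/= ltrBrDl => h.
    have -> : x0 - z = (x0 - x) + (x - z) by rewrite addrA subrK.
    by rewrite (le_trans (ler_normD _ _))// ltW.
  have : 'D_v phi x = 0.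
    apply: (@derive_local_min _ phi x _ v r2) => z /sub Bz.
      exact/dphi/rU/inb.
    by apply: xmin; rewrite inE.
  rewrite (@derive_val _ _ _ _ _ _ _ (is_derive_dot v (dmy _ Ux) (dmy _ Ux))).
  have -> : 'D_v (fun x => m x - y) x = 'D_v m x.
    rewrite deriveB; [|exact/diff_derivable/dm|exact: derivable_cst].
    by rewrite derive_cst subr0.
  rewrite (dotC (m x - y)) -mulr2n => /eqP; rewrite mulrn_eq0/= dotC dotDl -scaleN1r dotZl.
  rewrite derive_dot_unit; last exact: dm.
    by rewrite add0r mulN1r oppr_eq0 dotC => /eqP.
  by apply: (near_open oU Ux).
have tang v : dot (m x) ('D_v m x) = 0.
  by apply: derive_dot_unit; [apply: (near_open oU Ux)|exact: dm].
(* A unit vector orthogonal to the tangent plane of the sphere at [m x] is [m x] or its antipode,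
   and the antipode lies at squared distance [4]. *)
have [->//|yE] := orthogonal_tangent_frame (m1 _ Ux) yy (tang _) (tang _) (mc _ Ux)
  (etrans (dotC _ _) (crit _)) (etrans (dotC _ _) (crit _)).
have : phi x = 4.
  rewrite /phi yE opprK; have -> : dot (m x + m x) (m x + m x) = 4 * dot (m x) (m x).
    by rewrite !dotE !row3E; ring.
  by rewrite m1// mulr1.
have : e ^+ 2 <= (1 / 2) ^+ 2 by rewrite ler_sqr ?nnegrE ?(ltW e0)// ge_min lexx orbT.
by move=> /le_bound h /eqP; rewrite lt_eqF// (le_lt_trans phi0)// h.
Qed.

End OpenMap.

(** * Closedness of the Scherk forms *)

Section SmoothVectorFields.
Context {R : realType}.
Implicit Types (U : set 'rV[R]_2).

Lemma Ck_row3 k U (f : 'rV[R]_2 -> 'rV[R]_3) : open U ->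
  Ck k U (fun x => f x 0 (inord 0)) -> Ck k U (fun x => f x 0 (inord 1)) ->
  Ck k U (fun x => f x 0 (inord 2)) -> Ck k U f.
Proof. by move=> oU ? ? ?; apply: Ck_row => // i; case: (ord3P i) => ->. Qed.

Lemma Ck_vec3 k U (f g h : 'rV[R]_2 -> R) : open U ->
  Ck k U f -> Ck k U g -> Ck k U h -> Ck k U (fun x => vec3 (f x) (g x) (h x)).
Proof.
move=> oU Cf Cg Ch; apply: (Ck_row3 oU).
- by apply: Ck_ext oU _ Cf => x _; rewrite vec3E.
- by apply: Ck_ext oU _ Cg => x _; rewrite vec3E.
- by apply: Ck_ext oU _ Ch => x _; rewrite vec3E.
Qed.

Lemma Ck_cross k U (f g : 'rV[R]_2 -> 'rV[R]_3) : open U -> Ck k U f -> Ck k U g ->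
  Ck k U (fun x => cross (f x) (g x)).
Proof.
move=> oU Cf Cg; have cf i := Ck_coord i oU Cf; have cg i := Ck_coord i oU Cg.
by apply: (Ck_vec3 oU); apply: (CkB oU); exact: (CkM oU).
Qed.

Lemma Ck_scale k U (a : 'rV[R]_2 -> R) (f : 'rV[R]_2 -> 'rV[R]_3) : open U -> Ck k U a ->
  Ck k U f ->
  Ck k U (fun x => a x *: f x).
Proof.
move=> oU Ca Cf; have cf i := Ck_coord i oU Cf.
apply: (Ck_row oU) => i; apply: Ck_ext oU _ (CkM oU Ca (cf i)) => x _.
by rewrite mxE.
Qed.

Lemma Ck_add k U (f g : 'rV[R]_2 -> 'rV[R]_3) : open U -> Ck k U f -> Ck k U g ->
  Ck k U (fun x => f x + g x).
Proof.
move=> oU Cf Cg; have cf i := Ck_coord i oU Cf; have cg i := Ck_coord i oU Cg.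
apply: (Ck_row oU) => i; apply: Ck_ext oU _ (CkD oU (cf i) (cg i)) => x _.
by rewrite mxE.
Qed.

Lemma Ck_scherk_map k U (m w : 'rV[R]_2 -> 'rV[R]_3) : open U -> Ck k U m -> Ck k U w ->
  (forall x, U x -> regular (m x)) -> Ck k U (fun x => scherk_map (m x) (w x)).
Proof.
move=> oU Cm Cw rm; have cm i := Ck_coord i oU Cm; have cw i := Ck_coord i oU Cw.
have c1 : Ck k U (fun x => (m x 0 (inord 0) ^+ 2 + m x 0 (inord 2) ^+ 2)^-1).
  apply: (CkV oU) => [x /rm[]//|]; apply: (CkD oU); exact: CkM.
have c2 : Ck k U (fun x => (m x 0 (inord 1) ^+ 2 + m x 0 (inord 2) ^+ 2)^-1).
  apply: (CkV oU) => [x /rm[]//|]; apply: (CkD oU); exact: CkM.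
apply: (Ck_vec3 oU).
- by apply: (CkN oU); apply: (CkM oU _ c1); apply: (CkB oU); exact: CkM.
- by apply: (CkM oU _ c2); apply: (CkB oU); exact: CkM.
- by apply: (CkB oU); [apply: (CkM oU _ c1)|apply: (CkM oU _ c2)]; apply: (CkD oU); exact: CkM.
Qed.

Lemma Ck_unit_normal k U (f : 'rV[R]_2 -> 'rV[R]_3) : open U -> Ck k.+1 U f ->
  (forall x, U x -> cross (pd 0 f x) (pd 1 f x) <> 0) -> Ck k U (unit_normal f).
Proof.
move=> oU [_ Cf] f0; have C i : Ck k U (pd i f) by exact: Cf.
have Cc := Ck_cross oU (C 0) (C 1).
have pos x : U x -> 0 < dot (cross (pd 0 f x) (pd 1 f x)) (cross (pd 0 f x) (pd 1 f x)).
  by move=> /f0/eqP h; rewrite lt_def dot_ge0 dot_eq0 h.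
apply: (Ck_scale oU _ Cc); apply: (CkV oU).
  by move=> x /pos h; rewrite gt_eqF// sqrtr_gt0.
by apply: (Ck_sqrt oU pos); exact: Ck_dot.
Qed.

Lemma unit_normal_unit (f : 'rV[R]_2 -> 'rV[R]_3) x : cross (pd 0 f x) (pd 1 f x) <> 0 ->
  dot (unit_normal f x) (unit_normal f x) = 1.
Proof.
move=> /eqP h; rewrite /unit_normal dotZl dotC dotZl mulrA -expr2 exprVn sqr_sqrtr ?dot_ge0//.
by rewrite mulVf// dot_eq0.
Qed.

Lemma unit_normal_orthogonal (f : 'rV[R]_2 -> 'rV[R]_3) x (i : 'I_2) :
  dot (unit_normal f x) (pd i f x) = 0.
Proof.
rewrite /unit_normal dotZl dotC.
have [->|->] := ord2P i.
  by rewrite dot_cross_l mulr0.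
by rewrite dot_cross_r mulr0.
Qed.

Lemma derive_quotient (N D : 'rV[R]_2 -> R) x v : differentiable N x -> differentiable D x ->
  D x != 0 -> 'D_v (fun y => N y / D y) x = ('D_v N x * D x - N x * 'D_v D x) / D x ^+ 2.
Proof.
move=> dN dD D0; have dV := differentiableV dD D0.
rewrite (@deriveM _ _ N (fun y => (D y)^-1)); [|exact: diff_derivable..].
rewrite (@deriveV _ _ D)//; last exact: diff_derivable.
rewrite /GRing.scale /=; move: ('D_v N x) ('D_v D x) (N x) (D x) D0 => a b c d d0.
by field.
Qed.

Lemma derive_mul2 (f g F G : 'rV[R]_2 -> R) (s : R) x v :
  differentiable f x -> differentiable g x -> differentiable F x -> differentiable G x ->
  'D_v (fun y => f y * F y + s * (g y * G y)) x =
  'D_v f x * F x + f x * 'D_v F x + s * ('D_v g x * G x + g x * 'D_v G x).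
Proof.
move=> df dg dF dG.
have M (p q : 'rV[R]_2 -> R) : differentiable p x -> differentiable q x ->
    'D_v (fun y => p y * q y) x = 'D_v p x * q x + p x * 'D_v q x.
  move=> dp dq; rewrite (@deriveM _ _ p q); [|exact: diff_derivable..].
  by rewrite /GRing.scale /= addrC (mulrC (q x)).
have d1 : differentiable (fun y => f y * F y) x by exact: differentiableM.
have d2 : differentiable (fun y => g y * G y) x by exact: differentiableM.
rewrite (@deriveD _ _ _ (fun y => f y * F y) (fun y => s * (g y * G y))).
- by rewrite M// (@deriveZ _ _ _ (fun y => g y * G y)) ?M//; exact: diff_derivable.
- exact: diff_derivable.
- by apply: (@derivableZ _ _ _ (fun y => g y * G y)); exact: diff_derivable.
Qed.

Lemma closed_quotient_angle (f g fu fv gu gv fuv fvu guv gvu : R) :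
  f ^+ 2 + g ^+ 2 != 0 -> fuv = fvu -> guv = gvu ->
  ((gu * fv + g * fuv - (fu * gv + f * guv)) * (f ^+ 2 + g ^+ 2) -
    (g * fv - f * gv) * (2 * (f * fu + g * gu))) / (f ^+ 2 + g ^+ 2) ^+ 2 =
  ((gv * fu + g * fvu - (fv * gu + f * gvu)) * (f ^+ 2 + g ^+ 2) -
    (g * fu - f * gu) * (2 * (f * fv + g * gv))) / (f ^+ 2 + g ^+ 2) ^+ 2.
Proof. by move=> D0 -> ->; field; rewrite D0. Qed.

Lemma closed_quotient_log (f g fu fv gu gv fuv fvu guv gvu : R) :
  f ^+ 2 + g ^+ 2 != 0 -> fuv = fvu -> guv = gvu ->
  ((fu * fv + f * fuv + (gu * gv + g * guv)) * (f ^+ 2 + g ^+ 2) -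
    (f * fv + g * gv) * (2 * (f * fu + g * gu))) / (f ^+ 2 + g ^+ 2) ^+ 2 =
  ((fv * fu + f * fvu + (gv * gu + g * gvu)) * (f ^+ 2 + g ^+ 2) -
    (f * fu + g * gu) * (2 * (f * fv + g * gv))) / (f ^+ 2 + g ^+ 2) ^+ 2.
Proof. by move=> D0 -> ->; field; rewrite D0. Qed.

(** [P] is the differential of the angle [atan (f / g)] and [Q] that of [1 / 2 * ln (f^2 + g^2)].
    Stating closedness of the quotients avoids choosing a branch of the angle. *)
Lemma closed_quotient U (f g : 'rV[R]_2 -> R) x : open U -> Ck 2 U f -> Ck 2 U g -> U x ->
  f x ^+ 2 + g x ^+ 2 != 0 ->
  let P v y := (g y * 'D_v f y - f y * 'D_v g y) / (f y ^+ 2 + g y ^+ 2) in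
  let Q v y := (f y * 'D_v f y + g y * 'D_v g y) / (f y ^+ 2 + g y ^+ 2) in
  forall u v, 'D_u (P v) x = 'D_v (P u) x /\ 'D_u (Q v) x = 'D_v (Q u) x.
Proof.
move=> oU Cf Cg Ux D0 P Q u v.
have [df Df] := Cf; have [dg Dg] := Cg.
have dfx := df _ Ux; have dgx := dg _ Ux.
have ddf w : differentiable ('D_w f) x by have [d _] := Df w; exact: d.
have ddg w : differentiable ('D_w g) x by have [d _] := Dg w; exact: d.
have Den w : 'D_w (fun y => f y ^+ 2 + g y ^+ 2) x = 2 * (f x * 'D_w f x + g x * 'D_w g x).
  have -> : (fun y => f y ^+ 2 + g y ^+ 2) = (fun y => f y * f y + 1 * (g y * g y)).
    by apply/funext => y; rewrite mul1r !expr2.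
  by rewrite derive_mul2//; ring.
have dDen : differentiable (fun y => f y ^+ 2 + g y ^+ 2) x.
  by apply: differentiableD; apply: differentiableM.
have NP w z : 'D_w (fun y => g y * 'D_z f y - f y * 'D_z g y) x =
    'D_w g x * 'D_z f x + g x * 'D_w ('D_z f) x - ('D_w f x * 'D_z g x + f x * 'D_w ('D_z g) x).
  have -> : (fun y => g y * 'D_z f y - f y * 'D_z g y) =
     (fun y => g y * 'D_z f y + (-1) * (f y * 'D_z g y)) by apply/funext => y; rewrite mulN1r.
  by rewrite derive_mul2// mulN1r.
have NQ w z : 'D_w (fun y => f y * 'D_z f y + g y * 'D_z g y) x =
    'D_w f x * 'D_z f x + f x * 'D_w ('D_z f) x + ('D_w g x * 'D_z g x + g x * 'D_w ('D_z g) x).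
  have -> : (fun y => f y * 'D_z f y + g y * 'D_z g y) =
     (fun y => f y * 'D_z f y + 1 * (g y * 'D_z g y)) by apply/funext => y; rewrite mul1r.
  by rewrite derive_mul2// mul1r.
have dP z : differentiable (fun y => g y * 'D_z f y - f y * 'D_z g y) x.
  by apply: differentiableB; apply: differentiableM.
have dQ z : differentiable (fun y => f y * 'D_z f y + g y * 'D_z g y) x.
  by apply: differentiableD; apply: differentiableM.
have Sf := derive_sym u v oU Cf Ux; have Sg := derive_sym u v oU Cg Ux.
have EP w z := @derive_quotient _ _ x w (dP z) dDen D0.
have EQ w z := @derive_quotient _ _ x w (dQ z) dDen D0.
split.
  apply: (etrans (EP u v)); apply: esym; apply: (etrans (EP v u)); apply: esym.
  by rewrite !NP !Den; exact: (closed_quotient_angle _ _ _ _ D0 (esym Sf) (esym Sg)).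
apply: (etrans (EQ u v)); apply: esym; apply: (etrans (EQ v u)); apply: esym.
by rewrite !NQ !Den; exact: (closed_quotient_log _ _ _ _ D0 (esym Sf) (esym Sg)).
Qed.

End SmoothVectorFields.

Section ScherkForms.
Context {R : realType}.
Implicit Types (U : set 'rV[R]_2) (f m : 'rV[R]_2 -> 'rV[R]_3).

Lemma differentiable_coords (V : normedModType R) (f : V -> 'rV[R]_3) i x :
  differentiable f x -> differentiable (fun y => f y 0 i) x.
Proof.
move=> df.
exact: (@differentiable_comp _ _ _ _ f (fun w : 'rV[R]_3 => w 0 i)) df (differentiable_coord _
  _ _).
Qed.

Lemma deriveM_scalar (V : normedModType R) (p q : V -> R) x v :
  differentiable p x -> differentiable q x ->
  'D_v (fun y => p y * q y) x = 'D_v p x * q x + p x * 'D_v q x.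
Proof.
move=> dp dq; rewrite (@deriveM _ _ p q); [|exact: diff_derivable..].
by rewrite /GRing.scale /= addrC (mulrC (q x)).
Qed.

Lemma derive_scale (V : normedModType R) (a : V -> R) (f : V -> 'rV[R]_3) x v :
  differentiable a x -> differentiable f x ->
  'D_v (fun y => a y *: f y) x = 'D_v a x *: f x + a x *: 'D_v f x.
Proof.
move=> da df; have d : differentiable (fun y => a y *: f y) x.
  apply: differentiable_row => i.
  have -> : (fun y => (a y *: f y) 0 i) = (fun y => a y * f y 0 i).
    by apply/funext => y; rewrite mxE.
  by apply: differentiableM => //; exact: differentiable_coords.
apply/rowP => i; rewrite -derive_coord// !mxE -derive_coord//.
have -> : (fun y => (a y *: f y) 0 i) = (fun y => a y * f y 0 i).
  by apply/funext => y; rewrite mxE.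
by rewrite deriveM_scalar//; exact: differentiable_coords.
Qed.

Lemma derive_cross (V : normedModType R) (f g : V -> 'rV[R]_3) x v :
  differentiable f x -> differentiable g x ->
  'D_v (fun y => cross (f y) (g y)) x = cross ('D_v f x) (g x) + cross (f x) ('D_v g x).
Proof.
move=> df dg; have cf i := differentiable_coords i df; have cg i := differentiable_coords i dg.
have H i j k l : differentiable (fun y => f y 0 i * g y 0 j - f y 0 k * g y 0 l) x /\
    'D_v (fun y => f y 0 i * g y 0 j - f y 0 k * g y 0 l) x =
    'D_v f x 0 i * g x 0 j + f x 0 i * 'D_v g x 0 j -
    ('D_v f x 0 k * g x 0 l + f x 0 k * 'D_v g x 0 l).
  have d1 : differentiable (fun y => f y 0 i * g y 0 j) x by exact: differentiableM.
  have d2 : differentiable (fun y => f y 0 k * g y 0 l) x by exact: differentiableM.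
  split; first exact: differentiableB.
  rewrite (@deriveB _ _ _ (fun y => f y 0 i * g y 0 j) (fun y => f y 0 k * g y 0 l));
    [|exact: diff_derivable..].
  by rewrite !deriveM_scalar// !derive_coord.
have E0 : (fun y => cross (f y) (g y) 0 (inord 0)) =
  (fun y => f y 0 (inord 1) * g y 0 (inord 2) - f y 0 (inord 2) * g y 0 (inord 1)).
  by apply/funext => y; rewrite !row3E.
have E1 : (fun y => cross (f y) (g y) 0 (inord 1)) =
  (fun y => f y 0 (inord 2) * g y 0 (inord 0) - f y 0 (inord 0) * g y 0 (inord 2)).
  by apply/funext => y; rewrite !row3E.
have E2 : (fun y => cross (f y) (g y) 0 (inord 2)) =
  (fun y => f y 0 (inord 0) * g y 0 (inord 1) - f y 0 (inord 1) * g y 0 (inord 0)).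
  by apply/funext => y; rewrite !row3E.
have d : differentiable (fun y => cross (f y) (g y)) x.
  apply: differentiable_row => i; case: (ord3P i) => ->.
  - by rewrite E0; exact: (H _ _ _ _).1.
  - by rewrite E1; exact: (H _ _ _ _).1.
  - by rewrite E2; exact: (H _ _ _ _).1.
have ring4 (p q r s p' q' r' s' : R) :
  p' * s + p * s' - (q' * r + q * r') = p' * s - q' * r + (p * s' - q * r') by ring.
apply: row3P; rewrite -derive_coord//.
- by rewrite E0 (H (inord 1) (inord 2) (inord 2) (inord 1)).2 !row3E ring4.
- by rewrite E1 (H (inord 2) (inord 0) (inord 0) (inord 2)).2 !row3E ring4.
- by rewrite E2 (H (inord 0) (inord 1) (inord 1) (inord 0)).2 !row3E ring4.
Qed.

Lemma derive_sym_row U f x u v : open U -> Ck 2 U f -> U x ->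
  'D_v ('D_u f) x = 'D_u ('D_v f) x.
Proof.
move=> oU Cf Ux; have [df Df] := Cf.
have D w z : forall i, 'D_w ('D_z f) x 0 i = 'D_w ('D_z (fun y => f y 0 i)) x.
  move=> i; rewrite -derive_coord; last by have [d _] := Df z; exact: d.
  apply: near_eq_derive; apply: (near_open oU Ux) => y Uy.
  by rewrite derive_coord//; exact: df.
apply/rowP => i; apply: (etrans (D v u i)); apply: (etrans _ (esym (D u v i))).
exact: (@derive_sym _ U (fun y => f y 0 i) x u v oU (Ck_coord i oU Cf) Ux).
Qed.

(** Coordinate by coordinate, the form is minus an angle form, an angle form, and a difference of
    two logarithmic forms, for the pairs [(m0, m2)] and [(m1, m2)]. *)
Lemma scherk_form_closed U m x u v : open U -> Ck 2 U m -> U x ->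
  (forall x, U x -> regular (m x)) ->
  'D_u (fun y => scherk_map (m y) ('D_v m y)) x = 'D_v (fun y => scherk_map (m y) ('D_u m y)) x.
Proof.
move=> oU Cm Ux rm; have [dm Dm] := Cm.
have dw w : differentiable (fun y => scherk_map (m y) ('D_w m y)) x.
  have [d _] := Ck_scherk_map oU (CkW Cm) (Dm w) rm; exact: d.
have cm i : Ck 2 U (fun y => m y 0 i) by exact: Ck_coord.
have [r1 r2] := rm _ Ux.
have A1 := closed_quotient oU (cm (inord 0)) (cm (inord 2)) Ux r1.
have A2 := closed_quotient oU (cm (inord 1)) (cm (inord 2)) Ux r2.
pose P i w y := (m y 0 (inord 2) * 'D_w (fun y => m y 0 i) y - m y 0 i * 'D_w (fun y => m y 0
  (inord 2)) y) /
  (m y 0 i ^+ 2 + m y 0 (inord 2) ^+ 2).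
pose Q i w y := (m y 0 i * 'D_w (fun y => m y 0 i) y +
  m y 0 (inord 2) * 'D_w (fun y => m y 0 (inord 2)) y) /
  (m y 0 i ^+ 2 + m y 0 (inord 2) ^+ 2).
have cw i w y : U y -> 'D_w m y 0 i = 'D_w (fun y => m y 0 i) y.
  by move=> Uy; rewrite derive_coord//; exact: dm.
have E0 w : \forall y \near x, scherk_map (m y) ('D_w m y) 0 (inord 0) = - P (inord 0) w y.
  by apply: (near_open oU Ux) => y Uy; rewrite /scherk_map vec3E !cw.
have E1 w : \forall y \near x, scherk_map (m y) ('D_w m y) 0 (inord 1) = P (inord 1) w y.
  by apply: (near_open oU Ux) => y Uy; rewrite /scherk_map vec3E !cw.
have E2 w : \forall y \near x,
  scherk_map (m y) ('D_w m y) 0 (inord 2) = Q (inord 0) w y - Q (inord 1) w y.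
  by apply: (near_open oU Ux) => y Uy; rewrite /scherk_map vec3E !cw.
have dQ i w : m x 0 i ^+ 2 + m x 0 (inord 2) ^+ 2 != 0 -> differentiable (Q i w) x.
  move=> r0; have dc j : differentiable (fun y => m y 0 j) x by have [d _] := cm j; exact: d.
  have ddc j : differentiable ('D_w (fun y => m y 0 j)) x.
    by have [_ D] := cm j; have [d _] := D w; exact: d.
  have dn : differentiable (fun y => m y 0 i * 'D_w (fun y => m y 0 i) y +
    m y 0 (inord 2) * 'D_w (fun y => m y 0 (inord 2)) y) x.
    by apply: differentiableD; apply: differentiableM.
  have dd : differentiable (fun y => (m y 0 i ^+ 2 + m y 0 (inord 2) ^+ 2)^-1) x.
    by apply: differentiableV => //; apply: differentiableD; exact: differentiableM.
  exact: differentiableM dn dd.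
have dP i w : m x 0 i ^+ 2 + m x 0 (inord 2) ^+ 2 != 0 -> differentiable (P i w) x.
  move=> r0; have dc j : differentiable (fun y => m y 0 j) x by have [d _] := cm j; exact: d.
  have ddc j : differentiable ('D_w (fun y => m y 0 j)) x.
    by have [_ D] := cm j; have [d _] := D w; exact: d.
  have dn : differentiable (fun y => m y 0 (inord 2) * 'D_w (fun y => m y 0 i) y - m y 0 i *
    'D_w (fun y => m y 0 (inord 2)) y) x.
    by apply: differentiableB; apply: differentiableM.
  have dd : differentiable (fun y => (m y 0 i ^+ 2 + m y 0 (inord 2) ^+ 2)^-1) x.
    by apply: differentiableV => //; apply: differentiableD; exact: differentiableM.
  exact: differentiableM dn dd.
apply: row3P; apply: (etrans (esym (derive_coord u _ (dw v))));
  apply: (etrans _ (derive_coord v _ (dw u))).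
- apply: (etrans (near_eq_derive u (E0 v))); apply: (etrans _ (esym (near_eq_derive v (E0 u)))).
  have N w z : 'D_w (fun y => - P (inord 0) z y) x = - 'D_w (P (inord 0) z) x.
    by rewrite (@deriveN _ _ _ (P (inord 0) z))//; apply: diff_derivable; exact: dP.
  apply: (etrans (N u v)); apply: (etrans _ (esym (N v u))).
  exact: (congr1 -%R (A1 u v).1).
- apply: (etrans (near_eq_derive u (E1 v)));
  apply: (etrans _ (esym (near_eq_derive v (E1 u)))); exact: (A2 u v).1.
- apply: (etrans (near_eq_derive u (E2 v))); apply: (etrans _ (esym (near_eq_derive v (E2 u)))).
  have N w z : 'D_w (fun y => Q (inord 0) z y - Q (inord 1) z y) x =
      'D_w (Q (inord 0) z) x - 'D_w (Q (inord 1) z) x.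
    by rewrite (@deriveB _ _ _ (Q (inord 0) z) (Q (inord 1) z))//; apply: diff_derivable;
      exact: dQ.
  apply: (etrans (N u v)); apply: (etrans _ (esym (N v u))).
  exact: (f_equal2 (fun p q => p - q) (A1 u v).2 (A2 u v).2).
Qed.

End ScherkForms.

(** * Constancy of the coefficients [a] and [b] *)

Section RotationConstant.
Context {R : realType}.
Implicit Types (U : set 'rV[R]_2) (f m : 'rV[R]_2 -> 'rV[R]_3).

(** Since [(a, b)] moves on a circle, its gradient is tangent to it:
    [c * (a_i, b_i) = t_i * (- b, a)]. Closedness then reads [t0 *: cross n f1 = t1 *: cross n f0],
    and the independence of [f0] and [f1] kills both [t0] and [t1]. *)
Lemma rotation_gradient_zero (n f0 f1 w0 w1 : 'rV[R]_3) (a b c a0 a1 b0 b1 : R) :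
  dot n n = 1 -> dot n w0 = 0 -> dot n w1 = 0 ->
  f0 = a *: w0 + b *: cross n w0 -> f1 = a *: w1 + b *: cross n w1 ->
  a ^+ 2 + b ^+ 2 = c -> c != 0 ->
  a * a0 + b * b0 = 0 -> a * a1 + b * b1 = 0 ->
  a0 *: w1 + b0 *: cross n w1 = a1 *: w0 + b1 *: cross n w0 ->
  cross f0 f1 <> 0 -> [/\ a0 = 0, b0 = 0, a1 = 0 & b1 = 0].
Proof.
move=> nn nw0 nw1 f0E f1E abc c0 g0 g1 H /eqP f01.
have aE (p q : R) : a * p + b * q = 0 -> c * p = - b * (a * q - b * p).
  move=> h; have -> : c * p = a * (a * p + b * q) - b * (a * q - b * p) by rewrite -abc; ring.
  by rewrite h; ring.
have bE (p q : R) : a * p + b * q = 0 -> c * q = a * (a * q - b * p).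
  move=> h; have -> : c * q = b * (a * p + b * q) + a * (a * q - b * p) by rewrite -abc; ring.
  by rewrite h; ring.
set t0 := a * b0 - b * a0; set t1 := a * b1 - b * a1.
have J (w f : 'rV[R]_3) : dot n w = 0 -> f = a *: w + b *: cross n w ->
    cross n f = - b *: w + a *: cross n w.
  move=> nw ->; rewrite crossDr !crossZr double_cross// scalerN scaleNr addrC.
  by [].
have nf (w f : 'rV[R]_3) : dot n w = 0 -> f = a *: w + b *: cross n w -> dot n f = 0.
  move=> nw ->; rewrite dotC dotDl !dotZl (dotC w) nw (dotC _ n) dot_cross_l; ring.
have tJ : t0 *: cross n f1 = t1 *: cross n f0.
  rewrite (J w1 f1)// (J w0 f0)// !scalerDr !scalerA.
  rewrite !(mulrC t0) !(mulrC t1) -(aE _ _ g0) -(bE _ _ g0) -(aE _ _ g1) -(bE _ _ g1).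
  by rewrite -!scalerA -!scalerDr H.
have tf : t0 *: f1 = t1 *: f0.
  have := congr1 (cross n) tJ;
    rewrite !crossZr !double_cross ?(nf w0 f0)// ?(nf w1 f1)// !scalerN.
  exact: oppr_inj.
have t00 : t0 = 0.
  have : t0 *: cross f0 f1 = 0.
    rewrite -crossZr tf crossZr.
    by apply: row3P; rewrite !row3E; ring.
  by move=> /eqP; rewrite scaler_eq0 (negPf f01) orbF => /eqP.
have t10 : t1 = 0.
  have : t1 *: cross f0 f1 = 0.
    have -> : t1 *: cross f0 f1 = - cross f1 (t1 *: f0).
      by apply: row3P; rewrite !row3E; ring.
    rewrite -tf t00 scale0r; by apply: row3P; rewrite !row3E; ring.
  by move=> /eqP; rewrite scaler_eq0 (negPf f01) orbF => /eqP.
split; apply: (mulfI c0); rewrite mulr0.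
- by rewrite (aE _ _ g0) -/t0 t00 mulr0.
- by rewrite (bE _ _ g0) -/t0 t00 mulr0.
- by rewrite (aE _ _ g1) -/t1 t10 mulr0.
- by rewrite (bE _ _ g1) -/t1 t10 mulr0.
Qed.

Lemma deriveD_fun (V W : normedModType R) (f g : V -> W) x v :
  differentiable f x -> differentiable g x ->
  'D_v (fun y => f y + g y) x = 'D_v f x + 'D_v g x.
Proof.
by move=> df dg; apply: (@deriveD _ _ _ f g); exact: diff_derivable.
Qed.

Definition scherk_related (a b : R) f m x := forall v,
  'D_v f x = a *: scherk_map (m x) ('D_v m x) + b *: cross (m x) (scherk_map (m x) ('D_v m x)).

Lemma scherk_related_partials (a b : R) f m x : differentiable f x -> differentiable m x ->
  (forall i : 'I_2, pd i f x = a *: scherk_map (m x) (pd i m x) +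
    b *: cross (m x) (scherk_map (m x) (pd i m x))) ->
  scherk_related a b f m x.
Proof.
move=> df dm H v; apply: (etrans (derive_partials v df)).
have := derive_partials v dm; move: ('D_v m x) => w ->.
have := H 0; have := H 1; rewrite /pd.
move: (derive f x _) (derive f x _) (derive m x _) (derive m x _) => f1 f0 m1 m0 -> ->.
rewrite scherk_mapD !scherk_mapZ crossDr !crossZr.
by apply: row3P; rewrite !(mxDE, mxZE); ring.
Qed.

Lemma scherk_rotation_constant U f m (a b : 'rV[R]_2 -> R) c : open U ->
  Ck 2 U f -> Ck 2 U m -> Ck 1 U a -> Ck 1 U b ->
  (forall x, U x -> dot (m x) (m x) = 1) -> (forall x, U x -> regular (m x)) ->
  (forall x, U x -> cross (pd 0 f x) (pd 1 f x) <> 0) ->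
  (forall x, U x -> scherk_related (a x) (b x) f m x) ->
  (forall x, U x -> a x ^+ 2 + b x ^+ 2 = c) -> c != 0 ->
  forall x v, U x -> 'D_v a x = 0 /\ 'D_v b x = 0.
Proof.
move=> oU Cf Cm [da _] [db _] m1 rm fc rel abc c0 x v Ux.
have [dm Dm] := Cm; have [df Df] := Cf.
pose w (i : 'I_2) y := scherk_map (m y) (pd i m y).
have dw i : differentiable (w i) x.
  by have [d _] := Ck_scherk_map oU (CkW Cm) (Dm (delta_mx 0 i)) rm; exact: d.
have dmx := dm _ Ux; have dax := da _ Ux; have dbx := db _ Ux.
have tm y u : U y -> dot (m y) ('D_u m y) = 0.
  by move=> Uy; apply: derive_dot_unit; [apply: (near_open oU Uy)|exact: dm].
have tw i : dot (m x) (w i x) = 0.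
  by apply: scherk_map_tangent; [exact: m1|exact: tm|exact: rm].
have dcw i : differentiable (fun y => cross (m y) (w i y)) x.
  have [d _] := Ck_cross oU (CkW Cm) (Ck_scherk_map oU (CkW Cm) (Dm (delta_mx 0 i)) rm).
  exact: d.
have D2 i (j : 'I_2) : pd j (pd i f) x = ('D_(delta_mx 0 j) a x *: w i x +
  'D_(delta_mx 0 j) b x *: cross (m x) (w i x)) +
    (a x *: pd j (w i) x + b x *: (cross (pd j m x) (w i x) + cross (m x) (pd j (w i) x))).
  have N : \forall y \near x, pd i f y = a y *: w i y + b y *: cross (m y) (w i y).
    by apply: (near_open oU Ux) => y Uy; exact: rel.
  apply: (etrans (near_eq_derive _ N)).
  have d1 : differentiable (fun y => a y *: w i y) x.
    apply: differentiable_row => k.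
    have -> : (fun y => (a y *: w i y) 0 k) = (fun y => a y * w i y 0 k).
      by apply/funext => y; rewrite mxE.
    by apply: differentiableM => //; exact: differentiable_coords.
  have d2 : differentiable (fun y => b y *: cross (m y) (w i y)) x.
    apply: differentiable_row => k.
    have -> : (fun y => (b y *: cross (m y) (w i y)) 0 k) = (fun y => b y * cross (m y) (w i y)
      0 k).
      by apply/funext => y; rewrite mxE.
    by apply: differentiableM => //; exact: differentiable_coords.
  apply: (etrans (deriveD_fun (delta_mx 0 j) d1 d2)).
  apply: (etrans (f_equal2 +%R (derive_scale _ dax (dw i)) (derive_scale _ dbx (dcw i)))).
  apply: (etrans (congr1 (fun z => _ + (_ + b x *: z)) (derive_cross _ dmx (dw i)))).
  by rewrite /pd addrACA.
have Sf : pd (1 : 'I_2) (pd 0 f) x = pd (0 : 'I_2) (pd 1 f) x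
  by exact: (derive_sym_row _ _ oU Cf Ux).
have Sw : pd 0 (w 1) x = pd 1 (w 0) x by exact: (scherk_form_closed _ _ oU Cm Ux rm).
have Cw : cross (pd 0 m x) (w 1 x) = cross (pd 1 m x) (w 0 x).
  by apply: cross_scherk_map; [exact: m1|exact: tm|exact: tm|exact: rm].
(* The mixed second derivatives of [f] agree. By [Sw] and [Cw] all terms in which [a] and [b] are
   not differentiated cancel, so only their gradients remain. *)
have E : 'D_(delta_mx 0 0) a x *: w 1 x + 'D_(delta_mx 0 0) b x *: cross (m x) (w 1 x) =
    'D_(delta_mx 0 1) a x *: w 0 x + 'D_(delta_mx 0 1) b x *: cross (m x) (w 0 x).
  have H := etrans (esym (D2 1 0)) (etrans (esym Sf) (D2 0 1)).
  have K := f_equal2 (fun p q => a x *: p + b x *: (q + cross (m x) p)) Sw Cw.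
  exact: (addIr _ (etrans H (congr1 (fun z => _ + z) (esym K)))).
have gr (i : 'I_2) : a x * 'D_(delta_mx 0 i) a x + b x * 'D_(delta_mx 0 i) b x = 0.
  have N : \forall y \near x, a y * a y + b y * b y = c.
    by apply: (near_open oU Ux) => y Uy; rewrite -!expr2 abc.
  have : 'D_(delta_mx 0 i) (fun y => a y * a y + b y * b y) x = 0.
    by apply: (etrans (near_eq_derive _ N)); exact: derive_cst.
  have da2 : differentiable (fun y => a y * a y) x by exact: differentiableM.
  have db2 : differentiable (fun y => b y * b y) x by exact: differentiableM.
  have -> := deriveD_fun (delta_mx 0 i) da2 db2.
  have -> := deriveM_scalar (delta_mx 0 i) dax dax.
  have -> := deriveM_scalar (delta_mx 0 i) dbx dbx.
  rewrite /pd; move: ('D_(delta_mx 0 i) a x) ('D_(delta_mx 0 i) b x) => p q h.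
  have : (a x * p + b x * q) *+ 2 = 0 by rewrite -h; ring.
  by move=> /eqP; rewrite mulrn_eq0 /= => /eqP.
have [A0 B0 A1 B1] := rotation_gradient_zero (m1 _ Ux) (tw 0) (tw 1) (rel _ Ux _) (rel _ Ux _)
  (abc _ Ux) c0 (gr 0) (gr 1) E (fc _ Ux).
have Z g : differentiable g x -> 'D_(delta_mx 0 0) g x = 0 -> 'D_(delta_mx 0 1) g x = 0 ->
    'D_v g x = 0 :> R.
  by move=> dg g0 g1; apply: (etrans (derive_partials v dg)); rewrite g0 g1 !scaler0 addr0.
by split; [exact: Z dax A0 A1|exact: Z dbx B0 B1].
Qed.

End RotationConstant.

(** * Minimal surfaces with constant [a^2 + b^2] *)

Section MinimalChart.
Context {R : realType}.
Implicit Types (U : set 'rV[R]_2) (f m : 'rV[R]_2 -> 'rV[R]_3) (V : 'rV[R]_3).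

(** [V3] is left free so that both orientations [s *: cross V1 V2], with [s] a sign, are covered. *)
Definition frame_coords V1 V2 V3 (u : 'rV[R]_3) : 'rV[R]_3 :=
  vec3 (dot u V1) (dot u V2) (dot u V3).

Lemma dot_frame_coords V1 V2 (s : R) u v : dot V1 V1 = 1 -> dot V2 V2 = 1 -> dot V1 V2 = 0 ->
  s ^+ 2 = 1 ->
  let T := frame_coords V1 V2 (s *: cross V1 V2) in dot (T u) (T v) = dot u v.
Proof.
move=> h1 h2 h12 s1 T.
have E w : w = dot w V1 *: V1 + dot w V2 *: V2 + dot w (cross V1 V2) *: cross V1 V2.
  have := cross_basis V1 V2 w; rewrite h1 h2 h12 !mul1r !mul0r !subr0 expr0n subr0 scale1r.
  by [].
rewrite [in RHS](E u) !dotDl !dotZl !(dotC _ v) /T /frame_coords dotE !vec3E !dotZr.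
have -> : s * dot u (cross V1 V2) * (s * dot v (cross V1 V2)) =
  s ^+ 2 * (dot u (cross V1 V2) * dot v (cross V1 V2)) by ring.
by rewrite s1 mul1r.
Qed.

Lemma derive_frame_coords (W0 : normedModType R) V1 V2 V3 (f : W0 -> 'rV[R]_3) x v :
  differentiable f x ->
  differentiable (fun y => frame_coords V1 V2 V3 (f y)) x /\
  'D_v (fun y => frame_coords V1 V2 V3 (f y)) x = frame_coords V1 V2 V3 ('D_v f x).
Proof.
move=> df.
have dd W : differentiable (fun y => dot (f y) W) x.
  by apply: differentiable_dot => //; exact: differentiable_cst.
have E i : (fun y => frame_coords V1 V2 V3 (f y) 0 i) = (fun y => dot (f y) V1) \/
    (fun y => frame_coords V1 V2 V3 (f y) 0 i) = (fun y => dot (f y) V2) \/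
    (fun y => frame_coords V1 V2 V3 (f y) 0 i) = (fun y => dot (f y) V3).
  by case: (ord3P i) => ->; [left|right; left|right; right]; apply/funext => y; rewrite vec3E.
have dT : differentiable (fun y => frame_coords V1 V2 V3 (f y)) x.
  by apply: differentiable_row => i; case: (E i) => [|[]] ->; exact: dd.
split=> //; apply: row3P; apply: (etrans (esym (derive_coord v _ dT))); rewrite vec3E.
- by rewrite -(derive_dotl V1 v df); congr (derive _ x v); apply/funext => y; rewrite vec3E.
- by rewrite -(derive_dotl V2 v df); congr (derive _ x v); apply/funext => y; rewrite vec3E.
- by rewrite -(derive_dotl V3 v df); congr (derive _ x v); apply/funext => y; rewrite vec3E.
Qed.

Lemma Ck_frame_coords k U V1 V2 V3 f : open U -> Ck k U f ->
  Ck k U (fun y => frame_coords V1 V2 V3 (f y)).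
Proof.
by move=> oU Cf; apply: (Ck_vec3 oU); exact: (Ck_dot oU Cf (Ck_vcst k _ oU)).
Qed.

(** Obtained by differentiating the orthogonality of [pd j f] and the normal. *)
Lemma snd_form_shape U f x (i j : 'I_2) : open U -> smooth U f ->
  (forall x, U x -> cross (pd 0 f x) (pd 1 f x) <> 0) -> U x ->
  snd_form i j f x = - dot (pd j f x) (pd i (unit_normal f) x).
Proof.
move=> oU sf fc Ux.
have [_ Cn] := sf 3; have [dj _] := Cn (delta_mx 0 j).
have [dn _] := Ck_unit_normal oU (sf 2) fc.
have dj' : differentiable (pd j f) x by exact: dj.
have dn' : differentiable (unit_normal f) x by exact: dn.
have N : \forall y \near x, dot (pd j f y) (unit_normal f y) = 0.
  by apply: (near_open oU Ux) => y Uy; rewrite dotC unit_normal_orthogonal.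
have H : 'D_(delta_mx 0 i) (fun y => dot (pd j f y) (unit_normal f y)) x = 0.
  by apply: (etrans (near_eq_derive _ N)); exact: derive_cst.
have := etrans (esym (@derive_val _ _ _ _ _ _ _ (is_derive_dot (delta_mx 0 i) dj' dn'))) H.
by move=> /eqP; rewrite addr_eq0 => /eqP.
Qed.

Record minimal_chart U f := MinimalChart {
  mc_open : open U;
  mc_smooth : smooth U f;
  mc_immersed : forall x, U x -> cross (pd 0 f x) (pd 1 f x) <> 0;
  mc_minimal : forall x, U x -> mean_curv f x = 0;
  mc_curved : forall x, U x -> gauss_curv f x < 0 }.

(** Rewrites the curvature conditions in terms of first derivatives of the surface and of its
    normal, as [minimal_gauss_frame] expects. The coefficients of the second form all change sign,
    which affects neither their product terms nor the vanishing of the mean curvature. *)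
Lemma minimal_chart_facts U f x : minimal_chart U f -> U x ->
  let n := unit_normal f in
  [/\ dot (n x) (n x) = 1, forall i : 'I_2, dot (n x) (pd i f x) = 0 /\ dot (n x) (pd i n x) = 0,
      dot (pd 0 f x) (pd 1 n x) = dot (pd 1 f x) (pd 0 n x),
      dot (pd 0 f x) (pd 0 f x) * dot (pd 1 f x) (pd 1 n x) -
        2 * dot (pd 0 f x) (pd 1 f x) * dot (pd 0 f x) (pd 1 n x) +
        dot (pd 1 f x) (pd 1 f x) * dot (pd 0 f x) (pd 0 n x) = 0 &
      - gauss_curv f x = - ((dot (pd 0 f x) (pd 0 n x) * dot (pd 1 f x) (pd 1 n x) -
          dot (pd 0 f x) (pd 1 n x) ^+ 2) /
        (dot (pd 0 f x) (pd 0 f x) * dot (pd 1 f x) (pd 1 f x) - dot (pd 0 f x) (pd 1 f x) ^+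
          2))].
Proof.
move=> [oU sf fc H0 K0] Ux n.
have S i j := @snd_form_shape U f x i j oU sf fc Ux.
have sym : dot (pd 0 f x) (pd 1 n x) = dot (pd 1 f x) (pd 0 n x).
  apply: oppr_inj; apply: (etrans (esym (S 1 0))); apply: (etrans _ (S 0 1)).
  exact: (congr1 (fun w => dot w (n x)) (derive_sym_row _ _ oU (sf 2) Ux)).
have n1 y : U y -> dot (n y) (n y) = 1 := fun Uy => unit_normal_unit (fc y Uy).
pose E := dot (pd 0 f x) (pd 0 f x); pose F := dot (pd 0 f x) (pd 1 f x).
pose G := dot (pd 1 f x) (pd 1 f x).
have D0 : E * G - F ^+ 2 != 0 by rewrite -lagrange dot_eq0; exact/eqP/fc.
have S01 := etrans (S 0 1) (congr1 -%R (esym sym)).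
have A (E' F' G' a b c : R) : E' * G' - F' ^+ 2 != 0 ->
    (E' * (- c) - 2 * F' * (- b) + G' * (- a)) / (2 * (E' * G' - F' ^+ 2)) = 0 ->
    E' * c - 2 * F' * b + G' * a = 0.
  move=> d0 /eqP; rewrite mulf_eq0 invr_eq0 mulf_eq0 pnatr_eq0 /= (negPf d0) orbF => /eqP h.
  by rewrite -oppr0 -h; ring.
have B (a b c d : R) : - (((- a) * (- c) - (- b) ^+ 2) / d) = - ((a * c - b ^+ 2) / d).
  by congr (- (_ / _)); ring.
split.
- exact: n1.
- move=> i; split; first exact: unit_normal_orthogonal.
  apply: derive_dot_unit; first exact: (near_open oU Ux).
  by have [dn _] := Ck_unit_normal oU (sf 2) fc; exact: dn.
- exact: sym.
- exact: (A _ _ _ _ _ _ D0 (etrans (esym (f_equal3 (fun e h g =>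
    (E * g - 2 * F * h + G * e) / (2 * (E * G - F ^+ 2))) (S 0 0) S01 (S 1 1))) (H0 x Ux))).
- apply: (etrans (f_equal3 (fun e h g => - ((e * g - h ^+ 2) / (E * G - F ^+ 2))) (S 0 0) S01
  (S 1 1))).
  exact: B.
Qed.

Lemma continuous_gauss_curv U f : open U -> smooth U f ->
  (forall x, U x -> cross (pd 0 f x) (pd 1 f x) <> 0) -> Ck 0 U (gauss_curv f).
Proof.
move=> oU sf fc.
have C1 i : Ck 0 U (pd i f) by have [_ D] := sf 1; exact: D.
have C2 i j : Ck 0 U (pd i (pd j f)).
  by have [_ D] := sf 2; have [_ D2] := D (delta_mx 0 j); exact: D2.
have Cn := Ck_unit_normal oU (sf 1) fc.
have Cs i j : Ck 0 U (snd_form i j f) by exact: (Ck_dot oU (C2 i j) Cn).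
have Cf i j : Ck 0 U (fst_form i j f) by exact: (Ck_dot oU (C1 i) (C1 j)).
apply: (CkM oU); first by apply: (CkB oU); [exact: (CkM oU)|exact: (CkM oU)].
apply: (CkV oU); last by apply: (CkB oU); [exact: (CkM oU)|exact: (CkM oU)].
move=> x Ux; rewrite /fst_form -lagrange dot_eq0; exact/eqP/fc.
Qed.

End MinimalChart.

Section ChartScherk.
Context {R : realType}.
Implicit Types (U : set 'rV[R]_2) (f m : 'rV[R]_2 -> 'rV[R]_3).

(* Extends identities across the isolated points where the Gauss map meets a pole. *)
Lemma punctured_eq0 (V : normedModType R) (f : 'rV[R]_2 -> V) x0 r : 0 < r ->
  {for x0, continuous f} -> (forall x, ball x0 r x -> x != x0 -> f x = 0) -> f x0 = 0.
Proof.
move=> r0 /continuous_normP cf f0; apply/eqP; rewrite -normr_eq0 eq_le normr_ge0 andbT.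
apply/ler_addgt0Pl => e e0; rewrite addr0.
have [s /= s0 Hs] := (nbhs_ballP _ _).1 (cf e e0).
pose t := Num.min r s / 2.
have t0 : 0 < t by rewrite divr_gt0// lt_min r0.
have tm : t < Num.min r s by rewrite ltr_pdivrMr// ltr_pMr ?ltr1n// lt_min r0.
pose x := x0 + t *: (delta_mx 0 0 : 'rV[R]_2).
have nx : `|x0 - x| <= t.
  apply: norm_le_coord => [|i]; first exact: ltW.
  rewrite !mxE opprD addrA subrr sub0r normrN eqxx /= normrM (ger0_norm (ltW t0)).
  by case: (_ == _); rewrite ?normr1 ?normr0 ?mulr1 ?mulr0// ltW.
have xr : ball x0 r x.
  by rewrite -ball_normE/=; apply: le_lt_trans nx _; apply: lt_le_trans tm _; rewrite ge_min lexx.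
have xs : ball x0 s x.
  by rewrite -ball_normE/=; apply: le_lt_trans nx _; apply: lt_le_trans tm _;
    rewrite ge_min lexx orbT.
have xx : x != x0.
  rewrite -subr_eq0 /x addrC addKr scaler_eq0 negb_or gt_eqF//=.
  by apply/eqP => /rowP /(_ 0); rewrite !mxE !eqxx => /eqP; rewrite oner_eq0.
by have := Hs _ xs; rewrite (f0 _ xr xx) subr0.
Qed.

Lemma unit_coords (u : 'rV[R]_3) : dot u u = 1 ->
  (1 - u 0 (inord 0) ^+ 2) * (1 - u 0 (inord 1) ^+ 2) = 0 ->
  exists s : R, s ^+ 2 = 1 /\ (u = vec3 s 0 0 \/ u = vec3 0 s 0).
Proof.
rewrite dotE -!expr2 => uu /eqP; rewrite mulf_eq0 !subr_eq0 => /orP[/eqP h|/eqP h].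
  exists (u 0 (inord 0)); split=> //; left.
  have /eqP : u 0 (inord 1) ^+ 2 + u 0 (inord 2) ^+ 2 = 0.
    by apply: (addrI (u 0 (inord 0) ^+ 2)); rewrite addrA uu addr0.
  rewrite paddr_eq0 ?sqr_ge0// !expf_eq0/= => /andP[/eqP a /eqP b].
  by rewrite [LHS]vec3_eta a b.
exists (u 0 (inord 1)); split=> //; right.
have /eqP : u 0 (inord 0) ^+ 2 + u 0 (inord 2) ^+ 2 = 0.
  by apply: (addrI (u 0 (inord 1) ^+ 2)); rewrite addrCA addrA uu addr0.
rewrite paddr_eq0 ?sqr_ge0// !expf_eq0/= => /andP[/eqP a /eqP b].
by rewrite [LHS]vec3_eta a b.
Qed.

Lemma sign_close (s t : R) : s ^+ 2 = 1 -> t ^+ 2 = 1 -> `|s - t| < 1 -> s = t.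
Proof.
move=> /eqP; rewrite sqrf_eq1 => + /eqP; rewrite sqrf_eq1 => /orP[]/eqP-> /orP[]/eqP->//;
  rewrite ltr_norml => /andP[] *; lra.
Qed.

(** The four poles [+- e0], [+- e1] lie at mutual sup distance at least [1]. *)
Lemma poles_close (u v : 'rV[R]_3) : dot u u = 1 -> dot v v = 1 ->
  (1 - u 0 (inord 0) ^+ 2) * (1 - u 0 (inord 1) ^+ 2) = 0 ->
  (1 - v 0 (inord 0) ^+ 2) * (1 - v 0 (inord 1) ^+ 2) = 0 ->
  `|u - v| < 1 -> u = v.
Proof.
move=> uu vv hu hv uv.
have c i : `|u 0 i - v 0 i| < 1.
  by have := coord_le_norm (u - v) i; rewrite !mxE => /le_lt_trans; apply.
have big (s : R) : s ^+ 2 = 1 -> `|s| < 1 -> False.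
  by move=> /eqP; rewrite sqrf_eq1 => /orP[]/eqP->; rewrite ?normrN normr1 ltxx.
have [s [s1 [us|us]]] := unit_coords uu hu; have [t [t1 [vt|vt]]] := unit_coords vv hv.
- by move: (c (inord 0)); rewrite us vt !vec3E => /(sign_close s1 t1) ->.
- by move: (c (inord 0)); rewrite us vt !vec3E subr0 => /(big _ s1).
- by move: (c (inord 1)); rewrite us vt !vec3E subr0 => /(big _ s1).
- by move: (c (inord 1)); rewrite us vt !vec3E => /(sign_close s1 t1) ->.
Qed.

Section WithFrame.
Context (V1 V2 V3 : 'rV[R]_3).
Local Notation T := (frame_coords V1 V2 V3).
Hypothesis dotT : forall u v, dot (T u) (T v) = dot u v.
Context (U : set 'rV[R]_2) (f : 'rV[R]_2 -> 'rV[R]_3) (fU : minimal_chart U f).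
Let n := unit_normal f.
Let m y := T (n y).
Let F y := T (f y).
Let D y := (1 - m y 0 (inord 0) ^+ 2) * (1 - m y 0 (inord 1) ^+ 2).

Lemma Ck_chart_normal k : Ck k U m.
Proof.
have [oU sf fc _ _] := fU; apply: (Ck_frame_coords _ _ _ oU).
exact: (Ck_unit_normal oU (sf k.+1) fc).
Qed.

Lemma Ck_chart_coords k : Ck k U F.
Proof. by have [oU sf _ _ _] := fU; apply: (Ck_frame_coords _ _ _ oU); exact: sf. Qed.

Lemma chart_normal_unit x : U x -> dot (m x) (m x) = 1.
Proof.
move=> Ux; have [n1 _ _ _ _] := minimal_chart_facts fU Ux.
by rewrite /m dotT.
Qed.

Lemma pd_chart_normal x (i : 'I_2) : U x -> pd i m x = T (pd i n x).
Proof.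
have [oU sf fc _ _] := fU => Ux; have [dn _] := Ck_unit_normal oU (sf 2) fc.
exact: (derive_frame_coords V1 V2 V3 (delta_mx 0 i) (dn x Ux)).2.
Qed.

Lemma pd_chart_coords x (i : 'I_2) : U x -> pd i F x = T (pd i f x).
Proof.
have [_ sf _ _ _] := fU => Ux; have [df _] := sf 2.
exact: (derive_frame_coords V1 V2 V3 (delta_mx 0 i) (df x Ux)).2.
Qed.

(** [T] may reverse orientation, hence need not commute with [cross]; Gram determinants are
    preserved in any case. *)
Lemma cross_frame_coords u v : cross u v != 0 -> cross (T u) (T v) != 0.
Proof. by rewrite -!dot_eq0 !lagrange !dotT. Qed.

Lemma framed_rotation (N X0 X1 n0 n1 mx p0 p1 q0 q1 : 'rV[R]_3) k :
  mx = T N -> p0 = T X0 -> p1 = T X1 -> q0 = T n0 -> q1 = T n1 ->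
  dot N N = 1 -> dot N X0 = 0 -> dot N X1 = 0 -> dot N n0 = 0 -> dot N n1 = 0 ->
  regular mx -> cross p0 p1 != 0 -> dot X0 n1 = dot X1 n0 ->
  dot X0 X0 * dot X1 n1 - 2 * dot X0 X1 * dot X0 n1 + dot X1 X1 * dot X0 n0 = 0 ->
  k = - ((dot X0 n0 * dot X1 n1 - dot X0 n1 ^+ 2) / (dot X0 X0 * dot X1 X1 - dot X0 X1 ^+ 2)) ->
  0 < k ->
  exists a b,
    [/\ p0 = a *: scherk_map mx q0 + b *: cross mx (scherk_map mx q0),
        p1 = a *: scherk_map mx q1 + b *: cross mx (scherk_map mx q1),
        dot q0 q0 = k * dot p0 p0,
        a = dot p0 (scherk_map mx q0) / dot (scherk_map mx q0) (scherk_map mx q0) /\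
        b = dot p0 (cross mx (scherk_map mx q0)) / dot (scherk_map mx q0) (scherk_map mx q0) &
        (a ^+ 2 + b ^+ 2) * k = (1 - mx 0 (inord 0) ^+ 2) * (1 - mx 0 (inord 1) ^+ 2)].
Proof.
move=> E1 E2 E3 E4 E5 h1 h2 h3 h4 h5 r c h6 h7 h8 k0.
have d u v p q : p = T u -> q = T v -> dot p q = dot u v by move=> -> ->; exact: dotT.
apply: (minimal_scherk_rotation _ _ _ _ _ r c _ _ _ k0).
- by rewrite (d _ _ _ _ E1 E1).
- by rewrite (d _ _ _ _ E1 E2).
- by rewrite (d _ _ _ _ E1 E3).
- by rewrite (d _ _ _ _ E1 E4).
- by rewrite (d _ _ _ _ E1 E5).
- by rewrite (d _ _ _ _ E2 E5) (d _ _ _ _ E3 E4).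
- by rewrite (d _ _ _ _ E2 E2) (d _ _ _ _ E2 E3) (d _ _ _ _ E3 E3) (d _ _ _ _ E3 E5) (d _ _ _ _
  E2 E5) (d _ _ _ _ E2 E4).
- by rewrite (d _ _ _ _ E2 E2) (d _ _ _ _ E2 E3) (d _ _ _ _ E3 E3) (d _ _ _ _ E3 E5) (d _ _ _ _
  E2 E5) (d _ _ _ _ E2 E4).
Qed.

Lemma chart_coords_immersed x : U x -> cross (pd 0 F x) (pd 1 F x) != 0.
Proof.
have [_ _ fc _ _] := fU => Ux; have E0 := pd_chart_coords 0 Ux; have E1 := pd_chart_coords 1 Ux.
have h : cross (T (pd 0 f x)) (T (pd 1 f x)) != 0 by apply: cross_frame_coords; exact/eqP/fc.
by rewrite (f_equal2 (@cross R) E0 E1).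
Qed.

Lemma chart_normal_immersed x : U x -> cross (pd 0 m x) (pd 1 m x) != 0.
Proof.
move=> Ux; have [n1 t sy H kE] := minimal_chart_facts fU Ux.
have [oU sf fc _ K0] := fU.
have c0 : cross (pd 0 f x) (pd 1 f x) != 0 by exact/eqP/fc.
have [_ _ _ E] := minimal_gauss_frame n1 (t 0).1 (t 1).1 (t 0).2 (t 1).2 c0 sy H kE.
have E0 := pd_chart_normal 0 Ux; have E1 := pd_chart_normal 1 Ux.
have h : cross (T (pd 0 n x)) (T (pd 1 n x)) != 0.
  apply: cross_frame_coords; rewrite E scaler_eq0 negb_or c0 andbT opprK.
  exact: (negbT (lt_eqF (K0 x Ux))).
by rewrite (f_equal2 (@cross R) E0 E1).
Qed.

(** Where [D] vanishes the assumption on [ln] says nothing. But [m] is an immersion, hence locally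
    injective, and nearby zeros of [D] share the same pole, so zeros of [D] are isolated. Around
    such a zero [D = expR k * - K] holds, and by continuity it holds at the zero too, against
    [K < 0]. *)
Lemma chart_regular k :
  (forall x, U x -> 0 < D x / - gauss_curv f x -> ln (D x / - gauss_curv f x) = k) ->
  forall x, U x -> regular (m x) /\ D x = expR k * - gauss_curv f x.
Proof.
move=> hk.
have [oU sf fc _ K0] := fU.
have kpos x : U x -> 0 < - gauss_curv f x by move=> Ux; rewrite oppr_gt0 K0.
have D_ge0 x : U x -> 0 <= D x.
  move=> Ux; have := chart_normal_unit Ux; rewrite dotE -!expr2 => mm.
  rewrite /D mulr_ge0// subr_ge0 -mm.
    by rewrite -addrA lerDl addr_ge0// sqr_ge0.
  by rewrite -addrA addrCA lerDl addr_ge0// sqr_ge0.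
have DE x : U x -> D x != 0 -> D x = expR k * - gauss_curv f x.
  move=> Ux D0; have w0 : 0 < D x / - gauss_curv f x.
    by rewrite divr_gt0// ?kpos// lt_def D0 D_ge0.
  by rewrite -(hk _ Ux w0) lnK ?posrE// divfK// gt_eqF// kpos.
suff Dn x : U x -> D x != 0.
  move=> x Ux; split; last exact: DE (Dn _ Ux).
  by apply/(regularP (chart_normal_unit Ux)); rewrite mulrC Dn.
move=> Ux; apply/eqP => Dx.
have [C [r [C0 r0 rU lip]]] :=
  immersion_lipschitz oU (Ck_chart_normal 1) Ux (chart_normal_immersed Ux).
have cm : {for x, continuous m} by apply: (Ck_chart_normal 0); rewrite inE.
have h2 : (0 : R) < 1 / 2 by [].
have [s /= s0 Hs] := (nbhs_ballP _ _).1 ((continuous_normP _ _).1 cm (1 / 2) h2).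
pose t := Num.min r s.
have t0 : 0 < t by rewrite lt_min r0.
have tr y : ball x t y -> ball x r y by apply: le_ball; rewrite ge_min lexx.
have ts y : ball x t y -> ball x s y by apply: le_ball; rewrite ge_min lexx orbT.
pose g y := D y - expR k * - gauss_curv f y.
have cg : {for x, continuous g}.
  have cD : Ck 0 U D.
    have c i := Ck_coord i oU (Ck_chart_normal 0).
    by apply: (CkM oU); apply: (CkB oU);
      [exact: Ck_cst|exact: (CkM oU)|exact: Ck_cst|exact: (CkM oU)].
  have cK : Ck 0 U (fun y => expR k * - gauss_curv f y).
    by apply: (CkM oU); [exact: Ck_cst|apply: (CkN oU); exact: continuous_gauss_curv].
  by apply: (CkB oU cD cK); rewrite inE.
(* On the punctured ball [D] cannot vanish: [y] would have the same normal as [x], against the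
   Lipschitz bound. *)
have : g x = 0.
  apply: (punctured_eq0 t0 cg) => y yt yx; have Uy : U y by exact/rU/tr.
  apply/eqP; rewrite subr_eq0; apply/eqP/DE => //.
  apply: contraNneq yx => Dy.
  have mxy : m x = m y.
    apply: (poles_close (chart_normal_unit Ux) (chart_normal_unit Uy) Dx Dy).
    by apply: le_lt_trans (Hs _ (ts _ yt)) _; rewrite ltr_pdivrMr// mul1r ltr1n.
  have := lip x y (ballxx _ r0) (tr _ yt).
  by rewrite mxy subrr normr0 mulr0 normr_le0 subr_eq0 eq_sym.
rewrite /g Dx sub0r => /eqP; rewrite oppr_eq0 mulf_eq0 => /orP[|] /eqP h.
  by have := expR_gt0 k; rewrite h ltxx.
by have := kpos _ Ux; rewrite h ltxx.
Qed.

(** The coefficients are defined by orthogonal projection on [L] and [m x L], which makes them of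
    class C^1. Constancy is claimed on balls only, because the domain of a chart need not be
    connected. *)
Lemma chart_rotation c : 0 < c ->
  (forall x, U x -> regular (m x) /\ D x = c * - gauss_curv f x) ->
  exists a b : 'rV[R]_2 -> R,
    (forall x, U x -> scherk_related (a x) (b x) F m x /\ a x ^+ 2 + b x ^+ 2 = c) /\
    (forall x r, ball x r `<=` U -> forall y, ball x r y -> 0 < r -> a y = a x /\ b y = b x).
Proof.
move=> c0 reg; have [oU sf fc _ K0] := fU.
have rm x : U x -> regular (m x) by move=> /reg[].
have [dF _] := Ck_chart_coords 2; have [dm _] := Ck_chart_normal 2.
have DF v : Ck 1 U ('D_v F) by have [_ D2] := Ck_chart_coords 2; exact: D2.
have Dm v : Ck 1 U ('D_v m) by have [_ D2] := Ck_chart_normal 2; exact: D2.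
pose L y := scherk_map (m y) (pd 0 m y).
pose a y := dot (pd 0 F y) (L y) / dot (L y) (L y).
pose b y := dot (pd 0 F y) (cross (m y) (L y)) / dot (L y) (L y).
have pt x : U x -> [/\ scherk_related (a x) (b x) F m x,
  a x ^+ 2 + b x ^+ 2 = c & dot (L x) (L x) != 0].
  move=> Ux; have [n1 t sy H kE] := minimal_chart_facts fU Ux.
  have X0 := pd_chart_coords 0 Ux; have X1 := pd_chart_coords 1 Ux.
  have N0 := pd_chart_normal 0 Ux; have N1 := pd_chart_normal 1 Ux.
  have k0 : 0 < - gauss_curv f x by rewrite oppr_gt0 K0.
  have [rx Dx] := reg x Ux.
  have mm := chart_normal_unit Ux; have ic := chart_coords_immersed Ux.
  have [a' [b' [E0 E1 EN [Ea Eb] Eab]]] := framed_rotation erefl X0 X1 N0 N1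
    n1 (t 0).1 (t 1).1 (t 0).2 (t 1).2 rx ic sy H kE k0.
  have aE : a' = a x := Ea.
  have bE : b' = b x := Eb.
  rewrite -aE -bE; split.
  - apply: scherk_related_partials; [exact: dF|exact: dm|move=> i].
    have [->|->] := ord2P i.
      exact: E0.
    exact: E1.
  - by apply: (mulIf (lt0r_neq0 k0)); rewrite Eab -/(D x) Dx.
  - apply/eqP => L0.
    have t0 : dot (m x) (pd 0 m x) = 0.
      exact: (etrans (congr1 (dot (m x)) N0) (etrans (dotT _ _) (t 0).2)).
    have := scherk_map_norm mm t0 rx; rewrite -/(L x) L0 mul0r => /esym/eqP.
    rewrite dot_eq0 => /eqP z; have := chart_normal_immersed Ux; rewrite z.
    by move=> /eqP; apply; apply: row3P; rewrite !row3E; ring.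
exists a, b; split; first by move=> x /pt[].
have CL : Ck 1 U L by exact: (Ck_scherk_map oU (Ck_chart_normal 1) (Dm _) rm).
have CLL : Ck 1 U (fun y => (dot (L y) (L y))^-1).
  by apply: (CkV oU) => [x /pt[]//|]; exact: Ck_dot.
have Ca : Ck 1 U a.
  exact: (@CkM _ 1 U (fun y => dot (pd 0 F y) (L y)) _ oU (Ck_dot oU (DF (delta_mx 0 0)) CL) CLL).
have Cb : Ck 1 U b.
  exact: (@CkM _ 1 U (fun y => dot (pd 0 F y) (cross (m y) (L y))) _ oU
    (Ck_dot oU (DF (delta_mx 0 0)) (Ck_cross oU (Ck_chart_normal 1) CL)) CLL).
have Z x v : U x -> 'D_v a x = 0 /\ 'D_v b x = 0.
  apply: (scherk_rotation_constant oU (Ck_chart_coords 2) (Ck_chart_normal 2) Ca Cb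
    (@chart_normal_unit) rm) (lt0r_neq0 c0) _ _.
  - by move=> y Uy; exact/eqP/chart_coords_immersed.
  - by move=> y /pt[].
  - by move=> y /pt[].
move=> x r rU y yr r0; have xr : ball x r x by exact: ballxx.
have [da _] := Ca; have [db _] := Cb.
split.
  have [z zr E] := MVT_ball (fun z zr => da z (rU z zr)) xr yr.
  by apply/eqP; rewrite -subr_eq0 E; apply/eqP; exact: (Z _ _ (rU _ zr)).1.
have [z zr E] := MVT_ball (fun z zr => db z (rU z zr)) xr yr.
by apply/eqP; rewrite -subr_eq0 E; apply/eqP; exact: (Z _ _ (rU _ zr)).2.
Qed.

End WithFrame.
End ChartScherk.

(** * Surfaces *)

Section SurfaceCharts.
Context {R : realType} {M : surface R}.
Implicit Types (c : chart R M).

Lemma par_continuous c x : atlas c -> dom c x -> {for x, continuous (par c)}.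
Proof.
move=> /atlas_chart[oc _ + _ _] dx; rewrite continuous_open_subspace// => /(_ x).
by rewrite inE; apply.
Qed.

Lemma coord_continuous_at c p : atlas c -> chart_image c p -> {for p, continuous (Defs.coord c)}.
Proof.
move=> /atlas_chart[_ oi _ + _] ip; rewrite continuous_open_subspace// => /(_ p).
by rewrite inE; apply.
Qed.

Lemma coordK c x : atlas c -> dom c x -> Defs.coord c (par c x) = x.
Proof. by move=> /atlas_chart[_ _ _ _ +] dx; apply. Qed.

Lemma parK c p : atlas c -> chart_image c p ->
  dom c (Defs.coord c p) /\ par c (Defs.coord c p) = p.
Proof. by move=> ac [x dx <-]; rewrite coordK. Qed.

Lemma open_chart_image c (A : set 'rV[R]_2) : atlas c -> open A -> A `<=` dom c ->
  open (par c @` A).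
Proof.
move=> ac oA Ad; rewrite openE => _ [x Ax <-].
have ip : chart_image c (par c x) by exists x => //; exact: Ad.
have [_ oi _ _ _] := atlas_chart ac.
have N : \forall p \near par c x, A (Defs.coord c p).
  apply: (coord_continuous_at ac ip); rewrite coordK//; last exact: Ad.
  exact: open_nbhs_nbhs.
have N' : \forall p \near par c x, chart_image c p by exact: open_nbhs_nbhs.
apply: filterS2 N N' => p Ap ip'; exists (Defs.coord c p) => //.
exact: (parK ac ip').2.
Qed.

(** [w] is the differential of the transition map. It does not depend on [g], so the surface and its
    normal are transported along the same vector. *)
Lemma transition_derive c1 c2 x y : atlas c1 -> atlas c2 -> dom c1 x -> dom c2 y ->
  par c1 x = par c2 y -> exists w : 'rV[R]_2 -> 'rV[R]_2,
  forall n (g : M -> 'rV[R]_n) v, differentiable (g \o par c2) y ->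
    'D_v (g \o par c1) x = 'D_(w v) (g \o par c2) y.
Proof.
move=> a1 a2 d1 d2 E; pose tau := Defs.coord c2 \o par c1.
have tx : tau x = y by rewrite /tau /= E coordK.
have ip : chart_image c2 (par c1 x) by rewrite E; exists y.
have [sm _] := atlas_oriented a1 a2.
have [dt _] := sm 1.
have dtx : differentiable tau x by exact: dt.
exists ('d tau x) => n g v dg.
have [d1o _ _ _ _] := atlas_chart a1; have [_ oi _ _ _] := atlas_chart a2.
have N : \near x, (g \o par c1) x = ((g \o par c2) \o tau) x.
  have N1 : \forall z \near x, chart_image c2 (par c1 z).
    by apply: (par_continuous a1 d1); exact: open_nbhs_nbhs.
  by apply: filterS N1 => z iz /=; rewrite (parK a2 iz).2.
have dg' : differentiable (g \o par c2) (tau x) by rewrite tx.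
apply: (etrans (near_eq_derive _ N)).
apply: (etrans (deriveE _ (differentiable_comp dtx dg'))).
rewrite diff_comp//= tx.
by rewrite -deriveE.
Qed.

Lemma clopen_surface (A : set M) : open A -> open (~` A) -> A !=set0 -> A = setT.
Proof.
move=> oA oA' A0; apply: (@surface_connected R M A A0).
  by exists A => //; rewrite setTI.
by exists A; rewrite ?setTI// -(setCK A); exact: open_closedC.
Qed.

End SurfaceCharts.

(** * The coefficients are the same on the whole surface *)

Section GlobalRotation.
Context {R : realType} {M : surface R}.
Context (F m : M -> 'rV[R]_3).
Hypothesis diffF : forall c, atlas c -> forall x, dom c x ->
  differentiable (F \o par c) x /\ differentiable (m \o par c) x.
Hypothesis mreg : forall c, atlas c -> forall x, dom c x ->
  [/\ dot (m (par c x)) (m (par c x)) = 1, forall v, dot (m (par c x)) ('D_v (m \o par c) x) = 0,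
      regular (m (par c x)) & cross (pd 0 (m \o par c) x) (pd 1 (m \o par c) x) != 0].

Definition scherk_rotation_at (a b : R) (p : M) := forall c, atlas c -> forall x, dom c x ->
  par c x = p -> scherk_related a b (F \o par c) (m \o par c) x.

Lemma scherk_rotation_at_chart a b c x : atlas c -> dom c x ->
  scherk_related a b (F \o par c) (m \o par c) x -> scherk_rotation_at a b (par c x).
Proof.
move=> ac dx rel c' ac' x' dx' E v.
have [w H] := transition_derive ac' ac dx' dx E.
have [dF dm] := diffF ac dx.
rewrite (H _ F v dF) (H _ m v dm) /= E.
exact: rel.
Qed.

(** [L n v] and [n x L n v] are orthogonal and nonzero when [v] is, so the coefficients are
    determined by a single derivative. *)
Lemma scherk_rotation_uniq a b a' b' p : scherk_rotation_at a b p -> scherk_rotation_at a' b' p ->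
  a = a' /\ b = b'.
Proof.
have [c ac [x dx <-]] := atlas_cover p => H H'.
have [mm tm rm im] := mreg ac dx.
have := etrans (esym (H c ac x dx erefl (delta_mx 0 0))) (H' c ac x dx erefl (delta_mx 0 0)).
have nw := tm (delta_mx 0 0).
have w0 : 'D_(delta_mx 0 0) (m \o par c) x != 0.
  apply: contraNneq im; rewrite /pd => ->; apply/eqP.
  by apply: row3P; rewrite !row3E; ring.
move: w0 nw; move: ('D_(delta_mx 0 0) (m \o par c) x) => w w0 nw.
have nL := scherk_map_tangent mm nw rm.
have L0 : dot (scherk_map (m (par c x)) w) (scherk_map (m (par c x)) w) != 0.
  apply: contraNneq w0 => h; rewrite -dot_eq0 -(scherk_map_norm mm nw rm) h mul0r.
  by [].
rewrite /=; move: (scherk_map _ w) nL L0 => L nL L0 E.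
have dL : dot (cross (m (par c x)) L) L = 0 by rewrite dotC dot_cross_r.
have dJ : dot (cross (m (par c x)) L) (cross (m (par c x)) L) = dot L L.
  by rewrite lagrange mm nL; ring.
split; apply: (mulIf L0).
  by have := congr1 (fun u => dot u L) E; rewrite !dotDl !dotZl dL !mulr0 !addr0.
have := congr1 (fun u => dot u (cross (m (par c x)) L)) E.
by rewrite !dotDl !dotZl dJ (dotC L) dL !mulr0 !add0r.
Qed.

(** The pair is locally constant and, by uniqueness, well defined at each point; the set where it
    takes a given value is open and closed. *)
Lemma scherk_rotation_global k (p0 : M) :
  (forall c, atlas c -> exists a b : 'rV[R]_2 -> R,
    (forall x, dom c x -> scherk_related (a x) (b x) (F \o par c) (m \o par c) x /\
       a x ^+ 2 + b x ^+ 2 = k) /\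
    (forall x r, ball x r `<=` dom c -> forall y, ball x r y -> 0 < r ->
      a y = a x /\ b y = b x)) ->
  exists a b, a ^+ 2 + b ^+ 2 = k /\ forall p : M, scherk_rotation_at a b p.
Proof.
move=> H.
have loc (p : M) : exists a b, a ^+ 2 + b ^+ 2 = k /\ \forall q \near p, scherk_rotation_at a b q.
  have [c ac [x dx <-]] := atlas_cover p.
  have [a [b [rel cst]]] := H c ac.
  have [oc _ _ _ _] := atlas_chart ac.
  have [r /= r0 rd] := (nbhs_ballP _ _).1 (open_nbhs_nbhs (conj oc dx)).
  exists (a x), (b x); split; first exact: (rel x dx).2.
  have oI := open_chart_image ac (ball_open x r) rd.
  apply: (@near_open M (par c @` ball x r)) => //; first by exists x => //; exact: ballxx.
  move=> _ [y yr <-]; apply: scherk_rotation_at_chart => //; first exact: rd.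
  have [<- <-] := cst x r rd y yr r0.
  exact: (rel y (rd _ yr)).1.
have [a [b [ab N]]] := loc p0.
exists a, b; split=> // p.
suff : [set p | scherk_rotation_at a b p] = setT by move=> /seteqP[_ /(_ p)]; apply.
apply: clopen_surface.
- rewrite openE => q Qq; have [a' [b' [_ N']]] := loc q.
  have [<- <-] := scherk_rotation_uniq (nbhs_singleton N') Qq.
  exact: N'.
- rewrite openE => q Qq; have [a' [b' [_ N']]] := loc q.
  apply: filterS (N') => z Qz /= Qz'; apply: Qq => /=.
  have [<- <-] := scherk_rotation_uniq Qz Qz'.
  exact: (nbhs_singleton N').
- by exists p0; exact: (nbhs_singleton N).
Qed.

End GlobalRotation.

(** The common description of the two surfaces to be glued, met both by the rescaled and moved [X]
    and by a member of the family. Nothing ties the sign of [m] to the orientation of the charts, so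
    a reflected surface qualifies as well. *)
Record scherk_immersion (R : realType) (M : surface R) (a b : R) (Y m : M -> 'rV[R]_3) : Prop :=
  ScherkImmersion {
    si_normal_Ck : forall c, atlas c -> Ck 1 (dom c) (m \o par c);
    si_unit : forall p, dot (m p) (m p) = 1;
    si_regular : forall p, regular (m p);
    si_immersed : forall c, atlas c -> forall x, dom c x ->
      cross (pd 0 (m \o par c) x) (pd 1 (m \o par c) x) != 0;
    si_diff : forall c, atlas c -> forall x, dom c x -> differentiable (Y \o par c) x;
    si_related : forall c, atlas c -> forall x, dom c x ->
      scherk_related a b (Y \o par c) (m \o par c) x }.

(** * Normalizing the given minimal surface *)

Section MinimalSide.
Context {R : realType}.

(* For [s = -1], the reflection that turns [(a, b)] into [(- a, b)]. *)
Definition flip3 (s : R) (u : 'rV[R]_3) : 'rV[R]_3 :=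
  vec3 (u 0 (inord 0)) (u 0 (inord 1)) (s * u 0 (inord 2)).

Lemma scherk_map_flip3 (s : R) n v : s ^+ 2 = 1 ->
  scherk_map (flip3 s n) (flip3 s v) = s *: flip3 s (scherk_map n v).
Proof.
move=> s1; rewrite /flip3 /scherk_map !vec3E !exprMn s1 !mul1r.
have ss (a b : R) : s * a * (s * b) = a * b.
  by have -> : s * a * (s * b) = s ^+ 2 * (a * b) by [ring]; rewrite s1 mul1r.
have ss' (a : R) : s * (s * a) = a by rewrite mulrA -expr2 s1 mul1r.
apply: row3P; rewrite !row3E ?ss ?ss'; ring.
Qed.

Lemma cross_flip3 (s : R) u v : s ^+ 2 = 1 ->
  cross (flip3 s u) (flip3 s v) = s *: flip3 s (cross u v).
Proof.
move=> s1; have ss' (a : R) : s * (s * a) = a by rewrite mulrA -expr2 s1 mul1r.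
by apply: row3P; rewrite !row3E ?ss'; ring.
Qed.

Lemma frame_coords_flip3 (V1 V2 V3 : 'rV[R]_3) s u :
  frame_coords V1 V2 (s *: V3) u = flip3 s (frame_coords V1 V2 V3 u).
Proof. by rewrite /flip3 /frame_coords !vec3E dotZr. Qed.

Lemma flip3D s u v : flip3 s (u + v) = flip3 s u + flip3 s v.
Proof. by apply: row3P; rewrite !row3E; ring. Qed.

Lemma flip3Z s (a : R) u : flip3 s (a *: u) = a *: flip3 s u.
Proof. by apply: row3P; rewrite !row3E; ring. Qed.

(** The sign [s] comes from reflecting the frame and changes only [a]; [s'] comes from the point
    reflection and changes both coefficients. Together they reach any quadrant, here the one where
    [- (1 / 4) cos t] and [- (1 / 4) sin t] lie. *)
Lemma quarter_angle (a b : R) : 0 < a ^+ 2 + b ^+ 2 ->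
  exists t l s s', [/\ 0 <= t <= pi / 2, 0 < l, s ^+ 2 = 1 /\ s' ^+ 2 = 1,
    s' * l * (a * s) = - (1 / 4) * cos t & s' * l * b = - (1 / 4) * sin t].
Proof.
set c := a ^+ 2 + b ^+ 2 => c0; pose r := Num.sqrt c.
have r0 : 0 < r by rewrite sqrtr_gt0.
have r2 : r ^+ 2 = c by rewrite sqr_sqrtr// ltW.
(* The value at [0] is [1], so that the square is always [1]. *)
pose sg (x : R) : R := if 0 <= x then 1 else -1.
have sg2 x : sg x ^+ 2 = 1 by rewrite /sg; case: ifP; rewrite ?sqrrN expr1n.
have sgE x : sg x * x = `|x|.
  rewrite /sg; case: lerP => h; first by rewrite mul1r ger0_norm.
  by rewrite mulN1r ltr0_norm.
have ar : `|a| / r <= 1.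
  rewrite ler_pdivrMr// mul1r -ler_sqr ?nnegrE ?(ltW r0)// r2 real_normK ?num_real//.
  by rewrite lerDl sqr_ge0.
have ar0 : 0 <= `|a| / r by rewrite divr_ge0// ltW.
have dom : -1 <= `|a| / r <= 1 by rewrite ar andbT (le_trans _ ar0)// lerN10.
have ct : cos (acos (`|a| / r)) = `|a| / r by rewrite acosK// in_itv.
have st : sin (acos (`|a| / r)) = `|b| / r.
  rewrite sin_acos//.
  have -> : 1 - (`|a| / r) ^+ 2 = (`|b| / r) ^+ 2.
    rewrite !expr_div_n !real_normK ?num_real// r2.
    by apply: (mulIf (lt0r_neq0 c0)); rewrite mulrBl !divfK ?lt0r_neq0// /c; ring.
  by rewrite sqrtr_sqr ger0_norm// divr_ge0// ltW.
(* The homothety brings the radius [r] to [1 / 4], the size of the members of the family in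
   [weierstrass_scherk]. *)
exists (acos (`|a| / r)), (1 / (4 * r)), (sg a * sg b), (- sg b).
have sgb x : sg b * (sg b * x) = x by rewrite mulrA -expr2 sg2 mul1r.
split.
- rewrite acos_ge0//= leNgt; apply/negP => h.
  have : 0 < cos (acos (`|a| / r) - pi).
    apply: cos_gt0_pihalf; have := acos_lepi dom; have := pi_gt0 R; move: h.
    by move: (acos _) (pi : R) => x y *; apply/andP; split; lra.
  by rewrite cosB cospi sinpi mulr0 addr0 mulrN1 ct oppr_gt0 ltNge ar0.
- by rewrite divr_gt0// mulr_gt0.
- by rewrite exprMn sqrrN !sg2 mulr1.
- rewrite ct -(sgE a).
  transitivity (- (sg b * (sg b * (sg a * a))) * (1 / (4 * r))); first by ring.
  by rewrite sgb; field; rewrite lt0r_neq0.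
- rewrite st -(sgE b).
  by field; rewrite lt0r_neq0.
Qed.

Lemma enorm_isometry (f : 'rV[R]_3 -> 'rV[R]_3) (t : 'rV[R]_3) :
  (forall u v, f u - f v = f (u - v)) -> (forall u, dot (f u) (f u) = dot u u) ->
  euclidean_isometry (fun y => f y + t).
Proof. by move=> fB fd x y; rewrite /enorm opprD addrACA subrr addr0 fB fd. Qed.

Lemma enorm1 (V : 'rV[R]_3) : enorm V = 1 -> dot V V = 1.
Proof. by move=> h; rewrite -[LHS]sqr_sqrtr ?dot_ge0// -/(enorm V) h expr1n. Qed.

(** The coefficients are computed in the frame with [s = 1], and only they tell which reflection is
    wanted. The facts on the normal are therefore proved for either sign [s], and the relation found
    for [s = 1] is transported by [flip3]. *)
Theorem minimal_scherk_immersion (M : surface R) (X : M -> 'rV[R]_3) (hX : minimal_immersion X)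
    (n : M -> 'rV[R]_3) (hn : gauss_map X n)
    (K : M -> R) (hK : gauss_curvature X K) (K_lt0 : forall p, K p < 0)
    (V1 V2 : 'rV[R]_3) (hV1 : enorm V1 = 1) (hV2 : enorm V2 = 1) (hV12 : dot V1 V2 = 0)
    (hconst : exists k : R, forall p : M,
       let w := (1 - dot (n p) V1 ^+ 2) * (1 - dot (n p) V2 ^+ 2) / (- K p) in
       0 < w -> ln w = k) (p0 : M) :
  exists theta l, [/\ 0 <= theta <= pi / 2, 0 < l & exists f m,
    (forall t, euclidean_isometry (fun y => f y + t)) /\
    scherk_immersion (- (1 / 4) * cos theta) (- (1 / 4) * sin theta) (fun p => f (l *: X p)) m].
Proof.
have h1 := enorm1 hV1; have h2 := enorm1 hV2.
have [k hk] := hconst.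
pose T s := frame_coords V1 V2 (s *: cross V1 V2).
have dotT s u v : s ^+ 2 = 1 -> dot (T s u) (T s v) = dot u v.
  by move=> s1; exact: dot_frame_coords.
have mc c : atlas c -> minimal_chart (dom c) (X \o par c).
  move=> ac; have [im me] := hX; have [sm cr] := im c ac; have [oc _ _ _ _] := atlas_chart ac.
  split=> //; first exact: me.
  by move=> x dx; rewrite -(hK c ac x dx).
have eqn s c : atlas c -> forall x, dom c x ->
    (fun p => T s (n p)) (par c x) = T s (unit_normal (X \o par c) x).
  by move=> ac x dx; rewrite /= (hn c ac x dx).
have eqd s c x v : atlas c -> dom c x -> 'D_v ((fun p => T s (n p)) \o par c) x =
    'D_v (fun y => T s (unit_normal (X \o par c) y)) x.
  move=> ac dx; have [oc _ _ _ _] := atlas_chart ac.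
  by apply: near_eq_derive; apply: (near_open oc dx) => y dy; exact: eqn.
have Cm j s c : s ^+ 2 = 1 -> atlas c -> Ck j (dom c) ((fun p => T s (n p)) \o par c).
  move=> s1 ac; have [oc _ _ _ _] := atlas_chart ac.
  apply: (Ck_ext oc _ (Ck_chart_normal V1 V2 (s *: cross V1 V2) (mc c ac) j)) => x dx.
  by rewrite /= (hn c ac x dx).
have one2 : (1 : R) ^+ 2 = 1 by rewrite expr1n.
have reg s c : s ^+ 2 = 1 -> atlas c -> forall x, dom c x ->
    regular (T s (unit_normal (X \o par c) x)) /\
    (1 - T s (unit_normal (X \o par c) x) 0 (inord 0) ^+ 2) *
    (1 - T s (unit_normal (X \o par c) x) 0 (inord 1) ^+ 2) =
    expR k * - gauss_curv (X \o par c) x.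
  move=> s1 ac; apply: (chart_regular (fun u v => dotT s u v s1) (mc c ac)) => x dx.
  have := hk (par c x); rewrite (hK c ac x dx) (hn c ac x dx) /T /frame_coords !vec3E.
  exact.
have imm s c : s ^+ 2 = 1 -> atlas c -> forall x, dom c x ->
    cross (pd 0 ((fun p => T s (n p)) \o par c) x) (pd 1 ((fun p => T s (n p)) \o par c) x) != 0.
  move=> s1 ac x dx.
  rewrite (f_equal2 (@cross R) (eqd s c x (delta_mx 0 0) ac dx) (eqd s c x (delta_mx 0 1) ac dx)).
  exact: (chart_normal_immersed (fun u v => dotT s u v s1) (mc c ac) dx).
have un s p : s ^+ 2 = 1 -> dot (T s (n p)) (T s (n p)) = 1.
  move=> s1; have [c ac [x dx <-]] := atlas_cover p.
  rewrite dotT// (hn c ac x dx); apply: unit_normal_unit.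
  by have [im _] := hX; exact: (im c ac).2.
have rg s p : s ^+ 2 = 1 -> regular (T s (n p)).
  move=> s1; have [c ac [x dx <-]] := atlas_cover p.
  by rewrite (hn c ac x dx); exact: (reg s c s1 ac x dx).1.
have dX c x : atlas c -> dom c x -> differentiable (X \o par c) x.
  by move=> ac dx; have [_ sm _ _ _] := mc c ac; have [d _] := sm 1; exact: d.
have dn c x : atlas c -> dom c x -> differentiable (n \o par c) x.
  move=> ac dx; have [oc sm fc _ _] := mc c ac.
  have [d _] := Ck_unit_normal oc (sm 2) fc.
  apply: near_eq_differentiable (d x dx); apply: (near_open oc dx) => y dy.
  by rewrite /= (hn c ac y dy).
have [a [b [abk rel]]] : exists a b, a ^+ 2 + b ^+ 2 = expR k /\
    forall p : M, scherk_rotation_at (fun p => T 1 (X p)) (fun p => T 1 (n p)) a b p.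
  apply: (@scherk_rotation_global R M (fun p => T 1 (X p)) (fun p => T 1 (n p)) _ _ (expR k) p0).
  - move=> c ac x dx; split.
      exact: (derive_frame_coords V1 V2 (1 *: cross V1 V2) 0 (dX c x ac dx)).1.
    exact: (derive_frame_coords V1 V2 (1 *: cross V1 V2) 0 (dn c x ac dx)).1.
  - move=> c ac x dx; split; [exact: un|move=> v|exact: rg|exact: imm].
    have [oc _ _ _ _] := atlas_chart ac;
      apply: (@derive_dot_unit _ _ ((fun p => T 1 (n p)) \o par c)).
      by apply: (near_open oc dx) => y dy; exact: un.
    exact: (derive_frame_coords V1 V2 (1 *: cross V1 V2) 0 (dn c x ac dx)).1.
  - move=> c ac.
    have [a [b [rel cst]]] := chart_rotation (fun u v => dotT 1 u v one2) (mc c ac) (expR_gt0 k)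
      (reg 1 c one2 ac).
    exists a, b; split; last exact: cst.
    move=> x dx; have [rx ab] := rel x dx; split=> // v.
    apply: (etrans (rx v)).
    by rewrite /= (hn c ac x dx) (eqd 1 c x v ac dx).
have [|theta [l [s [s' [t01 l0 [s1 s1'] Ea Eb]]]]] := @quarter_angle a b.
  by rewrite abk expR_gt0.
exists theta, l; split=> //.
exists (fun u => s' *: T s u), (fun p => T s (n p)); split.
  move=> t; apply: enorm_isometry => [u v|u].
    by apply: row3P; rewrite !row3E !dotE !row3E; ring.
  by rewrite dotZl dotZr mulrA -expr2 s1' mul1r dotT.
have TE u : T s u = flip3 s (T 1 u) by rewrite /T scale1r frame_coords_flip3.
have YE : (fun p => s' *: T s (l *: X p)) = (fun p => (s' * l) *: T s (X p)).
  by apply/funext => p; apply: row3P; rewrite !row3E !dotE !row3E; ring.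
have dTX c x : atlas c -> dom c x -> differentiable ((fun p => T s (X p)) \o par c) x.
  by move=> ac dx; exact: (derive_frame_coords V1 V2 (s *: cross V1 V2) 0 (dX c x ac dx)).1.
split.
- by move=> c ac; exact: Cm.
- by move=> p; exact: un.
- by move=> p; exact: rg.
- by move=> c ac x dx; exact: imm.
- by move=> c ac x dx; rewrite YE; apply: differentiableZ; exact: dTX.
- move=> c ac x dx v; rewrite YE.
  have ED : 'D_v ((fun p => (s' * l) *: T s (X p)) \o par c) x =
      (s' * l) *: 'D_v ((fun p => T s (X p)) \o par c) x.
    by apply: deriveZ; apply: diff_derivable; exact: dTX.
  apply: (etrans ED).
  have EX := (derive_frame_coords V1 V2 (s *: cross V1 V2) v (dX c x ac dx)).2.
  have EX1 := (derive_frame_coords V1 V2 (1 *: cross V1 V2) v (dX c x ac dx)).2.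
  have En := (derive_frame_coords V1 V2 (s *: cross V1 V2) v (dn c x ac dx)).2.
  have En1 := (derive_frame_coords V1 V2 (1 *: cross V1 V2) v (dn c x ac dx)).2.
  have R1 := rel (par c x) c ac x dx erefl v.
  have {}R1 := etrans (esym EX1) R1.
  rewrite [X in scherk_map _ X]En1 /= in R1.
  rewrite [X in _ *: X]EX.
  have -> : 'D_v ((fun p => T s (n p)) \o par c) x = T s ('D_v (n \o par c) x) := En.
  rewrite [LHS](_ : _ = (s' * l) *: flip3 s (T 1 ('D_v (X \o par c) x))); last by rewrite -TE.
  (* Flipping multiplies [L] by [s] and [n x L] by [s ^+ 2 = 1], so the reflection changes the sign
     of [a] alone. *)
  rewrite [T 1 _]R1 /= !TE scherk_map_flip3// crossZr cross_flip3//.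
  rewrite flip3D !flip3Z !scalerDr !scalerA -Ea -Eb -!mulrA.
  by congr (_ *: _ + _ *: _); rewrite ?s1// -expr2 s1 mulr1.
Qed.

End MinimalSide.

(** * The associate family *)

Section ScherkSide.
Context {R : realType}.

Lemma not_pole (n : 'rV[R]_3) : dot n n = 1 -> ~ (n 0 (inord 0) = 0 /\ n 0 (inord 1) = 0) ->
  [/\ n <> north R, n 0 (inord 2) != 1 & stereo n != 0].
Proof.
move=> nn np; have n21 : n 0 (inord 2) != 1.
  apply/eqP => h; apply: np; move: nn; rewrite dotE h mulr1 => e.
  have /eqP : n 0 (inord 0) ^+ 2 + n 0 (inord 1) ^+ 2 = 0.
    by rewrite !expr2; apply: (addIr 1); rewrite e add0r.
  by rewrite paddr_eq0 ?sqr_ge0// !expf_eq0/= => /andP[/eqP-> /eqP->].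
split=> //; first by move=> e; move: n21; rewrite e /north vec3E eqxx.
have d0 : 1 - n 0 (inord 2) != 0 by rewrite subr_eq0 eq_sym.
apply/eqP => /eqP; rewrite /stereo eq_complex /= !mulf_eq0 invr_eq0 (negPf d0) !orbF.
by move=> /andP[/eqP a /eqP b]; apply: np.
Qed.

(** The punctures [1, -1, 'i, - 'i] are the stereographic images of the four poles [+- e0], [+- e1];
    [regular_punctured_sphere] gives the converse. *)
Lemma punctured_sphere_regular (n : 'rV[R]_3) : punctured_sphere n -> regular n.
Proof.
move=> [n1 H]; have nn := enorm1 n1; apply/(regularP nn); rewrite mulrC; apply/eqP => h.
have [s [/eqP s1 nE]] := unit_coords nn h.
move: s1; rewrite sqrf_eq1 => s1.
have nn' : n <> north R.
  move=> e; have : n 0 (inord 2) = 1 by rewrite e /north vec3E.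
  by case: nE => ->; rewrite vec3E => /eqP; rewrite eq_sym oner_eq0.
case: H => [//|]; apply/negP; rewrite negbK !inE /stereo.
case: nE => ->; rewrite !vec3E !subr0 !divr1.
- by case/orP: s1 => /eqP ->; rewrite !eq_complex /= ?oppr0 !eqxx ?orbT.
- by case/orP: s1 => /eqP ->; rewrite !eq_complex /= ?oppr0 !eqxx ?orbT.
Qed.

Lemma regular_punctured_sphere (n : 'rV[R]_3) : dot n n = 1 -> regular n -> punctured_sphere n.
Proof.
move=> nn rn; split; first by rewrite /enorm nn sqrtr1.
have [n1|n1] := eqVneq (n 0 (inord 2)) 1.
  left; have := nn; rewrite dotE n1 mulr1 => e.
  have /eqP : n 0 (inord 0) ^+ 2 + n 0 (inord 1) ^+ 2 = 0.
    by rewrite !expr2; apply: (addIr 1); rewrite e add0r.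
  rewrite paddr_eq0 ?sqr_ge0// !expf_eq0/= => /andP[/eqP a /eqP b].
  by rewrite [LHS]vec3_eta a b n1.
right; have nE := istereo_surj nn n1; rewrite nE in rn *.
move: rn; set x := (_ / _); set y := (_ / _) => rn.
have [r1 r2] := regular_istereo rn.
rewrite stereo_istereo; apply/negP; rewrite !inE !eq_complex /= oppr0 => H.
have {H} : (x ^+ 2 == 1) && (y == 0) || (x == 0) && (y ^+ 2 == 1).
  by move: H; rewrite !sqrf_eq1; case: (x == 1); case: (x == -1); case: (y == 0); case: (y == 1);
    case: (y == -1); case: (x == 0); rewrite ?orbT ?andbT.
move=> /orP[/andP[/eqP hx /eqP hy]|/andP[/eqP hx /eqP hy]].
  by move/eqP: r2; apply; rewrite hx hy; ring.
by move/eqP: r1; apply; rewrite hx hy; ring.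
Qed.

Lemma covering_injective_near (P T : topologicalType) (B : set T) (f : P -> T) p :
  covering_map B f -> exists A : set P, [/\ open A, A p & {in A &, injective f}].
Proof.
move=> [_ fB ev]; have Bp : B (f p) by rewrite -fB; exists p.
have [V [_ Vp [sh [_ shV Hs]]]] := ev _ Bp.
have : (f @^-1` V) p by [].
rewrite -shV => -[A shA Ap]; have [oA [s [_ _ sK]]] := Hs A shA.
exists A; split=> // q q' /[!inE] Aq Aq' E.
by rewrite -(sK _ Aq) -(sK _ Aq') E.
Qed.

Lemma pole_close (u v : 'rV[R]_3) : dot u u = 1 -> dot v v = 1 ->
  u 0 (inord 0) = 0 /\ u 0 (inord 1) = 0 -> v 0 (inord 0) = 0 /\ v 0 (inord 1) = 0 ->
  `|u - v| < 1 -> u = v.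
Proof.
rewrite !dotE => + + [u0 u1] [v0 v1]; rewrite u0 u1 v0 v1 !mul0r !add0r -!expr2 => uu vv h.
have c : `|u 0 (inord 2) - v 0 (inord 2)| < 1.
  by have := coord_le_norm (u - v) (inord 2); rewrite !mxE => /le_lt_trans; apply.
by apply: row3P; rewrite ?u0 ?u1 ?v0 ?v1//; exact: sign_close.
Qed.

Lemma stereo_derive (V : normedModType R) (m : V -> 'rV[R]_3) x v :
  differentiable m x -> m x 0 (inord 2) != 1 ->
  'D_v (fun y => complex.Re (stereo (m y))) x =
    'D_v m x 0 (inord 0) / (1 - m x 0 (inord 2)) +
    m x 0 (inord 0) * 'D_v m x 0 (inord 2) / (1 - m x 0 (inord 2)) ^+ 2 /\
  'D_v (fun y => complex.Im (stereo (m y))) x =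
    'D_v m x 0 (inord 1) / (1 - m x 0 (inord 2)) +
    m x 0 (inord 1) * 'D_v m x 0 (inord 2) / (1 - m x 0 (inord 2)) ^+ 2.
Proof.
move=> dm m1; have d0 : 1 - m x 0 (inord 2) != 0 by rewrite subr_eq0 eq_sym.
have dD : differentiable (fun y => 1 - m y 0 (inord 2)) x.
  apply: differentiableB; [exact: differentiable_cst|exact: differentiable_coords].
have ED : 'D_v (fun y => 1 - m y 0 (inord 2)) x = - 'D_v m x 0 (inord 2).
  rewrite (@deriveB _ _ _ (fun=> (1 : R)) (fun y => m y 0 (inord 2))).
  - by rewrite derive_cst sub0r derive_coord.
  - exact: derivable_cst.
  - exact/diff_derivable/differentiable_coords.
have dV := differentiableV dD d0.
have dVd : derivable (fun y => (1 - m y 0 (inord 2))^-1) x v by exact: diff_derivable.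
have E i : 'D_v (fun y => m y 0 i / (1 - m y 0 (inord 2))) x =
    'D_v m x 0 i / (1 - m x 0 (inord 2)) +
    m x 0 i * 'D_v m x 0 (inord 2) / (1 - m x 0 (inord 2)) ^+ 2.
  have dc := differentiable_coords i dm.
  apply: (etrans (deriveM_scalar v dc dV)).
  rewrite (derive_coord v i dm).
  have -> : 'D_v (fun y => (1 - m y 0 (inord 2))^-1) x =
      'D_v m x 0 (inord 2) / (1 - m x 0 (inord 2)) ^+ 2.
    have dDd : derivable (fun y => 1 - m y 0 (inord 2)) x v by exact: diff_derivable.
    rewrite (@deriveV _ _ (fun y => 1 - m y 0 (inord 2)) x v d0 dDd) ED.
    by rewrite /GRing.scale /= mulrN mulNr opprK mulrC.
  by rewrite mulrA.
by split; exact: E.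
Qed.

(** Away from the normals [+- e2] this is [weierstrass_scherk]. Those two normals are attained at
    isolated points, as a covering map is locally injective, and the relation extends there by
    continuity. *)
Lemma scherk_family_immersion (D : surface R) (S nu : D -> 'rV[R]_3) (dh : one_form R D) theta :
  covering_map (@punctured_sphere R) nu -> scherk_form nu dh ->
  minimal_immersion S -> weierstrass_data S nu (fun c x v => expi theta * dh c x v) ->
  scherk_immersion (- (1 / 4) * cos theta) (- (1 / 4) * sin theta) S nu.
Proof.
move=> cov sf [im _] [gn W].
have un p : dot (nu p) (nu p) = 1.
  have [c ac [x dx <-]] := atlas_cover p; rewrite (gn c ac x dx).
  by apply: unit_normal_unit; exact: (im c ac).2.
have rg p : regular (nu p).
  by apply: punctured_sphere_regular; have [_ <- _] := cov; exists p.
have Cn k c : atlas c -> Ck k (dom c) (nu \o par c).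
  move=> ac; have [oc _ _ _ _] := atlas_chart ac; have [sm cr] := im c ac.
  apply: (Ck_ext oc _ (Ck_unit_normal oc (sm k.+1) cr)) => x dx.
  by rewrite /= (gn c ac x dx).
have dn c x : atlas c -> dom c x -> differentiable (nu \o par c) x.
  by move=> ac dx; have [d _] := Cn 1 c ac; exact: d.
have tn c x v : atlas c -> dom c x -> dot (nu (par c x)) ('D_v (nu \o par c) x) = 0.
  move=> ac dx; have [oc _ _ _ _] := atlas_chart ac.
  apply: (@derive_dot_unit _ _ (nu \o par c)); last exact: dn.
  by apply: (near_open oc dx) => y _; exact: un.
have gen c x : atlas c -> dom c x ->
    ~ (nu (par c x) 0 (inord 0) = 0 /\ nu (par c x) 0 (inord 1) = 0) ->
    scherk_related (- (1 / 4) * cos theta) (- (1 / 4) * sin theta) (S \o par c) (nu \o par c) x.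
  move=> ac dx np v; have [nN n2 st0] := not_pole (un _) np.
  have E := W c ac x dx nN (elimN eqP st0) v.
  have F := sf c ac x dx nN (elimN eqP st0) v.
  have [pE qE] := stereo_derive v (dn c x ac dx) n2.
  apply: (etrans E).
  apply: (etrans (weierstrass_scherk theta (un _) (tn c x v ac dx) (rg _) n2 st0 pE qE F)).
  by rewrite scalerDr !scalerA.
have rel c x : atlas c -> dom c x ->
    scherk_related (- (1 / 4) * cos theta) (- (1 / 4) * sin theta) (S \o par c) (nu \o par c) x.
  move=> ac dx.
  have [|np] := pselect (nu (par c x) 0 (inord 0) = 0 /\ nu (par c x) 0 (inord 1) = 0);
    last exact: gen.
  move=> pole v; have [oc _ _ _ _] := atlas_chart ac; have [sm _] := im c ac.
  pose g y := 'D_v (S \o par c) y - ((- (1 / 4) * cos theta) *: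
    scherk_map ((nu \o par c) y) ('D_v (nu \o par c) y) + (- (1 / 4) * sin theta) *:
    cross ((nu \o par c) y) (scherk_map ((nu \o par c) y) ('D_v (nu \o par c) y))).
  have C0n := Cn 0 c ac.
  have CDn : Ck 0 (dom c) ('D_v (nu \o par c)) by have [_ d] := Cn 1 c ac; exact: d.
  have CDS : Ck 0 (dom c) ('D_v (S \o par c)) by have [_ d] := sm 1; exact: d.
  have CL : Ck 0 (dom c) (fun y => scherk_map ((nu \o par c) y) ('D_v (nu \o par c) y)).
    by apply: (Ck_scherk_map oc C0n CDn) => y _; exact: rg.
  have CJ := Ck_cross oc C0n CL.
  have Cr := Ck_add oc (Ck_scale oc (Ck_cst 0 _ (- (1 / 4) * cos theta)) CL)
    (Ck_scale oc (Ck_cst 0 _ (- (1 / 4) * sin theta)) CJ).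
  have cg : {for x, continuous g}.
    have := @Ck_add _ 0 (dom c) ('D_v (S \o par c)) _ oc CDS (Ck_scale oc (Ck_cst 0 _ (-1)) Cr).
    move=> /(_ x); rewrite inE => /(_ dx); apply: near_eq_continuous.
    by near=> y; rewrite /g scaleN1r.
  (* Near [x] another point with normal [+- e2] would have the same normal as [x], since [e2] and
     [- e2] are far apart, and would then coincide with [x] by injectivity on [A]. *)
  have [A [oA Ap inj]] := covering_injective_near (par c x) cov.
  have NA : \forall y \near x, A (par c y).
    by apply: (par_continuous ac dx); exact: open_nbhs_nbhs.
  have cn : {for x, continuous (nu \o par c)} by apply: C0n; rewrite inE.
  have h2 : (0 : R) < 1 / 2 by [].
  have NC := (continuous_normP _ _).1 cn (1 / 2) h2.
  have ND : \forall y \near x, dom c y by exact: open_nbhs_nbhs.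
  have [r /= r0 Hr] := (nbhs_ballP _ _).1 (filterI NA (filterI NC ND)).
  apply/eqP; rewrite -subr_eq0; apply/eqP.
  apply: (punctured_eq0 r0 cg) => y yr yx.
  have [Ay [Cy dy]] := Hr y yr.
  apply/eqP; rewrite /g subr_eq0; apply/eqP; apply: gen => // pole'.
  move/eqP: yx; apply.
  have E : nu (par c x) = nu (par c y).
    apply: pole_close => //; apply: le_lt_trans Cy _.
    by rewrite ltr_pdivrMr// mul1r ltr1n.
  have := inj _ _ (mem_set Ap) (mem_set Ay) E.
  by move=> /(congr1 (Defs.coord c)); rewrite !coordK.
split.
- by move=> c ac; exact: Cn.
- exact: un.
- exact: rg.
(* The differential of [S] depends linearly on that of [nu], so dependent partial derivatives of
   [nu] would give dependent ones of [S]. *)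
- move=> c ac x dx; have [sm cr] := im c ac.
  apply/eqP => h; apply: (cr x dx).
  have R0 := rel c x ac dx (delta_mx 0 0); have R1 := rel c x ac dx (delta_mx 0 1).
  apply: (etrans (f_equal2 (@cross R) R0 R1)).
  move: h; rewrite /pd; move: ('D_(delta_mx 0 0) (nu \o par c) x) ('D_(delta_mx 0 1) (nu \o par
    c) x).
  move: ((nu \o par c) x) (- (1 / 4) * cos theta) (- (1 / 4) * sin theta) => n a b u w h.
  have [u0|u0] := eqVneq u 0.
    by rewrite u0; apply: row3P; rewrite !row3E; ring.
  have uu : dot u u != 0 by rewrite dot_eq0.
  have wE : w = (dot u w / dot u u) *: u.
    apply/eqP; rewrite -subr_eq0 -dot_eq0; apply/eqP; apply: (mulfI uu); rewrite mulr0.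
    transitivity (dot u u * dot w w - dot u w ^+ 2); last by rewrite -lagrange h !dotE !row3E;
      ring.
    rewrite -scaleNr dotDl dotZl !(dotC _ (w + _)) !dotDl !dotZl (dotC w u).
    by field.
  by rewrite wE scherk_mapZ crossZr; apply: row3P; rewrite !(mxDE, mxZE, crossE, vec3E, mx0E);
    ring.
- by move=> c ac x dx; have [sm _] := im c ac; have [d _] := sm 1; exact: d.
- by move=> c ac x dx; exact: rel.
Unshelve. all: by end_near. Qed.

End ScherkSide.

(** * Gluing along the Gauss maps *)

Section LiftConstant.
Context {R : realType}.

Lemma scherk_rotation_bounded (a b : R) (n : 'rV[R]_3) : exists2 k, 0 <= k & forall u,
  `|a *: scherk_map n u + b *: cross n (scherk_map n u)| <= k * `|u|.
Proof.
pose L u := a *: scherk_map n u + b *: cross n (scherk_map n u).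
exists (`|L (vec3 1 0 0)| + `|L (vec3 0 1 0)| + `|L (vec3 0 0 1)|); first by rewrite !addr_ge0.
move=> u.
have E : L u = u 0 (inord 0) *: L (vec3 1 0 0) + u 0 (inord 1) *: L (vec3 0 1 0) +
    u 0 (inord 2) *: L (vec3 0 0 1).
  have {1}-> : u = u 0 (inord 0) *: vec3 1 0 0 + u 0 (inord 1) *: vec3 0 1 0 +
    u 0 (inord 2) *: vec3 0 0 1.
    by apply: row3P; rewrite !row3E; ring.
  rewrite /L !scherk_mapD !scherk_mapZ !crossDr !crossZr.
  by apply: row3P; rewrite !(mxDE, mxZE); ring.
rewrite -/(L u) E !mulrDl.
rewrite (le_trans (ler_normD _ _))// lerD//;
  last by rewrite normrZ mulrC ler_wpM2l// coord_le_norm.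
rewrite (le_trans (ler_normD _ _))// lerD// normrZ mulrC ler_wpM2l// coord_le_norm//.
Qed.

(* Since [N] is bi-Lipschitz near [psi z], the increment of [psi] is controlled by that of [m]:
   no inverse function theorem is needed to differentiate the lift [Z \o psi] of [m]. *)
Lemma derive_lift (a b : R) (UN : set 'rV[R]_2) (N Z m : 'rV[R]_2 -> 'rV[R]_3)
    (psi : 'rV[R]_2 -> 'rV[R]_2) z :
  open UN -> Ck 1 UN N -> UN (psi z) -> cross (pd 0 N (psi z)) (pd 1 N (psi z)) != 0 ->
  differentiable Z (psi z) -> scherk_related a b Z N (psi z) ->
  {for z, continuous psi} -> differentiable m z ->
  (\forall x \near z, N (psi x) = m x) ->
  forall e, 0 < e -> \forall x \near z,
    `|Z (psi x) - Z (psi z) - (a *: scherk_map (m z) ('d m z (x - z)) +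
       b *: cross (m z) (scherk_map (m z) ('d m z (x - z))))| <= e * `|x - z|.
Proof.
move=> oN CN Nz imN dZ rel cpsi dm NE e e0.
have Ez : N (psi z) = m z by exact: (nbhs_singleton NE).
have [C [r [C0 r0 rU lip]]] := immersion_lipschitz oN CN Nz imN.
have dN : differentiable N (psi z) by have [d _] := CN; exact: d.
have [K K0 HK] := scherk_rotation_bounded a b (m z).
set Lam := fun u => a *: scherk_map (m z) u + b *: cross (m z) (scherk_map (m z) u) in HK.
have LamB u v : Lam (u - v) = Lam u - Lam v.
  rewrite /Lam -scaleN1r scherk_mapD scherk_mapZ crossDr crossZr.
  by apply: row3P; rewrite !(mxDE, mxZE, mxNE); ring.
have [B B0 HB] := linear_lipschitz (diff_continuous dm).
(* [B] bounds the differential of [m], so [psi] has increments at most [C * (B + 1) * |x - z|]; [e1]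
   makes the three first-order errors, one of them magnified by [K], sum to at most
   [e * |x - z|]. *)
pose e1 := e / (C * (B + 1) + K * (1 + C * (B + 1)) + 1).
have CB0 : 0 <= C * (B + 1) by rewrite mulr_ge0 ?addr_ge0// ltW.
have den0 : 0 < C * (B + 1) + K * (1 + C * (B + 1)) + 1.
  by rewrite ltr_wpDl// addr_ge0// mulr_ge0// addr_ge0.
have e10 : 0 < e1 by rewrite divr_gt0.
have nb : \forall x \near z, ball (psi z) r (psi x).
  exact: (cpsi _ (nbhsx_ballx (psi z) r r0)).
have n1 : \forall x \near z,
  `|Z (psi x) - Z (psi z) - 'd Z (psi z) (psi x - psi z)| <= e1 * `|psi x - psi z|.
  exact: (cpsi _ (diff_bound dZ e10)).
have n2 : \forall x \near z,
  `|N (psi x) - N (psi z) - 'd N (psi z) (psi x - psi z)| <= e1 * `|psi x - psi z|.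
  exact: (cpsi _ (diff_bound dN e10)).
have n3 := diff_bound dm e10.
have n4 := diff_bound dm (ltr01 : (0 : R) < 1).
apply: filterS (filterI (filterI nb NE) (filterI (filterI n1 n2) (filterI n3 n4))) => x.
move=> [[bx NEx] [[G1 G2] [G3 G4]]].
have H4 : `|m x - m z| <= (B + 1) * `|x - z|.
  have -> : m x - m z = 'd m z (x - z) + (m x - m z - 'd m z (x - z)) by rewrite [RHS]addrC subrK.
  apply: le_trans (ler_normD _ _) _; rewrite mulrDl; apply: lerD; first exact: HB.
  exact: G4.
have Hp : `|psi x - psi z| <= C * (B + 1) * `|x - z|.
  apply: le_trans (lip _ _ bx (ballxx _ r0)) _.
  rewrite -mulrA ler_wpM2l//; first exact: ltW.
  by rewrite NEx Ez.
have H1 : `|Z (psi x) - Z (psi z) - 'd Z (psi z) (psi x - psi z)| <= e1 * (C * (B +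
  1) * `|x - z|).
  apply: (@le_trans _ _ (e1 * `|psi x - psi z|)); first exact: G1.
  by rewrite ler_wpM2l// ltW.
have H2 : `|N (psi x) - N (psi z) - 'd N (psi z) (psi x - psi z)| <= e1 * (C * (B +
  1) * `|x - z|).
  apply: (@le_trans _ _ (e1 * `|psi x - psi z|)); first exact: G2.
  by rewrite ler_wpM2l// ltW.
have H3 : `|m x - m z - 'd m z (x - z)| <= e1 * `|x - z| := G3.
rewrite NEx Ez in H2.
have ZE : 'd Z (psi z) (psi x - psi z) = Lam ('d N (psi z) (psi x - psi z)).
  have := rel (psi x - psi z); rewrite !deriveE// Ez; exact.
rewrite ZE in H1.
(* Here [p] is the linear increment of [N] and [q] that of [m]. Both approximate the same true
   increment [dn], so [p] may be replaced by [q] under the bounded map [Lam]. *)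
have H5 (dz dn p q : 'rV[R]_3) (t u : R) : `|dz - Lam p| <= t -> `|dn - p| <= t ->
    `|dn - q| <= u -> `|dz - Lam q| <= t + K * (u + t).
  move=> g1 g2 g3.
  have -> : dz - Lam q = (dz - Lam p) + Lam ((dn - q) - (dn - p)).
    have -> : dn - q - (dn - p) = p - q by apply: row3P; rewrite !(mxDE, mxNE); ring.
    by rewrite LamB addrA subrK.
  apply: le_trans (ler_normD _ _) _; apply: lerD => //.
  apply: le_trans (HK _) _; rewrite ler_wpM2l//.
  by apply: le_trans (ler_normB _ _) _; exact: lerD.
apply: le_trans (H5 _ _ _ _ _ _ H1 H2 H3) _.
have -> : e1 * (C * (B + 1) * `|x - z|) + K * (e1 * `|x - z| + e1 * (C * (B + 1) * `|x - z|)) =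
    e1 * (C * (B + 1) + K * (1 + C * (B + 1))) * `|x - z| by ring.
rewrite ler_wpM2r// /e1 mulrAC ler_pdivrMr// ler_wpM2l ?(ltW e0)// lerDl.
by [].
Qed.

End LiftConstant.

Section Lift.
Context {R : realType} {M D : surface R} (a b : R).
Context (Y m : M -> 'rV[R]_3) (S nu : D -> 'rV[R]_3).
Hypothesis hY : scherk_immersion a b Y m.
Hypothesis hS : scherk_immersion a b S nu.

Lemma scherk_normal_continuous (N : surface R) (Z k : N -> 'rV[R]_3) :
  scherk_immersion a b Z k -> continuous k.
Proof.
move=> hZ p; have [c ac [x dx xp]] := atlas_cover p.
have [oc oi _ _ _] := atlas_chart ac.
have ip : chart_image c p by exists x.
have N1 : \near p, ((k \o par c) \o Defs.coord c) p = k p.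
  by apply: (near_open oi ip) => q iq /=; rewrite (parK ac iq).2.
apply: (near_eq_continuous N1).
apply: continuous_comp; first exact: coord_continuous_at.
rewrite -xp (coordK ac dx); apply: differentiable_continuous.
by have [d _] := si_normal_Ck hZ ac; exact: (d x dx).
Qed.

(** [s] is a continuous section of [nu], so [nu] composed with the lift [s o m] is [m]. By
    [derive_lift] the lifted surface [S o s o m] has as differential the same function of [m] and
    [dm] as [Y], hence the difference has differential zero. *)
Lemma lift_difference_constant c x0 r (W : set 'rV[R]_3) (s : 'rV[R]_3 -> D) :
  atlas c -> ball x0 r `<=` dom c ->
  (forall x, ball x0 r x -> W (m (par c x))) ->
  {within W, continuous s} -> (forall y, W y -> nu (s y) = y) ->
  forall x y, ball x0 r x -> ball x0 r y ->
    Y (par c x) - S (s (m (par c x))) = Y (par c y) - S (s (m (par c y))).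
Proof.
move=> ac rd hW cs sK.
pose g x := Y (par c x) - S (s (m (par c x))).
suff G z : ball x0 r z -> is_diff z g (\0 : {linear 'rV[R]_2 -> 'rV[R]_3}).
  move=> x y xr yr.
  apply: (@derive0_ball_cst R 2 g x0 r x y _ _ xr yr) => [z zr|z v zr].
    by have [] := G z zr.
  by have [d E] := G z zr; rewrite deriveE// E.
move=> zr; apply: is_diff_of_bound; first by move=> u; exact: cst_continuous.
move=> e e0; have dz := rd _ zr.
have [e' ae [y0 dy0 y0E]] := atlas_cover (s (m (par c z))).
pose psi x := Defs.coord e' (s (m (par c x))).
have psiz : psi z = y0 by rewrite /psi -y0E coordK.
have dm : differentiable (m \o par c) z by have [d _] := si_normal_Ck hY ac; exact: d.
have bz : \forall x \near z, ball x0 r x.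
  by apply: open_nbhs_nbhs; split=> //; exact: ball_open.
have csm : {for z, continuous (fun x => s (m (par c x)))}.
  move=> A /= nA.
  have cm := differentiable_continuous dm.
  have Wz : W (m (par c z)) by exact: hW.
  have /subspace_continuousP /(_ _ Wz A nA) nW := cs.
  apply: filterS2 bz (cm _ nW) => x xr; apply.
  exact: hW.
have ie : chart_image e' (s (m (par c z))) by exists y0.
have [_ oie _ _ _] := atlas_chart ae.
have cpsi : {for z, continuous psi}.
  by apply: continuous_comp csm _; exact: coord_continuous_at.
have near_ie : \forall x \near z, chart_image e' (s (m (par c x))).
  exact: (csm _ (open_nbhs_nbhs (conj oie ie))).
have [oe _ _ _ _] := atlas_chart ae.
have NE : \forall x \near z, (nu \o par e') (psi x) = (m \o par c) x.
  by apply: filterS2 bz near_ie => x xr ix /=; rewrite /psi (parK ae ix).2 sK//; exact: hW.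
have e20 : 0 < e / 2 by rewrite divr_gt0.
have Dz : dom e' (psi z) by rewrite psiz.
have H := @derive_lift R a b (dom e') (nu \o par e') (S \o par e') (m \o par c) psi z oe
  (si_normal_Ck hS ae) Dz (si_immersed hS ae Dz) (si_diff hS ae Dz) (si_related hS ae Dz)
  cpsi dm NE _ e20.
have dY := si_diff hY ac dz.
have H' := diff_bound dY e20.
apply: filterS (filterI H (filterI H' near_ie)) => x [h1 [h2 ix]]; rewrite subr0.
have Sx : (S \o par e') (psi x) = S (s (m (par c x))) by rewrite /= /psi (parK ae ix).2.
have Sz : (S \o par e') (psi z) = S (s (m (par c z))) by rewrite /= /psi (parK ae ie).2.
rewrite Sx Sz in h1.
have rl := si_related hY ac dz (x - z); rewrite !deriveE// in rl.
rewrite -rl in h1.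
have -> : e * `|x - z| = e / 2 * `|x - z| + e / 2 * `|x - z| by field.
have -> : g x - g z = ((Y \o par c) x - (Y \o par c) z - 'd (Y \o par c) z (x - z)) -
   (S (s (m (par c x))) - S (s (m (par c z))) - 'd (Y \o par c) z (x - z)).
  rewrite /g /=; move: ('d (Y \o par c) z (x - z)) => q.
  by apply: row3P; rewrite !(mxDE, mxNE); ring.
by apply: le_trans (ler_normB _ _) _; exact: lerD.
Qed.

End Lift.

Section Gluing.
Context {R : realType} {M D : surface R} (a b : R).
Context (Y m : M -> 'rV[R]_3) (S nu : D -> 'rV[R]_3).
Hypothesis hY : scherk_immersion a b Y m.
Hypothesis hS : scherk_immersion a b S nu.
Hypothesis cov : covering_map (@punctured_sphere R) nu.

Lemma normal_punctured p : punctured_sphere (m p).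
Proof. exact: regular_punctured_sphere (si_unit hY p) (si_regular hY p). Qed.

(** One neighbourhood [U], the image of a coordinate ball, serves all the sheets at once; this
    uniformity is what the covering property of [lift_base] requires. *)
Lemma evenly_covered_disc (p : M) : exists (U : set M) (V : set 'rV[R]_3) (sheets : set (set D)),
  [/\ open U, U p, forall q, U q -> V (m q) &
   [/\ trivIset sheets id, \bigcup_(A in sheets) A = nu @^-1` V &
    forall A, sheets A -> open A /\ exists s : 'rV[R]_3 -> D,
      [/\ forall q, U q -> {for q, continuous (s \o m)},
          forall q, U q -> A (s (m q)) /\ nu (s (m q)) = m q,
          forall d, A d -> s (nu d) = d &
          forall q q', U q -> U q' -> Y q - S (s (m q)) = Y q' - S (s (m q'))]]].
Proof.
have [_ _ ev] := cov; have [V [oV Vp [sheets [tr shV Hs]]]] := ev _ (normal_punctured p).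
have [c ac [x dx xp]] := atlas_cover p; have [oc _ _ _ _] := atlas_chart ac.
have cm := scherk_normal_continuous hY.
have N1 : \forall y \near x, V (m (par c y)).
  have NV : nbhs (m (par c x)) V by rewrite xp; exact: open_nbhs_nbhs.
  exact: (par_continuous ac dx (cm _ V NV)).
have [r /= r0 Hr] := (nbhs_ballP _ _).1 (filterI N1 (open_nbhs_nbhs (conj oc dx))).
have rd : ball x r `<=` dom c by move=> y /Hr[].
pose U := par c @` ball x r.
have oU : open U by exact: (open_chart_image ac (ball_open x r) rd).
have UV q : U q -> V (m q) by move=> [y yr <-]; exact: (Hr y yr).1.
exists U, V, sheets; split=> //; first by exists x => //; exact: ballxx.
split=> // A shA; have [oA [s [cs sA sK]]] := Hs A shA; split=> //.
exists s.
have VB q : U q -> (V `&` @punctured_sphere R) (m q).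
  by move=> Uq; split; [exact: UV|exact: normal_punctured].
split.
- move=> q Uq W nW; have /subspace_continuousP /(_ _ (VB _ Uq) W nW) nsW := cs.
  apply: filterS2 (open_nbhs_nbhs (conj oU Uq)) (cm q _ nsW) => q' Uq'; apply.
  exact: VB.
- by move=> q Uq; have [] := sA _ (VB _ Uq).
- exact: sK.
- move=> _ _ [y yr <-] [y' yr' <-].
  apply: (lift_difference_constant hY hS ac rd _ cs _ yr yr').
    by move=> z zr; apply: VB; exists z.
  by move=> w /sA[].
Qed.

(* A level set of the difference [Y - S] on the fibre product of the Gauss maps. *)
Definition lift_set : set (M * D) := [set q | m q.1 = nu q.2 /\ Y q.1 = S q.2].

Definition lift_base (q : lift_set) : M := (set_val q).1.
Definition lift_map (q : lift_set) : D := (set_val q).2.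

Lemma lift_eq (q : lift_set) : m (lift_base q) = nu (lift_map q) /\ Y (lift_base q) = S
  (lift_map q).
Proof. exact: (set_valP q). Qed.

Lemma lift_intro p d : m p = nu d -> Y p = S d ->
  exists q : lift_set, lift_base q = p /\ lift_map q = d.
Proof.
move=> h h'; have H : (p, d) \in lift_set by rewrite inE.
by exists (SigSub H).
Qed.

Lemma lift_inj (q q' : lift_set) : lift_base q = lift_base q' -> lift_map q = lift_map q' ->
  q = q'.
Proof.
by move=> h1 h2; apply: val_inj; exact: injective_projections.
Qed.

Lemma continuous_lift_base : continuous lift_base.
Proof.
move=> q; apply: continuous_comp; first exact: initial_continuous.
exact: cvg_fst.
Qed.

Lemma continuous_lift_map : continuous lift_map.
Proof.
move=> q; apply: continuous_comp; first exact: initial_continuous.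
exact: cvg_snd.
Qed.

Lemma nbhs_lift (q : lift_set) (W : set lift_set) : nbhs q W ->
  exists2 B : set (M * D), nbhs (lift_base q, lift_map q) B &
    forall q' : lift_set, B (lift_base q', lift_map q') -> W q'.
Proof.
rewrite nbhsE => -[W' [[B oB BE] W'q] W'W].
exists B.
  apply: open_nbhs_nbhs; split=> //.
  by move: W'q; rewrite -BE /lift_base /lift_map /=; case: (set_val q).
move=> q' Bq'; apply: W'W; rewrite -BE /=.
by move: Bq'; rewrite /lift_base /lift_map /=; case: (set_val q').
Qed.

(** Over [U] the difference [Y - S] is constant along each lift, so a point of the level set above
    one point of [U] propagates to all of [U]. The image is therefore open and closed. *)
Lemma lift_base_surjective p0 d0 : m p0 = nu d0 -> Y p0 = S d0 ->
  lift_base @` setT = [set: M].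
Proof.
move=> mp0 Yp0.
have key p : exists U : set M, [/\ open U, U p &
    forall q q', U q -> U q' -> range lift_base q -> range lift_base q'].
  have [U [V [sheets [oU Up UV [_ shV Hs]]]]] := evenly_covered_disc p.
  exists U; split=> // q q' Uq Uq' [l _ lq].
  have [ml Yl] := lift_eq l; rewrite lq in ml Yl.
  have : (nu @^-1` V) (lift_map l) by rewrite /= -ml; exact: UV.
  rewrite -shV => -[A shA Al]; have [_ [s [_ sA sK sY]]] := Hs A shA.
  have sq : s (m q) = lift_map l by rewrite ml sK.
  have [_ nuq'] := sA _ Uq'.
  have [|l' [lq' _]] := @lift_intro q' (s (m q')) (esym nuq').
    apply/eqP; rewrite -subr_eq0; apply/eqP.
    by rewrite -(sY _ _ Uq Uq') sq Yl subrr.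
  by exists l'.
apply: clopen_surface.
- rewrite openE => p Rp; have [U [oU Up HU]] := key p.
  by apply: (near_open oU Up) => q Uq; exact: HU Rp.
- rewrite openE => p Rp; have [U [oU Up HU]] := key p.
  by apply: (near_open oU Up) => q Uq /= Rq; apply: Rp; exact: HU Rq.
- have [l [lp _]] := lift_intro mp0 Yp0.
  by exists p0, l.
Qed.

Lemma lift_base_covering p0 d0 : m p0 = nu d0 -> Y p0 = S d0 ->
  covering_map [set: M] lift_base.
Proof.
move=> mp0 Yp0; split.
- exact: continuous_lift_base.
- exact: lift_base_surjective Yp0.
move=> p _; have [U [V [sheets [oU Up UV [tr shV Hs]]]]] := evenly_covered_disc p.
exists U; split=> //.
pose sh A : set lift_set := [set l | U (lift_base l) /\ A (lift_map l)].
(* A sheet [A] of [nu] carries either a full copy of [U] in the level set or no point of it; only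
   the sheets of the first kind are kept. *)
exists [set B | exists A, [/\ sheets A, sh A !=set0 & B = sh A]]; split.
- move=> _ _ [A [shA _ ->]] [A' [shA' _ ->]] [l [[_ Al] [_ Al']]].
  by rewrite (tr A A' shA shA')//; exists (lift_map l).
- apply/seteqP; split=> [l [_ [A [_ _ ->]] []]//|l /= Ul].
  have : (nu @^-1` V) (lift_map l) by rewrite /= -(lift_eq l).1; exact: UV.
  rewrite -shV => -[A shA Al]; exists (sh A) => //.
  by exists A; split=> //; exists l.
move=> _ [A [shA [l0 [Ul0 Al0]] ->]]; have [oA [s [cs sA sK sY]]] := Hs A shA.
have E l : sh A l -> lift_map l = s (m (lift_base l)).
  by move=> [_ Al]; rewrite (lift_eq l).1 sK.
split.
  rewrite openE => l [Ul Al].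
  have n1 : \forall l' \near l, U (lift_base l').
    exact: (continuous_lift_base (open_nbhs_nbhs (conj oU Ul))).
  have n2 : \forall l' \near l, A (lift_map l').
    exact: (continuous_lift_map (open_nbhs_nbhs (conj oA Al))).
  exact: filterI n1 n2.
(* [l0] is a default value for points outside [U], where nothing is claimed about the section. *)
have ex q : exists l : lift_set, U q -> lift_base l = q /\ lift_map l = s (m q).
  have [Uq|nUq] := pselect (U q); last by exists l0.
  have [_ nuq] := sA _ Uq.
  have [|l [h1 h2]] := @lift_intro q (s (m q)) (esym nuq); last by exists l.
  apply/eqP; rewrite -subr_eq0; apply/eqP.
  by rewrite -(sY _ _ Ul0 Uq) -(E l0)// (lift_eq l0).2 subrr.
have [sec Hsec] := choice ex.
exists sec; split.
- rewrite setIT continuous_open_subspace// => q /[!inE] Uq W nW.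
  have [B nB BW] := nbhs_lift nW.
  have [h1 h2] := Hsec q Uq; rewrite h1 h2 in nB.
  have cpair : {for q, continuous (fun q => (q, s (m q)))}.
    by apply: cvg_pair; [exact: cvg_id|exact: cs].
  apply: filterS2 (open_nbhs_nbhs (conj oU Uq)) (cpair _ nB) => q' Uq' Bq'.
  by apply: BW; have [-> ->] := Hsec q' Uq'.
- move=> q [Uq _]; have [h1 h2] := Hsec q Uq.
  by split=> //; split; rewrite ?h1// h2; exact: (sA _ Uq).1.
- move=> l Al; have [h1 h2] := Hsec _ Al.1.
  by apply: lift_inj => //; rewrite h2 -E.
Qed.

(** Openness: a point [d] near [lift_map l] has a normal close to that of [l], which [m] attains at
    some point near [lift_base l], and constancy of [Y - S] puts the pair in the level set.
    Injectivity: the base points of two pairs with the same [d] have the same value of [m], which is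
    locally injective. *)
Lemma lift_map_local_homeomorphism : local_homeomorphism lift_map.
Proof.
have cm := scherk_normal_continuous hY; have cnu := scherk_normal_continuous hS.
split; first exact: continuous_lift_map.
- move=> W oW; rewrite openE => _ [l Wl <-].
  have [B [[U1 E1] /= [nU1 nE1] UE] BW] := nbhs_lift (open_nbhs_nbhs (conj oW Wl)).
  have [U [V [sheets [oU Up UV [tr shV Hs]]]]] := evenly_covered_disc (lift_base l).
  have [ml Yl] := lift_eq l.
  have : (nu @^-1` V) (lift_map l) by rewrite /= -ml; exact: UV.
  rewrite -shV => -[A shA Al]; have [oA [s [_ sA sK sY]]] := Hs A shA.
  have [c ac [x dx xl]] := atlas_cover (lift_base l).
  have [oc _ _ _ _] := atlas_chart ac.
  have N : \forall y \near x, U1 (par c y) /\ U (par c y).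
    have n1 : nbhs (par c x) (U1 `&` U) by rewrite xl; apply: filterI => //;
      exact: open_nbhs_nbhs.
    exact: (par_continuous ac dx n1).
  have [r /= r0 Hr] := (nbhs_ballP _ _).1 N.
  have [e e0 He] := @sphere_open_map R (dom c) (ball x r) (m \o par c) x oc (ball_open x r)
    (si_normal_Ck hY ac) (fun y _ => si_unit hY (par c y)) (si_immersed hY ac) dx (ballxx x r0).
  have ne : \forall d \near lift_map l, `|nu (lift_map l) - nu d| <= e / 2.
    exact: ((continuous_normP _ _).1 (cnu (lift_map l)) _ (divr_gt0 e0 (ltr0n _ 2))).
  apply: filterS (filterI ne (filterI nE1 (open_nbhs_nbhs (conj oA Al)))) => d [de [E1d Ad]].
  have mde : `|(m \o par c) x - nu d| < e.
    by rewrite /= xl ml; apply: le_lt_trans de _; rewrite ltr_pdivrMr// ltr_pMr ?ltr1n.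
  have [y [dy yr my]] := He _ (si_unit hS d) mde.
  have [U1y Uy] := Hr y yr.
  have [|l' [h1 h2]] := lift_intro (my : m (par c y) = nu d).
    apply/eqP; rewrite -subr_eq0; apply/eqP.
    rewrite -(sK _ Ad) -[nu d]my /= -(sY _ _ Up Uy).
    by rewrite ml sK// Yl subrr.
  exists l' => //; apply: BW; rewrite h1 h2; exact: UE.
- move=> l; have [c ac [x dx xl]] := atlas_cover (lift_base l).
  have [oc _ _ _ _] := atlas_chart ac.
  have [C [r [C0 r0 rd lip]]] :=
    immersion_lipschitz oc (si_normal_Ck hY ac) dx (si_immersed hY ac dx).
  have oI := open_chart_image ac (ball_open x r) rd.
  exists (lift_base @^-1` (par c @` ball x r)).
    split; last by exists x => //; exact: ballxx.
    by apply: open_comp => // l' _; exact: continuous_lift_base.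
  move=> l1 l2 /[!inE] /=.
  move=> [x1 r1 E1] [x2 r2 E2] E.
  apply: lift_inj => //; rewrite -E1 -E2; congr (par c _).
  apply/eqP; rewrite -subr_eq0 -normr_le0.
  apply: le_trans (lip _ _ r1 r2) _.
  rewrite /= E1 E2 (lift_eq l1).1 (lift_eq l2).1 E subrr normr0 mulr0.
  exact: lexx.
Qed.

End Gluing.

Lemma scherk_immersion_part_of (R : realType) (M D : surface R) (a b : R)
    (Y m : M -> 'rV[R]_3) (S nu : D -> 'rV[R]_3) p0 d0 :
  scherk_immersion a b Y m -> scherk_immersion a b S nu ->
  covering_map (@punctured_sphere R) nu -> m p0 = nu d0 -> Y p0 = S d0 -> part_of Y S.
Proof.
move=> hY hS cov mp0 Yp0.
exists (lift_set Y m S nu), (@lift_base _ _ _ Y m S nu), (@lift_map _ _ _ Y m S nu); split.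
- exact: (lift_base_covering hY hS cov mp0 Yp0).
- exact: (lift_map_local_homeomorphism hY hS cov).
- by move=> q; exact: (lift_eq q).2.
Qed.

Lemma scherk_immersion_translate (R : realType) (M : surface R) (a b : R)
    (Y m : M -> 'rV[R]_3) t :
  scherk_immersion a b Y m -> scherk_immersion a b (fun p => Y p + t) m.
Proof.
move=> [h1 h2 h3 h4 h5 h6]; split.
- exact: h1.
- exact: h2.
- exact: h3.
- exact: h4.
- by move=> c ac x dx; apply: differentiableD; [exact: h5|exact: differentiable_cst].
- move=> c ac x dx v; apply: (etrans _ (h6 c ac x dx v)).
  have dt : differentiable (fun _ : 'rV[R]_2 => t) x by exact: differentiable_cst.
  apply: (etrans (deriveD_fun v (h5 c ac x dx) dt)).
  by rewrite derive_cst addr0.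
Qed.

Theorem theorem2p1 (R : realType)
    (* the associate family of Scherk's surfaces *)
    (D : surface R) (S : R -> D -> 'rV[R]_3)
    (hS : scherk_associate_family S)
    (* the minimal surface *)
    (M : surface R) (X : M -> 'rV[R]_3) (hX : minimal_immersion X)
    (n : M -> 'rV[R]_3) (hn : gauss_map X n)
    (K : M -> R) (hK : gauss_curvature X K) (K_lt0 : forall p, K p < 0)
    (V1 V2 : 'rV[R]_3) (hV1 : enorm V1 = 1) (hV2 : enorm V2 = 1)
    (hV12 : dot V1 V2 = 0)
    (hconst : exists k : R, forall p : M,
       let w := (1 - dot (n p) V1 ^+ 2) * (1 - dot (n p) V2 ^+ 2) / (- K p) in
       0 < w -> ln w = k) :
  exists theta : R, 0 <= theta <= pi / 2 /\
  exists lambda : R, 0 < lambda /\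
  exists f : 'rV[R]_3 -> 'rV[R]_3, euclidean_isometry f /\
    part_of (fun p => f (lambda *: X p)) (S theta).
Proof.
(* The empty space counts as connected; it has no base point to start from, but it is trivially a
   part of any surface. *)
have [[p0 _]|M0] := pselect ([set: M] !=set0); last first.
  have no (p : M) : False by apply: M0; exists p.
  exists 0; split; first by rewrite lexx divr_ge0// pi_ge0.
  exists 1; split=> //; exists id; split=> //.
  exists M, id, (fun p => match no p with end); split.
  - split; [by move=> p|exact: image_id|by move=> p; case: (no p)].
  - split=> [p|U oU|p]; [by case: (no p)| |by case: (no p)].
    by rewrite openE => d [p]; case: (no p).
  - by move=> p; case: (no p).
have [_ [nu [dh [cov sf HS]]]] := hS.
have [theta [l [t01 l0 [f [m [iso si]]]]]] :=
  minimal_scherk_immersion hX hn hK K_lt0 hV1 hV2 hV12 hconst p0.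
exists theta; split=> //; exists l; split=> //.
have [mS wS] := HS theta t01.
have siS := scherk_family_immersion cov sf mS wS.
have [_ nuB _] := cov.
have : punctured_sphere (m p0).
  exact: regular_punctured_sphere (si_unit si p0) (si_regular si p0).
rewrite -nuB => -[d0 _ d0E].
(* The translation brings the image of [p0] to [S theta d0], where [d0] has the same normal, so that
   the level set contains the pair [(p0, d0)]. *)
exists (fun y => f y + (S theta d0 - f (l *: X p0))); split; first exact: iso.
apply: (scherk_immersion_part_of (scherk_immersion_translate _ si) siS cov (esym d0E)).
by rewrite addrC subrK.
Qed.
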